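(* Let $\mathbb{K}=\mathbb{R}$ or $\mathbb{K}=\mathbb{C}$, let $n\ge 2$ be an integer and let $X=(\mathbb{K}^n,\|\cdot\|_X)$ be a normed space over $\mathbb{K}$. Then $X$ satisfies $\lambda(X)=\delta_{\mathbb{K}}(n)$ if and only if there exist a maximal ETF $w_1,\ldots,w_d\in\mathbb{K}^n$ (where $d=d_{\mathbb{K}}(n)$) and a linear transformation $T:\mathbb{K}^n\to\mathbb{K}^n$ such that $$\operatorname{absconv}\{w_1,\ldots,w_d\}\subseteq T(B_{X^*})\subseteq \frac{n}{d\,\delta_{\mathbb{K}}(n)}\,Z(w_1,\ldots,w_d).$$
   Context: $\langle\cdot,\cdot\rangle$ is the standard inner product on $\mathbb{K}^n$ (linear in the first variable, conjugate-linear in the second). The dual unit ball of $X$ is regarded as a subset of $\mathbb{K}^n$ via the inner product: $B_{X^*}=\{y\in\mathbb{K}^n: |\langle x,y\rangle|\le 1\text{ for all }x\text{ with }\|x\|_X\le 1\}$. Projection constants: for a linear subspace $Y$ of a normed space $Z$ over $\mathbb{K}$, $\lambda(Y,Z)$ is the infimum of $\|P\|$ over all linear projections $P:Z\to Y$ onto $Y$. The absolute projection constant $\lambda(X)$ is the supremum of $\lambda(S(X),Z)$ over all normed spaces $Z$ over $\mathbb{K}$ and all linear isometric embeddings $S:X\to Z$. Define $$\delta_{\mathbb{R}}(n)=\frac{2}{n+1}\left(1+\frac{n-1}{2}\sqrt{n+2}\right),\qquad \delta_{\mathbb{C}}(n)=\frac1n\left(1+(n-1)\sqrt{n+1}\right),$$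 $$d_{\mathbb{R}}(n)=\frac{n(n+1)}{2},\qquad d_{\mathbb{C}}(n)=n^2.$$ A set of pairwise distinct (Euclidean) unit vectors $w_1,\ldots,w_m\in\mathbb{K}^n$ is equiangular if $|\langle w_i,w_j\rangle|$ is constant over all $1\le i<j\le m$. It is an equiangular tight frame (ETF) if in addition it is a tight frame, i.e. for some constant $\alpha$ one has $x=\alpha\sum_{i=1}^m\langle x,w_i\rangle w_i$ for every $x\in\mathbb{K}^n$. A maximal ETF in $\mathbb{K}^n$ is an ETF consisting of exactly $d_{\mathbb{K}}(n)$ vectors. $\operatorname{absconv}C=\{\sum_{j=1}^N\alpha_jx_j: N\ge1,\ x_j\in C,\ \alpha_j\in\mathbb{K},\ \sum_{j=1}^N|\alpha_j|\le1\}$, and $Z(x_1,\ldots,x_N)=\{a_1x_1+\ldots+a_Nx_N: a_i\in\mathbb{K},\ |a_i|\le 1\text{ for }1\le i\le N\}$. *)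

(* Defs.v *)
From HB Require Import structures.
From mathcomp Require Import all_boot all_order all_algebra.
From mathcomp Require Import complex.
From mathcomp Require Import boolp classical_sets functions reals ereal.
From mathcomp Require Import topology normedtype.

Set Implicit Arguments.
Unset Strict Implicit.
Unset Printing Implicit Defensive.

Import Order.TTheory GRing.Theory Num.Theory.
Import numFieldNormedType.Exports.

Local Open Scope classical_set_scope.
Local Open Scope ring_scope.

Inductive scalar_kind := Reals | Complexes.

Definition scalars (R : realType) (k : scalar_kind) : numFieldType :=
  match k with
  | Reals => R
  | Complexes => R[i]
  end.

Definition conjK (R : realType) (k : scalar_kind) :
    scalars R k -> scalars R k :=
  match k with
  | Reals => fun x => x
  | Complexes => fun z : R[i] => conjc z
  end.

Definition of_real (R : realType) (k : scalar_kind) : R -> scalars R k :=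
  match k with
  | Reals => fun x => x
  | Complexes => fun x : R => (x +i* 0)%C
  end.

Definition real_part (R : realType) (k : scalar_kind) : scalars R k -> R :=
  match k with
  | Reals => fun x => x
  | Complexes => fun z : R[i] => complex.Re z
  end.

Arguments conjK {R k}.
Arguments of_real {R} k.
Arguments real_part {R k}.

Definition delta (R : realType) (k : scalar_kind) (n : nat) : R :=
  match k with
  | Reals =>
      2 / (n%:R + 1) * (1 + (n%:R - 1) / 2 * Num.sqrt (n%:R + 2))
  | Complexes =>
      n%:R^-1 * (1 + (n%:R - 1) * Num.sqrt (n%:R + 1))
  end.

Definition dmax (k : scalar_kind) (n : nat) : nat :=
  match k with
  | Reals => ((n * (n + 1)) %/ 2)%N
  | Complexes => (n ^ 2)%N
  end.

Definition inner (R : realType) (k : scalar_kind) (n : nat)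
    (x y : 'rV[scalars R k]_n) : scalars R k :=
  \sum_(i < n) x 0 i * conjK (y 0 i).

(* As for [normedModType], a norm over K takes its values in K.  Over R[i],
   [a <= b] entails that [b - a] is real, so that these axioms force
   [N x] to be a nonnegative real number. *)
Definition is_norm (K : numFieldType) (V : lmodType K) (N : V -> K) : Prop :=
  [/\ forall x y, N (x + y) <= N x + N y,
      forall (a : K) x, N (a *: x) = `|a| * N x
    & forall x, N x = 0 -> x = 0].

Definition dual_ball (R : realType) (k : scalar_kind) (n : nat)
    (N : 'rV[scalars R k]_n -> scalars R k) : set 'rV[scalars R k]_n :=
  [set y | forall x, N x <= 1 -> `|inner x y| <= 1].

(* Equal to +oo when P is unbounded. *)
Definition op_norm (R : realType) (k : scalar_kind)
    (Z : normedModType (scalars R k)) (P : Z -> Z) : \bar R :=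
  ereal_sup [set (real_part `|P z|)%:E | z in [set z | `|z| <= 1]].

Definition projection_onto (K : numFieldType) (Z : lmodType K) (Y : set Z)
    (P : {linear Z -> Z}) : Prop :=
  range P = Y /\ forall y, Y y -> P y = y.

Definition proj_const (R : realType) (k : scalar_kind)
    (Z : normedModType (scalars R k)) (Y : set Z) : \bar R :=
  ereal_inf [set r | exists P : {linear Z -> Z},
                       projection_onto Y P /\ r = op_norm P].

(* [lambda N] is the absolute projection constant of K^n normed by [N]. *)
Definition lambda (R : realType) (k : scalar_kind) (n : nat)
    (N : 'rV[scalars R k]_n -> scalars R k) : \bar R :=
  ereal_sup [set r | exists (Z : normedModType (scalars R k))
                            (S : {linear 'rV[scalars R k]_n -> Z}),
                       (forall x, `|S x| = N x) /\ r = proj_const (range S)].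

Definition equiangular (R : realType) (k : scalar_kind) (n m : nat)
    (w : 'I_m -> 'rV[scalars R k]_n) : Prop :=
  [/\ injective w,
      forall i, inner (w i) (w i) = 1
    & exists c : scalars R k,
        forall i j : 'I_m, (i < j)%N -> `|inner (w i) (w j)| = c].

Definition tight_frame (R : realType) (k : scalar_kind) (n m : nat)
    (w : 'I_m -> 'rV[scalars R k]_n) : Prop :=
  exists alpha : scalars R k,
    forall x, x = alpha *: \sum_(i < m) inner x (w i) *: w i.

Definition ETF (R : realType) (k : scalar_kind) (n m : nat)
    (w : 'I_m -> 'rV[scalars R k]_n) : Prop :=
  equiangular w /\ tight_frame w.

Definition maximal_ETF (R : realType) (k : scalar_kind) (n : nat)
    (w : 'I_(dmax k n) -> 'rV[scalars R k]_n) : Prop :=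
  ETF w.

Definition absconv (K : numFieldType) (V : lmodType K) (C : set V) : set V :=
  [set v | exists (N : nat) (a : 'I_N -> K) (x : 'I_N -> V),
     [/\ (1 <= N)%N, forall j, C (x j), \sum_(j < N) `|a j| <= 1
       & v = \sum_(j < N) a j *: x j]].

Definition zonotope (K : numFieldType) (V : lmodType K) (N : nat)
    (x : 'I_N -> V) : set V :=
  [set v | exists a : 'I_N -> K,
     (forall i, `|a i| <= 1) /\ v = \sum_(i < N) a i *: x i].

(* Main.v *)
Require Import Defs.
From HB Require Import structures.
From mathcomp Require Import all_boot all_order all_algebra.
From mathcomp Require Import complex.
From mathcomp Require Import ring lra.
From mathcomp Require Import boolp classical_sets functions reals ereal.
From mathcomp Require Import topology normedtype sequences.

Set Implicit Arguments.
Unset Strict Implicit.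
Unset Printing Implicit Defensive.

Import Order.TTheory GRing.Theory Num.Theory.

Local Open Scope classical_set_scope.
Local Open Scope ring_scope.

(* By trace duality, an embedded copy of [X] admits a projection of norm at most
   [L] unless some matrix [A] with [|tr A| > L] satisfies
   [N (w A) <= \sum_l m_l |<w, y_l>|] for finitely many [y_l] in the dual ball
   and weights [m_l] of sum at most 1.  Put the form [\sum_l m_l y_l^* y_l] in
   isotropic position: with [v_l] the new vectors,
   [|tr A| <= \sum_ij m_i m_j |<v_i, v_j>|].  Writing [u] for the cosine of
   [v_i] and [v_j], this energy is at most [delta n] by the inequality
   [u <= a + b u^2 - e u^4] on [0, 1], tight at [u = 1] and at the angle [c] of
   a maximal ETF, because the fourth moment is bounded below by a Sidelnikov-type
   inequality and the term in [u^2] is at most 1.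

   Equality forces all the [v_l] to have norm [sqrt n] and all cosines to lie in
   [{c, 1}], hence the [v_l] form a maximal ETF up to phases.  Optimal
   certificates exist: in a nearly optimal one the points lie close to boundedly
   many lines, so they can be merged and a limit taken.  Conversely, the zonotope
   inclusion yields a superspace of [X] of dimension [d] on which a trace
   argument bounds every projection from below by [delta n]. *)

(** * Scalars and vectors *)

(** The [v_l] have no common length, while the energy has degree one in each of them. Every moment
    is therefore brought to the weight [|v_i| |v_j|], and [B = \sum_l m_l |v_l|], with [B^2 <= n],
    enters beside the cosines. Only even moments are controlled, so the majorant has no cubic term:
    double contact at [c] and contact at 1 force the last root [- 1 - 2 c], and the coefficient of
    [u] then fixes [e].

    Trace duality gives only nearly optimal certificates, with no bound on their number of points,
    so that an equality case alone would not apply. The energy inequality keeps its slack: near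
    equality, most pairs have a cosine close to [c] or 1.

    At an optimal certificate the trace bound is tight term by term, which forces the operator to be
    [delta n / n] times the identity. Dualising the certificate writes [(delta n / n) z], for [z] in
    the dual ball, as a combination of the [y_l] with coefficients of modulus at most [m_l]. Each
    line carries mass [1 / d]; collecting coefficients by lines gives the zonotope with the factor
    [n / (d delta)]. *)

Section Scalars.
Variables (R : realType) (k : scalar_kind).
Local Notation K := (scalars R k).
Local Notation ofR := (@of_real R k).

Fact conjK_is_zmod_morphism : zmod_morphism (@conjK R k).
Proof. by case: k => //= x y; exact: rmorphB. Qed.

Fact conjK_is_monoid_morphism : monoid_morphism (@conjK R k).
Proof. by case: k => //=; split; [exact: rmorph1|exact: rmorphM]. Qed.

HB.instance Definition _ := GRing.isZmodMorphism.Build K K (@conjK R k)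
  conjK_is_zmod_morphism.
HB.instance Definition _ := GRing.isMonoidMorphism.Build K K (@conjK R k)
  conjK_is_monoid_morphism.

Fact of_real_is_zmod_morphism : zmod_morphism (@of_real R k).
Proof. by case: k => //= x y; exact: (rmorphB (real_complex R)). Qed.

Fact of_real_is_monoid_morphism : monoid_morphism (@of_real R k).
Proof.
case: k => //=; split=> //; exact: (rmorphM (real_complex R)).
Qed.

HB.instance Definition _ := GRing.isZmodMorphism.Build R K (@of_real R k)
  of_real_is_zmod_morphism.
HB.instance Definition _ := GRing.isMonoidMorphism.Build R K (@of_real R k)
  of_real_is_monoid_morphism.

Fact real_part_is_zmod_morphism : zmod_morphism (@real_part R k).
Proof. by case: k => //= -[x1 x2] [y1 y2]. Qed.

HB.instance Definition _ := GRing.isZmodMorphism.Build K R (@real_part R k)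
  real_part_is_zmod_morphism.

Lemma conjKK : involutive (@conjK R k).
Proof. by case: k => //=; exact: conjcK. Qed.

Lemma conjK_of_real (a : R) : conjK (ofR a : K) = ofR a.
Proof. by case: k => //=; exact: conjc_real. Qed.

Lemma of_realK (a : R) : real_part (ofR a : K) = a.
Proof. by case: k. Qed.

Lemma of_real_inj : injective (@of_real R k).
Proof. exact: can_inj of_realK. Qed.

Lemma real_part_conj (z : K) : real_part (conjK z) = real_part z.
Proof. by case: k z => //= -[]. Qed.

Lemma real_partZ (a : R) (z : K) : real_part (ofR a * z) = a * real_part z.
Proof. by case: k z => //= -[x y] /=; rewrite mul0r subr0. Qed.

Lemma ler_of_real (a b : R) : ((ofR a : K) <= ofR b) = (a <= b).
Proof. by case: k => //=; exact: lecR. Qed.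

Lemma of_real_nat (n : nat) : ofR n%:R = n%:R :> K.
Proof. exact: rmorph_nat. Qed.

Definition absK (z : K) : R := real_part `|z|.

Lemma normKE (z : K) : `|z| = ofR (absK z).
Proof.
rewrite /absK; by case: k z => //= z; rewrite normc_def.
Qed.

Lemma ge0_of_real (z : K) : 0 <= z -> z = ofR (real_part z).
Proof. by move=> z0; rewrite -{1}(ger0_norm z0) normKE -[in RHS](ger0_norm z0). Qed.

Lemma mulz_conj (z : K) : z * conjK z = ofR (absK z ^+ 2).
Proof.
rewrite rmorphXn /= -normKE; case: k z => //= z; last by rewrite sqr_normc.
by rewrite real_normK ?num_real.
Qed.

Lemma absK_ge0 (z : K) : 0 <= absK z.
Proof. by rewrite -ler_of_real -normKE rmorph0. Qed.

Lemma absK_eq0 (z : K) : (absK z == 0) = (z == 0).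
Proof. by rewrite -(inj_eq of_real_inj) -normKE rmorph0 normr_eq0. Qed.

Lemma absK0 : absK 0 = 0.
Proof. by apply/eqP; rewrite absK_eq0. Qed.

Lemma absKM (x y : K) : absK (x * y) = absK x * absK y.
Proof. by apply: of_real_inj; rewrite rmorphM /= -!normKE normrM. Qed.

Lemma absKD (x y : K) : absK (x + y) <= absK x + absK y.
Proof. by rewrite -ler_of_real rmorphD /= -!normKE ler_normD. Qed.

Lemma absKN (x : K) : absK (- x) = absK x.
Proof. by apply: of_real_inj; rewrite -!normKE normrN. Qed.

Lemma absK_sum (I : Type) (r : seq I) (P : pred I) (F : I -> K) :
  absK (\sum_(i <- r | P i) F i) <= \sum_(i <- r | P i) absK (F i).
Proof.
elim/big_rec2 : _ => [|i y x _ le]; first by rewrite absK0.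
by rewrite (le_trans (absKD _ _)) // lerD2l.
Qed.

Lemma absK_of_real (a : R) : absK (ofR a) = `|a|.
Proof.
apply/eqP; rewrite -(@eqrXn2 _ 2) ?absK_ge0 //; apply/eqP.
apply: of_real_inj.
by rewrite -mulz_conj conjK_of_real -rmorphM -expr2 real_normK ?num_real.
Qed.

Lemma absK1 : absK 1 = 1.
Proof. by rewrite -(rmorph1 (@of_real R k)) absK_of_real normr1. Qed.

Lemma absK_conj (z : K) : absK (conjK z) = absK z.
Proof.
apply/eqP; rewrite -(@eqrXn2 _ 2) ?absK_ge0 //; apply/eqP.
by apply: of_real_inj; rewrite -!mulz_conj conjKK mulrC.
Qed.

Lemma real_part_le (z : K) : real_part z <= absK z.
Proof.
rewrite /absK; case: k z => /= z; first exact: ler_norm.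
case: z => x y; have := normc_ge_Re (Complex x y); rewrite normc_def lecR.
exact: (le_trans (ler_norm x)).
Qed.

Lemma absK_le_real (z : K) (a : R) : (`|z| <= ofR a) = (absK z <= a).
Proof. by rewrite normKE ler_of_real. Qed.

Lemma absK_inv (z : K) : absK z^-1 = (absK z)^-1.
Proof. by apply: of_real_inj; rewrite fmorphV /= -!normKE normfV. Qed.

Lemma absK_phase (z : K) : exists2 t : K, absK t = 1 & t * z = ofR (absK z).
Proof.
have [->|z0] := eqVneq z 0.
  by exists 1; rewrite ?absK1 // mulr0 absK0 rmorph0.
have a0 : absK z != 0 by rewrite absK_eq0.
exists (conjK z / ofR (absK z)).
  by rewrite absKM absK_inv absK_conj absK_of_real ger0_norm ?absK_ge0 // divff.
rewrite mulrAC [conjK z * z]mulrC mulz_conj -fmorphV -rmorphM.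
by rewrite expr2 mulfK.
Qed.

Lemma real_part_eq_abs (z : K) : real_part z = absK z -> z = ofR (absK z).
Proof.
rewrite /absK; case: k z => /= z; first by [].
case: z => x y /= xE.
have : x ^+ 2 = x ^+ 2 + y ^+ 2.
  by rewrite {1}xE sqr_sqrtr // addr_ge0 ?sqr_ge0.
move/eqP; rewrite -subr_eq0 opprD addrA subrr sub0r oppr_eq0 sqrf_eq0 => /eqP y0.
by rewrite -xE y0.
Qed.

End Scalars.

(** * Inner product, Euclidean norm and adjoint *)

Section Vectors.
Variables (R : realType) (k : scalar_kind).
Local Notation K := (scalars R k).
Local Notation ofR := (@of_real R k).

Section Inner.
Variable n : nat.
Implicit Types x y z : 'rV[K]_n.

Lemma innerDl x y z : inner (x + y) z = inner x z + inner y z.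
Proof. by rewrite -big_split; apply: eq_bigr => i _; rewrite mxE mulrDl. Qed.

Lemma innerZl a x z : inner (a *: x) z = a * inner x z.
Proof. by rewrite mulr_sumr; apply: eq_bigr => i _; rewrite mxE mulrA. Qed.

Lemma inner_conj x y : conjK (inner x y) = inner y x.
Proof.
by rewrite rmorph_sum; apply: eq_bigr => i _; rewrite rmorphM /= conjKK mulrC.
Qed.

Lemma innerDr x y z : inner x (y + z) = inner x y + inner x z.
Proof. by rewrite -inner_conj innerDl rmorphD /= !inner_conj. Qed.

Lemma innerZr a x y : inner x (a *: y) = conjK a * inner x y.
Proof. by rewrite -inner_conj innerZl rmorphM /= inner_conj. Qed.

Lemma inner0l x : inner 0 x = 0.
Proof. by rewrite -(scale0r 0) innerZl mul0r. Qed.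

Lemma inner0r x : inner x 0 = 0.
Proof. by rewrite -inner_conj inner0l rmorph0. Qed.

Lemma innerNl x y : inner (- x) y = - inner x y.
Proof. by rewrite -scaleN1r innerZl mulN1r. Qed.

Lemma innerNr x y : inner x (- y) = - inner x y.
Proof. by rewrite -inner_conj innerNl rmorphN /= inner_conj. Qed.

Lemma innerBl x y z : inner (x - y) z = inner x z - inner y z.
Proof. by rewrite innerDl innerNl. Qed.

Lemma innerBr x y z : inner x (y - z) = inner x y - inner x z.
Proof. by rewrite innerDr innerNr. Qed.

Lemma inner_suml (I : Type) (r : seq I) (P : pred I) (F : I -> 'rV[K]_n) y :
  inner (\sum_(i <- r | P i) F i) y = \sum_(i <- r | P i) inner (F i) y.
Proof.
by elim/big_rec2 : _ => [|i u v _ <-]; rewrite ?inner0l // innerDl.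
Qed.

Lemma inner_sumr (I : Type) (r : seq I) (P : pred I) (F : I -> 'rV[K]_n) y :
  inner y (\sum_(i <- r | P i) F i) = \sum_(i <- r | P i) inner y (F i).
Proof.
by elim/big_rec2 : _ => [|i u v _ <-]; rewrite ?inner0r // innerDr.
Qed.

Lemma inner_delta x i : inner x (delta_mx 0 i) = x 0 i.
Proof.
rewrite /inner (bigD1 i) //= big1 ?addr0 => [|j ji].
  by rewrite mxE !eqxx rmorph1 mulr1.
by rewrite mxE (negbTE ji) andbF rmorph0 mulr0.
Qed.

Lemma inner_deltal x i : inner (delta_mx 0 i) x = conjK (x 0 i).
Proof. by rewrite -inner_conj inner_delta. Qed.

Definition sqn x : R := real_part (inner x x).

Lemma sqnE x : sqn x = \sum_i absK (x 0 i) ^+ 2.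
Proof.
rewrite /sqn raddf_sum; apply: eq_bigr => i _.
by rewrite mulz_conj /= of_realK.
Qed.

Lemma inner_sqn x : inner x x = ofR (sqn x).
Proof.
rewrite sqnE rmorph_sum; apply: eq_bigr => i _.
by rewrite mulz_conj.
Qed.

Lemma sqn_ge0 x : 0 <= sqn x.
Proof. by rewrite sqnE sumr_ge0 // => i _; exact: sqr_ge0. Qed.

Lemma sqn_eq0 x : (sqn x == 0) = (x == 0).
Proof.
apply/idP/eqP => [|->]; last by rewrite /sqn inner0l raddf0.
rewrite sqnE psumr_eq0 => [/allP x0|i _]; last exact: sqr_ge0.
apply/rowP => i; rewrite mxE; apply/eqP.
by have := x0 i (mem_index_enum i); rewrite /= sqrf_eq0 absK_eq0.
Qed.

Lemma sqnZ a x : sqn (a *: x) = absK a ^+ 2 * sqn x.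
Proof. by rewrite /sqn innerZl innerZr mulrA mulz_conj real_partZ. Qed.

Lemma sqnB x y : sqn (x - y) = sqn x + sqn y - 2 * real_part (inner x y).
Proof.
rewrite /sqn innerBl !innerBr !raddfB /= -(inner_conj y x) real_part_conj.
by ring.
Qed.

Definition nrm x : R := Num.sqrt (sqn x).

Lemma nrm_ge0 x : 0 <= nrm x. Proof. exact: sqrtr_ge0. Qed.

Lemma nrm_sq x : nrm x ^+ 2 = sqn x.
Proof. by rewrite sqr_sqrtr ?sqn_ge0. Qed.

Lemma nrm_eq0 x : (nrm x == 0) = (x == 0).
Proof. by rewrite -sqn_eq0 -nrm_sq sqrf_eq0. Qed.

Lemma cauchy_schwarz_sq x y : absK (inner x y) ^+ 2 <= sqn x * sqn y.
Proof.
have [->|y0] := eqVneq y 0.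
  by rewrite inner0r absK0 expr0n mulr_ge0 ?sqn_ge0.
have sy : 0 < sqn y by rewrite lt0r sqn_eq0 y0 sqn_ge0.
have := sqn_ge0 (ofR (sqn y) *: x - inner x y *: y).
rewrite sqnB !sqnZ innerZl innerZr [conjK _ * _]mulrC mulz_conj -rmorphM /= of_realK.
rewrite absK_of_real real_normK ?num_real // => h.
rewrite -(ler_pM2l sy) -subr_ge0; apply: le_trans h _.
by rewrite le_eqVlt; apply/orP; left; apply/eqP; ring.
Qed.

Lemma cauchy_schwarz x y : absK (inner x y) <= nrm x * nrm y.
Proof.
rewrite -(@ler_pXn2r _ 2) ?nnegrE ?absK_ge0 ?mulr_ge0 ?nrm_ge0 //.
by rewrite exprMn !nrm_sq cauchy_schwarz_sq.
Qed.

End Inner.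

Definition adj m n (A : 'M[K]_(m, n)) : 'M[K]_(n, m) := map_mx conjK A^T.

Lemma inner_mulmx m n (x : 'rV[K]_m) (A : 'M[K]_(m, n)) y :
  inner (x *m A) y = inner x (y *m adj A).
Proof.
rewrite /inner; under eq_bigr do rewrite mxE mulr_suml.
rewrite exchange_big; apply: eq_bigr => i _ /=.
rewrite mxE rmorph_sum mulr_sumr; apply: eq_bigr => j _.
by rewrite !mxE rmorphM /= conjKK [in RHS](mulrC (conjK _)) mulrA.
Qed.

Lemma adjK m n (A : 'M[K]_(m, n)) : adj (adj A) = A.
Proof. by apply/matrixP => i j; rewrite !mxE conjKK. Qed.

Lemma adjM m n p (A : 'M[K]_(m, n)) (B : 'M[K]_(n, p)) :
  adj (A *m B) = adj B *m adj A.
Proof. by rewrite /adj trmx_mul map_mxM. Qed.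

End Vectors.

(** * Hahn-Banach *)

Section HahnBanach.
Variables (R : realType) (k : scalar_kind).
Local Notation K := (scalars R k).
Local Notation ofR := (@of_real R k).

Section Sublinear.
Variable V : lmodType K.
Implicit Types (p q : V -> R) (x y z : V).

Record sublinear p : Prop := Sublinear {
  sublinearD : forall x y, p (x + y) <= p x + p y;
  sublinearZ : forall t x, 0 <= t -> p (ofR t *: x) = t * p x }.

Lemma sublinear0 p : sublinear p -> p 0 = 0.
Proof. by case=> _ /(_ 0 0 (lexx _)); rewrite scaler0 mul0r. Qed.

Lemma sublinearN_ge p x : sublinear p -> - p (- x) <= p x.
Proof.
move=> sp; have := sublinearD sp x (- x); rewrite subrr sublinear0 //; lra.
Qed.

Lemma sublinearW p : (forall x y, p (x + y) <= p x + p y) ->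
  (forall (t : R) x, 0 < t -> p (ofR t *: x) <= t * p x) -> sublinear p.
Proof.
move=> pD pZ; split=> // t x; rewrite le_eqVlt => /predU1P[<-|t0].
  rewrite rmorph0 scale0r mul0r; apply/eqP; rewrite eq_le.
  have h2 : 0 < 2 :> R by rewrite ltr0n.
  have h2V : 0 < 2^-1 :> R by rewrite invr_gt0.
  have := pZ 2 0 h2; have := pZ 2^-1 0 h2V; rewrite !scaler0 => ? ?.
  by apply/andP; split; lra.
apply/eqP; rewrite eq_le pZ //= -ler_pdivlMl // mulrC.
have := pZ t^-1 (ofR t *: x); rewrite invr_gt0 => /(_ t0).
by rewrite scalerA -rmorphM mulVf ?gt_eqF // rmorph1 scale1r mulrC.
Qed.

(* [lowered] is a sublinear functional below [p] with [lowered (- z) <= - s] for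
   all [(z, s)] in the cone [D].  With [D] the graph of a functional it forces an
   extension; with [D] a ray it contradicts minimality of a non-odd [p]. *)
Section Lowering.
Variables (p : V -> R) (D : set (V * R)).
Hypothesis sp : sublinear p.
Hypothesis D0 : D (0, 0).
Hypothesis DD : forall d d', D d -> D d' -> D (d.1 + d'.1, d.2 + d'.2).
Hypothesis DZ : forall t d, 0 < t -> D d -> D (ofR t *: d.1, t * d.2).
Hypothesis Dp : forall d, D d -> d.2 <= p d.1.

Let lowered_set x := [set p (x + d.1) - d.2 | d in D].
Definition lowered x : R := inf (lowered_set x).

Let has_lower x : has_lbound (lowered_set x).
Proof.
exists (- p (- x)) => _ [d Dd <-].
have := sublinearD sp (x + d.1) (- x); have := Dp Dd.
by rewrite addrAC subrr add0r; lra.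
Qed.

Let has_inf_lowered x : has_inf (lowered_set x).
Proof. by split=> //; exists (p (x + 0) - 0); exists (0, 0). Qed.

Lemma lowered_le x d : D d -> lowered x <= p (x + d.1) - d.2.
Proof. by move=> Dd; apply: ge_inf => //; exists d. Qed.

Let le_lowered x a : (forall d, D d -> a <= p (x + d.1) - d.2) -> a <= lowered x.
Proof.
move=> h; apply: lb_le_inf; first by case: (has_inf_lowered x).
by move=> _ [d Dd <-]; exact: h.
Qed.

Lemma lowered_sublinear : sublinear lowered.
Proof.
apply: sublinearW => [x y|t x t0].
  rewrite -lerBlDr; apply: le_lowered => d Dd.
  rewrite lerBlDr -lerBlDl; apply: le_lowered => d' Dd'.
  rewrite lerBlDl; apply: le_trans (lowered_le _ (DD Dd Dd')) _ => /=.
  have := sublinearD sp (x + d.1) (y + d'.1); rewrite addrACA; lra.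
rewrite -ler_pdivrMl //; apply: le_lowered => d Dd; rewrite ler_pdivrMl //.
have h := lowered_le (ofR t *: x) (DZ t0 Dd).
by apply: le_trans h _; rewrite /= -scalerDr (sublinearZ sp _ (ltW t0)) mulrBr.
Qed.

Lemma lowered_le_id x : lowered x <= p x.
Proof. by have := lowered_le x D0; rewrite addr0 subr0. Qed.

Lemma loweredN_le d : D d -> lowered (- d.1) <= - d.2.
Proof. by move=> /(lowered_le (- d.1)); rewrite addNr sublinear0 // sub0r. Qed.

End Lowering.

(** Zorn's lemma for the reversed pointwise order. A chain is bounded below by its pointwise
    infimum: this is finite since every member is at least [- p (- x)] at [x], and subadditive since
    of two comparable members the smaller serves at both points. *)
Lemma minimal_sublinear p : sublinear p -> exists q, [/\ sublinear q,
  forall x, q x <= p x &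
  forall q', sublinear q' -> (forall x, q' x <= q x) -> q' = q].
Proof.
move=> sp; pose P q := sublinear q /\ forall x, q x <= p x; pose T := {q : V -> R | P q}.
pose le (a b : T) : bool := `[< forall x, sval b x <= sval a x >].
have [||A Atot|q qmin] := @ZL_preorder T (exist P p (conj sp (fun=> lexx _))) le.
- by move=> a; apply/asboolP.
- move=> b a c /asboolP ab /asboolP bc; apply/asboolP => x.
  exact: le_trans (bc x) (ab x).
- have [[a0 Aa0]|A0] := pselect (A !=set0); last first.
    exists (exist P p (conj sp (fun=> lexx _))) => a Aa.
    by case: A0; exists a.
  pose E x := [set sval a x | a in A].
  have Elb x : has_lbound (E x).
    exists (- p (- x)) => _ [a _ <-].
    case: (svalP a) => sa ap; apply: le_trans (sublinearN_ge _ sa).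
    by rewrite lerN2.
  have Ene x : E x !=set0 by exists (sval a0 x); exists a0.
  have Einf_le x a : A a -> inf (E x) <= sval a x by move=> Aa; apply: ge_inf => //; exists a.
  have le_Einf x t : (forall a, A a -> t <= sval a x) -> t <= inf (E x).
    by move=> h; apply: lb_le_inf => // _ [a Aa <-]; exact: h.
  have sE : sublinear (fun x => inf (E x)).
    apply: sublinearW => [x y|t x t0].
      rewrite -lerBlDr; apply: (le_Einf _ _) => a Aa.
      rewrite lerBlDr -lerBlDl; apply: (le_Einf _ _) => b Ab; rewrite lerBlDl.
      have [c [Ac cx cy]] : exists c, [/\ A c, sval c x <= sval a x & sval c y <= sval b y].
        by have [/asboolP ab|/asboolP ba] := Atot _ _ Aa Ab; [exists b|exists a].
      apply: le_trans (Einf_le _ _ Ac) _; have [sc _] := svalP c.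
      by apply: le_trans (sublinearD sc _ _) _; rewrite lerD.
    rewrite -ler_pdivrMl //; apply: (le_Einf _ _) => a Aa; rewrite ler_pdivrMl //.
    by have [sa _] := svalP a; rewrite -(sublinearZ sa _ (ltW t0)) Einf_le.
  have Ep x : inf (E x) <= p x.
    by apply: le_trans (Einf_le _ _ Aa0) _; have [_ ->] := svalP a0.
  by exists (exist P _ (conj sE Ep)) => a Aa; apply/asboolP => x /=; exact: Einf_le.
have [sq qp] := svalP q; exists (sval q); split=> // q' sq' q'q.
have q'p x : q' x <= p x by exact: le_trans (q'q x) (qp x).
have lqq' : le q (exist P q' (conj sq' q'p)) by apply/asboolP.
have /asboolP qq' := qmin _ lqq'.
by apply/funext => x; apply/eqP; rewrite eq_le q'q qq'.
Qed.

Lemma minimal_sublinearN q : sublinear q ->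
  (forall q', sublinear q' -> (forall x, q' x <= q x) -> q' = q) ->
  forall x, q (- x) = - q x.
Proof.
move=> sq qmin y.
pose D : set (V * R) := [set d | exists2 t : R, 0 <= t & d = (ofR t *: y, t * q y)].
have D0 : D (0, 0) by exists 0; rewrite ?rmorph0 ?scale0r ?mul0r.
have DD d d' : D d -> D d' -> D (d.1 + d'.1, d.2 + d'.2).
  move=> [t t0 ->] [s s0 ->]; exists (t + s); first exact: addr_ge0.
  by rewrite rmorphD scalerDl mulrDl.
have DZ t d : 0 < t -> D d -> D (ofR t *: d.1, t * d.2).
  move=> t0 [s s0 ->]; exists (t * s); first by rewrite mulr_ge0 // ltW.
  by rewrite rmorphM scalerA mulrA.
have Dp d : D d -> d.2 <= q d.1 by move=> [t t0 ->] /=; rewrite sublinearZ.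
have lq := qmin _ (lowered_sublinear sq D0 DD DZ Dp) (lowered_le_id sq D0 Dp).
apply/eqP; rewrite eq_le -{1}lq; apply/andP; split.
  have Dy : D (y, q y) by exists 1; rewrite ?rmorph1 ?scale1r ?mul1r.
  exact: (loweredN_le sq Dp Dy).
have := sublinearN_ge (- y) sq; rewrite opprK; lra.
Qed.

End Sublinear.

Lemma hahn_banach_real (V W : lmodType K) (p : V -> R) (S : {linear W -> V})
    (f : W -> R) : sublinear p -> {morph f : x y / x + y} ->
  (forall t x, f (ofR t *: x) = t * f x) -> (forall w, f w <= p (S w)) ->
  exists g : V -> R, [/\ {morph g : x y / x + y},
    forall t x, g (ofR t *: x) = t * g x, forall x, g x <= p x &
    forall w, g (S w) = f w].
Proof.
move=> sp fD fZ fp; pose D : set (V * R) := [set (S w, f w) | w in setT].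
have f0 : f 0 = 0 by have := fZ 0 0; rewrite scaler0 mul0r.
have D0 : D (0, 0) by exists 0; rewrite // linear0 f0.
have DD d d' : D d -> D d' -> D (d.1 + d'.1, d.2 + d'.2).
  by move=> [w _ <-] [w' _ <-]; exists (w + w'); rewrite // linearD fD.
have DZ t d : 0 < t -> D d -> D (ofR t *: d.1, t * d.2).
  by move=> t0 [w _ <-]; exists (ofR t *: w); rewrite //= linearZ /= fZ.
have Dp d : D d -> d.2 <= p d.1 by move=> [w _ <-]; exact: fp.
have [q [sq qp qmin]] := minimal_sublinear (lowered_sublinear sp D0 DD DZ Dp).
have qN := minimal_sublinearN sq qmin.
(* The graph cone gives only one inequality; both sides are odd, which turns it into equality. *)
have qle w : q (S w) <= f w.
  have fN : f (- w) = - f w by have := fD w (- w); rewrite subrr f0; lra.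
  have Dw : D (S (- w), f (- w)) by exists (- w).
  by have := loweredN_le sp Dp Dw; rewrite /= linearN opprK fN opprK; apply: le_trans (qp _).
exists q; split=> [x y|t x|x|w].
- apply/eqP; rewrite eq_le (sublinearD sq) /=.
  by have := sublinearD sq (- x) (- y); rewrite -opprD !qN; lra.
- have [t0|t0] := leP 0 t; first exact: sublinearZ.
  rewrite -[t]opprK rmorphN scaleNr qN sublinearZ // ?mulNr //.
  by rewrite oppr_ge0 ltW.
- exact: le_trans (qp x) (lowered_le_id sp D0 Dp x).
- have fN : f (- w) = - f w by have := fD w (- w); rewrite subrr f0; lra.
  by apply/eqP; rewrite eq_le qle; have := qle (- w); rewrite linearN qN fN; lra.
Qed.

(** Over the complex numbers the functional is [g x - i g (i x)], the only linear one with real part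
    [g]. *)
Lemma complexify (V : lmodType K) (g : V -> R) : {morph g : x y / x + y} ->
  (forall t x, g (ofR t *: x) = t * g x) ->
  exists h : V -> K, (forall a x y, h (a *: x + y) = a * h x + h y) /\
    forall x, real_part (h x) = g x.
Proof.
case: k V g => /= V g gD gZ.
  by exists g; split=> // a x y; rewrite gD gZ.
exists (fun x => (g x -i* g ('i%C *: x))%C); split=> // -[s t] x y.
have e1 : ((s +i* t)%C : R[i]) *: x = (s +i* 0)%C *: x + (t +i* 0)%C *: ('i%C *: x).
  rewrite scalerA -scalerDl; congr (_ *: x).
  by rewrite /GRing.add /GRing.mul /=; congr Complex; ring.
have e2 : 'i%C *: (((s +i* t)%C : R[i]) *: x) =
    (s +i* 0)%C *: ('i%C *: x) + (- t +i* 0)%C *: x.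
  rewrite !scalerA -scalerDl; congr (_ *: x).
  by rewrite /GRing.add /GRing.mul /=; congr Complex; ring.
rewrite scalerDr e2 e1 !gD !gZ; apply/eqP; rewrite eq_complex /=.
by apply/andP; split; apply/eqP; ring.
Qed.

Theorem hahn_banach (V W : lmodType K) (p : V -> R) (S : {linear W -> V})
    (f : W -> K) : (forall x y, p (x + y) <= p x + p y) ->
  (forall a x, p (a *: x) = absK a * p x) ->
  (forall a x y, f (a *: x + y) = a * f x + f y) ->
  (forall w, absK (f w) <= p (S w)) ->
  exists g : V -> K, [/\ forall a x y, g (a *: x + y) = a * g x + g y,
    forall x, absK (g x) <= p x & forall w, g (S w) = f w].
Proof.
move=> pD pZ fL fp.
have sp : sublinear p.
  by split=> // t x t0; rewrite pZ absK_of_real ger0_norm.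
have f0 : f 0 = 0 by have := fL (-1) 0 0; rewrite scaler0 addr0 mulN1r addNr.
have fZ a x : f (a *: x) = a * f x by rewrite -[a *: x]addr0 fL f0 addr0.
have fD x y : f (x + y) = f x + f y by rewrite -[x]scale1r fL mul1r scale1r.
have [||w|g [gD gZ gp gS]] := @hahn_banach_real V W p S (fun w => real_part (f w)) sp.
- by move=> x y; rewrite fD raddfD.
- by move=> t x; rewrite fZ real_partZ.
- exact: le_trans (real_part_le _) (fp w).
have [h [hL hg]] := complexify gD gZ.
have h0 : h 0 = 0 by have := hL (-1) 0 0; rewrite scaler0 addr0 mulN1r addNr.
have hZ a x : h (a *: x) = a * h x by rewrite -[a *: x]addr0 hL h0 addr0.
exists h; split=> // [x|w].
  have [t t1 tE] := absK_phase (h x).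
  have -> : absK (h x) = real_part (h (t *: x)) by rewrite hZ tE of_realK.
  by rewrite hg (le_trans (gp _)) // pZ t1 mul1r.
(* With [z] the difference of the two values, [|z|^2 = Re (conj z * z)] is the real part of the
   difference at [conjK z *: w], where the real extension already agrees with [f]. *)
apply/eqP; rewrite -subr_eq0 -absK_eq0 -sqrf_eq0.
set z := h (S w) - f w.
rewrite -(@of_realK _ k (absK z ^+ 2)) -mulz_conj mulrC {2}/z mulrBr raddfB /=.
by rewrite -hZ hg -linearZ gS fZ subrr.
Qed.

End HahnBanach.

(** * The dual ball *)

Lemma linear_lift (K : pzRingType) (V W : lmodType K) (f : V -> W) :
  (forall a x y, f (a *: x + y) = a *: f x + f y) ->
  exists g : {linear V -> W}, g =1 f.
Proof.
move=> fL; pose fM := GRing.isLinear.Build K V W _ f fL.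
by exists (HB.pack f fM : {linear V -> W}).
Qed.

Section DualBall.
Variables (R : realType) (k : scalar_kind) (n : nat).
Local Notation K := (scalars R k).
Local Notation ofR := (@of_real R k).

Lemma rV_functional (g : 'rV[K]_n -> K) :
  (forall a x y, g (a *: x + y) = a * g x + g y) ->
  exists y, forall x, g x = inner x y.
Proof.
move=> gL; exists (\row_i conjK (g (delta_mx 0 i))) => x.
have g0 : g 0 = 0 by have := gL (-1) 0 0; rewrite scaler0 addr0 mulN1r addNr.
rewrite [in LHS](row_sum_delta x).
transitivity (\sum_i x 0 i * g (delta_mx 0 i)); last first.
  by apply: eq_bigr => i _; rewrite mxE conjKK.
by elim/big_rec2 : _ => [//|i u v _ <-]; rewrite gL.
Qed.

Variable N : 'rV[K]_n -> K.
Hypothesis hN : is_norm N.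

Definition rnorm x : R := real_part (N x).

Lemma rnormE x : N x = ofR (rnorm x).
Proof.
have [ND NZ N0] := hN; apply: ge0_of_real.
have := ND x (- x); rewrite subrr.
have -> : N 0 = 0 by have := NZ 0 0; rewrite scale0r normr0 mul0r.
have -> : N (- x) = N x by rewrite -scaleN1r NZ normrN normr1 mul1r.
by rewrite -mulr2n pmulrn_lge0.
Qed.

Lemma rnormD x y : rnorm (x + y) <= rnorm x + rnorm y.
Proof. by have [ND _ _] := hN; rewrite -(ler_of_real k) rmorphD /= -!rnormE. Qed.

Lemma rnormZ a x : rnorm (a *: x) = absK a * rnorm x.
Proof.
have [_ NZ _] := hN; apply: (@of_real_inj _ k).
by rewrite rmorphM /= -!rnormE NZ normKE.
Qed.

Lemma rnorm0 : rnorm 0 = 0.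
Proof. by have := rnormZ 0 0; rewrite scale0r absK0 mul0r. Qed.

Lemma rnorm_eq0 x : rnorm x = 0 -> x = 0.
Proof. by have [_ _ N0] := hN; move=> h; apply: N0; rewrite rnormE h rmorph0. Qed.

Lemma rnormN x : rnorm (- x) = rnorm x.
Proof. by rewrite -scaleN1r rnormZ absKN absK1 mul1r. Qed.

Lemma rnorm_ge0 x : 0 <= rnorm x.
Proof.
have := rnormD x (- x); rewrite subrr rnorm0 rnormN; lra.
Qed.

Lemma rnorm_sum (I : Type) (r : seq I) (P : pred I) (F : I -> 'rV[K]_n) :
  rnorm (\sum_(i <- r | P i) F i) <= \sum_(i <- r | P i) rnorm (F i).
Proof.
elim/big_rec2 : _ => [|i y x _ le]; first by rewrite rnorm0.
by rewrite (le_trans (rnormD _ _)) // lerD2l.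
Qed.

Lemma dual_ballP y : dual_ball N y <-> forall x, absK (inner x y) <= rnorm x.
Proof.
split=> [By x|h x]; last first.
  rewrite rnormE -(rmorph1 ofR) ler_of_real absK_le_real => Nx.
  exact: le_trans (h x) Nx.
have [/rnorm_eq0->|x0] := eqVneq (rnorm x) 0; first by rewrite inner0l absK0 rnorm0.
have x_gt0 : 0 < rnorm x by rewrite lt0r x0 rnorm_ge0.
have := By (ofR (rnorm x)^-1 *: x).
rewrite rnormE -(rmorph1 ofR) ler_of_real absK_le_real rnormZ innerZl absKM.
rewrite absK_of_real ger0_norm ?invr_ge0 ?rnorm_ge0 // mulVf // => /(_ (lexx _)).
by rewrite mulrC ler_pdivrMr // mul1r.
Qed.

Lemma dual_ball0 : dual_ball N 0.
Proof. by apply/dual_ballP => x; rewrite inner0r absK0 rnorm_ge0. Qed.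

Lemma dual_extend (W : lmodType K) (S : {linear W -> 'rV[K]_n}) (f : W -> K) :
  (forall a x y, f (a *: x + y) = a * f x + f y) ->
  (forall w, absK (f w) <= rnorm (S w)) ->
  exists2 y, dual_ball N y & forall w, inner (S w) y = f w.
Proof.
move=> fL fN; have [g [gL gN gS]] := hahn_banach rnormD rnormZ fL fN.
have [y gE] := rV_functional gL; exists y; first by apply/dual_ballP => x; rewrite -gE.
by move=> w; rewrite -gE.
Qed.

Lemma dual_norming x : exists2 y, dual_ball N y & inner x y = ofR (rnorm x).
Proof.
have [S SE] : exists S : {linear K^o -> 'rV[K]_n}, S =1 (fun a => a *: x).
  by apply: linear_lift => a b c /=; rewrite scalerDl scalerA.
have [|w|y By yE] := @dual_extend K^o S (fun a => a * ofR (rnorm x)).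
- by move=> a b c; rewrite mulrDl -mulrA.
- by rewrite SE rnormZ absKM absK_of_real ger0_norm ?rnorm_ge0.
by exists y => //; have := yE 1; rewrite SE scale1r mul1r.
Qed.

Lemma rnorm_le_dual x a : (forall y, dual_ball N y -> absK (inner x y) <= a) -> rnorm x <= a.
Proof.
move=> h; have [y By yE] := dual_norming x.
by have := h y By; rewrite yE absK_of_real ger0_norm ?rnorm_ge0.
Qed.

(** Take a family of maximal rank: a nonzero vector orthogonal to all its rows would have a norming
    functional outside their span. *)
Lemma dual_ball_frame : exists m (Y : 'M[K]_(m, n)),
  (forall i, dual_ball N (row i Y)) /\ row_full Y.
Proof.
pose P r := `[< exists m (Y : 'M[K]_(m, n)),
  (forall i, dual_ball N (row i Y)) /\ \rank Y = r >].
have P0 : exists r, P r.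
  exists 0%N; apply/asboolP; exists 0%N, 0; split; last exact: mxrank0.
  by case.
have Pn r : P r -> (r <= n)%N by move=> /asboolP[m [Y [_ <-]]]; exact: rank_leq_col.
case: (ex_maxnP P0 Pn) => r /asboolP[m [Y [BY rY]]] rmax.
exists m, Y; split=> //; rewrite -col_leq_rank leqNgt; apply/negP => rn.
have [x [x0 xY]] : exists x : 'rV[K]_n, x != 0 /\ x *m adj Y = 0.
  have : kermx (adj Y) != 0.
    rewrite -mxrank_eq0 mxrank_ker /adj mxrank_map mxrank_tr subn_eq0 -ltnNge //.
  by move=> /rowV0Pn[x /sub_kermxP xY x0]; exists x.
have [y By yE] := dual_norming x.
have sub : (Y <= col_mx Y y)%MS by rewrite -addsmxE addsmxSl.
suff /rmax : P (\rank (col_mx Y y)).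
  rewrite -rY => le; have := mxrank_leqif_sup sub; rewrite /leqif => -[_].
  rewrite eqn_leq le mxrankS // => /esym; rewrite col_mx_sub => /andP[_ /submxP[D yD]].
  move: yE; rewrite yD -[Y]adjK -inner_mulmx xY inner0l.
  by rewrite -(rmorph0 ofR) => /of_real_inj /esym /rnorm_eq0 /eqP; exact/negP.
apply/asboolP; exists (m + 1)%N, (col_mx Y y); split=> // i.
case: (split_ordP i) => j ->; first by rewrite rowKu.
by rewrite rowKd; have -> : row j y = y by apply/rowP => a; rewrite mxE ord1.
Qed.

(** An inverse of the full-rank family of [dual_ball_frame] expresses the coordinates through
    functionals bounded by the norm, which compares norms without compactness. *)
Lemma coord_le_rnorm : exists2 C : R, 0 <= C &
  forall (x : 'rV[K]_n) a, absK (x 0 a) <= C * rnorm x.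
Proof.
have [m [Y [BY fY]]] := dual_ball_frame.
have : row_free (adj Y) by rewrite /row_free /adj mxrank_map mxrank_tr.
case/row_freeP => Z YZ; exists (\sum_i \sum_a absK (Z i a)).
  by do 2!apply: sumr_ge0 => ? _; exact: absK_ge0.
move=> x a; have -> : x 0 a = (x *m adj Y *m Z) 0 a by rewrite -mulmxA YZ mulmx1.
rewrite mxE.
apply: le_trans (absK_sum _ _ _) _; rewrite mulr_suml.
apply: ler_sum => i _; rewrite absKM mulrC.
have -> : (x *m adj Y) 0 i = inner x (row i Y).
  by rewrite mxE; apply: eq_bigr => b _; rewrite !mxE.
have /dual_ballP/(_ x) h := BY i.
apply: ler_pM => //; rewrite ?absK_ge0 //.
rewrite (bigD1 a) //= lerDl; apply: sumr_ge0 => b _; exact: absK_ge0.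
Qed.

End DualBall.

(** * Trace duality *)

Section Certificate.
Variables (R : realType) (k : scalar_kind) (n : nat).
Local Notation K := (scalars R k).
Local Notation ofR := (@of_real R k).
Variable N : 'rV[K]_n -> K.
Hypothesis hN : is_norm N.
Local Notation rnorm := (rnorm N).

(* Weights and functionals witnessing that the operator [X] has 1-summing norm
   at most 1. *)
Definition summing_certificate (I : finType) (m : I -> R) (y : I -> 'rV[K]_n)
    (X : 'M[K]_n) : Prop :=
  [/\ forall l, 0 <= m l, forall l, dual_ball N (y l), \sum_l m l <= 1
    & forall w, rnorm (w *m X) <= \sum_l m l * absK (inner w (y l))].

Section Projection.
Variables (Z : normedModType K) (S : {linear 'rV[K]_n -> Z}).
Hypothesis S_isom : forall x, `|S x| = N x.
Variable c : R.
Hypothesis c_ge0 : 0 <= c.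
Hypothesis cert_le : forall p (m : 'I_p -> R) y X,
  summing_certificate m y X -> real_part (\tr X) <= c.

Definition znorm (z : Z) : R := real_part `|z|.

Lemma znormE z : `|z| = ofR (znorm z).
Proof. exact: ge0_of_real. Qed.

Lemma znorm_ge0 z : 0 <= znorm z.
Proof. by rewrite -(ler_of_real k) -znormE rmorph0. Qed.

Lemma znormZ a z : znorm (a *: z) = absK a * znorm z.
Proof.
by apply: (@of_real_inj _ k); rewrite rmorphM /= -!znormE normrZ normKE.
Qed.

Lemma znormD z z' : znorm (z + z') <= znorm z + znorm z'.
Proof. by rewrite -(ler_of_real k) rmorphD /= -!znormE ler_normD. Qed.

Lemma znorm0 : znorm 0 = 0. Proof. by rewrite /znorm normr0 raddf0. Qed.

Lemma znorm_sum (I : Type) (r : seq I) (F : I -> Z) :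
  znorm (\sum_(i <- r) F i) <= \sum_(i <- r) znorm (F i).
Proof.
elim/big_rec2 : _ => [|i y x _ le]; first by rewrite znorm0.
by rewrite (le_trans (znormD _ _)) // lerD2l.
Qed.

Local Notation V := {ffun 'I_n -> Z}.

(** An expansion of [z] as a sum of tensors of [d.1] with functionals [d.2] from the dual ball. The
    coordinates are conjugated because [y] stands for the functional [x |-> inner x y]. *)
Definition represents (s : seq (Z * 'rV[K]_n)) (z : V) : Prop :=
  (forall i, dual_ball N (tnth (in_tuple s) i).2) /\
  forall a, z a = \sum_(d <- s) conjK (d.2 0 a) *: d.1.

Definition cost (s : seq (Z * 'rV[K]_n)) : R := \sum_(d <- s) znorm d.1.

(* [Z^n] stands for the tensor product of [Z] with the dual of [X]: this is [c]
   times the projective norm, whose dual ball consists of the operators from [Z]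
   to [X] of norm at most [c]. *)
Definition tensor_norm (z : V) : R :=
  inf [set c * cost s | s in [set s | represents s z]].

Lemma cost_ge0 s : 0 <= cost s.
Proof. by apply: sumr_ge0 => d _; exact: znorm_ge0. Qed.

Lemma represents_nil : represents [::] 0.
Proof. by split=> [[]//|a]; rewrite big_nil ffunE. Qed.

Lemma represents_cons d s z : dual_ball N d.2 -> represents s z ->
  represents (d :: s) ([ffun a => conjK (d.2 0 a) *: d.1] + z).
Proof.
move=> Bd [Bs zE]; split=> [|a]; last by rewrite big_cons !ffunE zE.
case=> -[|i] Hi; rewrite (tnth_nth d) //=.
by have := Bs (Ordinal (Hi : (i < size s)%N)); rewrite (tnth_nth d).
Qed.

Lemma represents_cat s s' z z' : represents s z -> represents s' z' ->
  represents (s ++ s') (z + z').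
Proof.
move=> [Bs zE] [Bs' zE']; split=> [|a]; last by rewrite big_cat !ffunE zE zE'.
case=> i Hi; rewrite (tnth_nth (0, 0)) /= nth_cat.
have Hi' := Hi; rewrite /= size_cat in Hi'.
case: ltnP => [lt|ge].
  by have := Bs (Ordinal lt); rewrite (tnth_nth (0, 0)).
have lt : (i - size s < size s')%N by rewrite ltn_subLR.
by have := Bs' (Ordinal lt); rewrite (tnth_nth (0, 0)).
Qed.

Lemma represents_scale a s z : represents s z ->
  exists2 s', represents s' (a *: z) & cost s' = absK a * cost s.
Proof.
move=> [Bs zE]; exists [seq (a *: d.1, d.2) | d <- s]; last first.
  by rewrite /cost big_map mulr_sumr; apply: eq_bigr => d _; rewrite znormZ.
split=> [|b].
  case=> i Hi; rewrite (tnth_nth (0, 0)) /=.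
  have Hi' := Hi; rewrite size_map in Hi'.
  by rewrite (nth_map (0, 0)) //=; have := Bs (Ordinal Hi'); rewrite (tnth_nth (0, 0)).
rewrite big_map !ffunE zE scaler_sumr; apply: eq_bigr => d _ /=.
by rewrite !scalerA mulrC.
Qed.

Lemma represents_ex z : exists s, represents s z.
Proof.
have [C C0 hC] := coord_le_rnorm hN.
(* [C] may vanish, hence the scaling of the basis functionals by [C + 1]. *)
have C1 : 0 < C + 1 by rewrite ltr_wpDl.
have Bd a : dual_ball N (ofR (C + 1)^-1 *: delta_mx 0 a).
  apply/dual_ballP => // x; rewrite innerZr conjK_of_real inner_delta absKM absK_of_real.
  rewrite gtr0_norm ?invr_gt0 // ler_pdivrMl // (le_trans (hC x a)) //.
  by rewrite ler_wpM2r ?rnorm_ge0 // lerDl.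
have -> : z = \sum_a [ffun b => conjK ((ofR (C + 1)^-1 *: delta_mx 0 a : 'rV[K]_n) 0 b)
                                  *: (ofR (C + 1) *: z a)].
  apply/ffunP => b; rewrite sum_ffunE (bigD1 b) //= big1 ?addr0 => [|a ab].
    rewrite ffunE !mxE !eqxx mulr1 conjK_of_real scalerA -rmorphM mulVf ?gt_eqF //.
    by rewrite rmorph1 scale1r.
  by rewrite ffunE !mxE eqxx [b == a]eq_sym (negbTE ab) /= mulr0 rmorph0 scale0r.
elim/big_rec : _ => [|a u _ [s us]]; first by exists [::]; exact: represents_nil.
exists ((ofR (C + 1) *: z a, ofR (C + 1)^-1 *: delta_mx 0 a) :: s).
by apply: (represents_cons _ us); exact: Bd.
Qed.

Let costs z := [set c * cost s | s in [set s | represents s z]].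

Let costs_lb z : has_lbound (costs z).
Proof. by exists 0 => _ [s _ <-]; rewrite mulr_ge0 ?cost_ge0. Qed.

Lemma tensor_norm_le s z : represents s z -> tensor_norm z <= c * cost s.
Proof. by move=> sz; apply: (ge_inf (costs_lb z)); exists s. Qed.

Lemma le_tensor_norm z a : (forall s, represents s z -> a <= c * cost s) ->
  a <= tensor_norm z.
Proof.
move=> h; apply: lb_le_inf => [|_ [s sz <-]]; last exact: h.
by have [s sz] := represents_ex z; exists (c * cost s); exists s.
Qed.

Lemma tensor_normD z z' : tensor_norm (z + z') <= tensor_norm z + tensor_norm z'.
Proof.
rewrite -lerBlDr; apply: le_tensor_norm => s sz.
rewrite lerBlDr -lerBlDl; apply: le_tensor_norm => s' sz'.
rewrite lerBlDl; apply: le_trans (tensor_norm_le (represents_cat sz sz')) _.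
by rewrite /cost big_cat mulrDr.
Qed.

Lemma tensor_normZ a z : tensor_norm (a *: z) = absK a * tensor_norm z.
Proof.
have le b u : b != 0 -> tensor_norm (b *: u) <= absK b * tensor_norm u.
  move=> b0; have b1 : 0 < absK b by rewrite lt0r absK_eq0 b0 absK_ge0.
  rewrite -ler_pdivrMl //; apply: le_tensor_norm => s su.
  have [s' s'u cE] := represents_scale b su.
  by rewrite ler_pdivrMl // (le_trans (tensor_norm_le s'u)) // cE mulrCA.
have [->|a0] := eqVneq a 0.
  rewrite scale0r absK0 mul0r; apply/eqP; rewrite eq_le.
  rewrite le_tensor_norm ?andbT => [|s _]; last by rewrite mulr_ge0 ?cost_ge0.
  by have := tensor_norm_le represents_nil; rewrite /cost big_nil mulr0.
apply/eqP; rewrite eq_le le //=.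
have a1 : 0 < absK a by rewrite lt0r absK_eq0 a0 absK_ge0.
have := le a^-1 (a *: z); rewrite invr_eq0 scalerA mulVf // scale1r => /(_ a0).
by rewrite absK_inv -ler_pdivrMl ?invr_gt0 // invrK.
Qed.

Let rows (X : 'M[K]_n) : V := [ffun a => S (row a X)].


(** Dividing the weights of an expansion of [rows X] by its cost gives a certificate for [X] divided
    by that cost and turned by the phase that makes the trace nonnegative; [cert_le] bounds its
    trace. Cost zero forces [X = 0]. *)
Let trace_le X : absK (\tr X) <= tensor_norm (rows X).
Proof.
apply: le_tensor_norm => s [Bs XE].
pose y i := (tnth (in_tuple s) i).2; pose m i := znorm (tnth (in_tuple s) i).1.
have costE : cost s = \sum_i m i by rewrite /cost big_tnth.
have SX w : rnorm (w *m X) <= \sum_i m i * absK (inner w (y i)).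
  have -> : rnorm (w *m X) = znorm (S (w *m X)) by rewrite /znorm S_isom.
  have -> : S (w *m X) = \sum_(d <- s) inner w d.2 *: d.1.
    rewrite mulmx_sum_row linear_sum /=.
    under eq_bigr => a _ do rewrite linearZ /=.
    transitivity (\sum_a \sum_(d <- s) (w 0 a * conjK (d.2 0 a)) *: d.1).
      apply: eq_bigr => a _; have := XE a; rewrite ffunE => ->.
      by rewrite scaler_sumr; apply: eq_bigr => d _; rewrite scalerA.
    by rewrite exchange_big; apply: eq_bigr => d _ /=; rewrite scaler_suml.
  apply: le_trans (znorm_sum _ _) _; rewrite big_tnth.
  by apply: ler_sum => i _; rewrite znormZ mulrC.
have m0 i : 0 <= m i by exact: znorm_ge0.
have [t t1 tE] := absK_phase (\tr X).
have := cost_ge0 s; rewrite le_eqVlt => /predU1P[/esym cost0|cost_gt0].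
  suff -> : X = 0 by rewrite mxtrace0 absK0 mulr_ge0 ?cost_ge0.
  apply/row_matrixP => a; rewrite row0 rowE; apply: (rnorm_eq0 hN).
  apply/eqP; rewrite eq_le rnorm_ge0 // andbT.
  apply: le_trans (SX _) _; rewrite big1 // => i _.
  have -> : m i = 0 by rewrite costE in cost0; exact: (psumr_eq0P (fun i _ => m0 i) cost0).
  by rewrite mul0r.
have := @cert_le _ (fun i => m i / cost s) y ((ofR (cost s)^-1 * t) *: X).
rewrite mxtraceZ -mulrA tE -rmorphM of_realK => h.
rewrite -ler_pdivrMr // mulrC; apply: h; split=> [i|i||w].
- by rewrite divr_ge0 ?m0 ?cost_ge0.
- exact: Bs.
- by rewrite -mulr_suml -costE divff // gt_eqF.
rewrite -scalemxAr rnormZ // absKM t1 mulr1 absK_of_real gtr0_norm ?invr_gt0 //.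
rewrite ler_pdivrMl // mulr_sumr (le_trans (SX w)) //.
apply: ler_sum => i _; rewrite le_eqVlt; apply/orP; left; apply/eqP.
by field; rewrite gt_eqF.
Qed.

(** The trace, carried to [Z^n] by [rows], extends to all of [Z^n] by Hahn-Banach, and a functional
    on [Z^n], read slot by slot, is an operator from [Z] to [K^n]. Its values on rank-one matrices
    give [P (S x) = x]; its bound on a single tensor of [z] with [y], represented at cost [|z|],
    gives the norm. *)
Lemma projection_of_certificates : exists P : {linear Z -> 'rV[K]_n},
  (forall x, P (S x) = x) /\ forall z, rnorm (P z) <= c * znorm z.
Proof.
have rowsL a X X' : rows (a *: X + X') = a *: rows X + rows X'.
  by apply/ffunP => i; rewrite !ffunE !linearP.
have [rows' rowsE] := linear_lift rowsL.
have trL a (X X' : 'M[K]_n) : \tr (a *: X + X') = a * \tr X + \tr X'.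
  by rewrite linearP.
have tr_le X : absK (\tr X) <= tensor_norm (rows' X) by rewrite rowsE trace_le.
have [g [gL gp gS]] := hahn_banach tensor_normD tensor_normZ trL tr_le.
pose slot (a : 'I_n) (z : Z) : V := [ffun b => (b == a)%:R *: z].
have g0 : g 0 = 0 by have := gL (-1) 0 0; rewrite scaler0 addr0 mulN1r addNr.
have [P PE] : exists P : {linear Z -> 'rV[K]_n}, P =1 (fun z => \row_a g (slot a z)).
  apply: linear_lift => t z z'; apply/rowP => a; rewrite !mxE -gL; congr g.
  by apply/ffunP => b; rewrite !ffunE scalerDr !scalerA mulrC.
exists P; split=> [x|z].
  apply/rowP => a; rewrite PE mxE.
  have -> : slot a (S x) = rows' (delta_mx a 0 *m x).
    apply/ffunP => b; rewrite rowsE !ffunE -linearZ; congr (S _).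
    apply/rowP => i; rewrite !mxE big_ord1 !mxE eqxx andbT.
    by [].
  by rewrite gS mxtrace_mulC /mxtrace big_ord1 -colE mxE.
apply: (rnorm_le_dual hN) => y By.
have -> : inner (P z) y = g [ffun a => conjK (y 0 a) *: z].
  rewrite PE; transitivity (g (\sum_a conjK (y 0 a) *: slot a z)).
    rewrite /inner; under eq_bigr do rewrite mxE mulrC.
    by elim/big_rec2 : _ => [|i u v _ ->]; rewrite ?g0 ?gL.
  congr g; apply/ffunP => b; rewrite sum_ffunE ffunE (bigD1 b) //= big1 ?addr0 => [|a ab].
    by rewrite !ffunE eqxx scale1r.
  by rewrite !ffunE [b == a]eq_sym (negbTE ab) scale0r scaler0.
apply: le_trans (gp _) _.
have := represents_cons (d := (z, y)) By represents_nil.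
by rewrite addr0 => /tensor_norm_le; rewrite /cost big_seq1.
Qed.

End Projection.
End Certificate.

(** * The energy of isotropic frames *)

Section FourthMoment.
Variables (R : realType) (k : scalar_kind).
Local Notation K := (scalars R k).
Local Notation ofR := (@of_real R k).

(* The number of pairings of [v_a v_b conj(v_c) conj(v_d)] that contract to
   [|v|^4], minus one. *)
Definition fieldq : nat := if k is Reals then 2 else 1.

Let realb : nat := if k is Reals then 1 else 0.

Section Tensor.
Variable n : nat.

(** Up to a scalar, the average of [v_a v_b conj(v_c) conj(v_d)] over the unit sphere. The
    contraction of [a] with [b] occurs only over the reals. *)
Definition pairing (a b c d : 'I_n) : R :=
  ((a == c) && (b == d))%:R + ((a == d) && (b == c))%:R
  + realb%:R * ((a == b) && (c == d))%:R.

Let sum_eq (A : nmodType) (i : 'I_n) (F : 'I_n -> A) (b : 'I_n -> bool) :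
  (forall j, b j = (j == i)) -> \sum_j F j *+ b j = F i.
Proof.
move=> bE; rewrite (bigD1 i) //= big1 ?addr0 => [|j /negbTE ji]; rewrite bE.
  by rewrite eqxx.
by rewrite ji.
Qed.

Let sum_pairing (F : 'I_n -> 'I_n -> 'I_n -> 'I_n -> R) :
  \sum_a \sum_b \sum_c \sum_d F a b c d * pairing a b c d =
  \sum_a \sum_b F a b a b + \sum_a \sum_b F a b b a
  + realb%:R * \sum_a \sum_c F a a c c.
Proof.
rewrite /pairing mulr_sumr -!big_split; apply: eq_bigr => a _ /=.
transitivity (\sum_b (F a b a b + F a b b a) +
    \sum_b realb%:R * (\sum_c F a b c c) *+ (b == a)); last first.
  by rewrite big_split /= (@sum_eq _ a (fun b => realb%:R * \sum_c F a b c c)).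
transitivity (\sum_b (F a b a b + F a b b a +
    realb%:R * (\sum_c F a b c c) *+ (b == a))); last by rewrite big_split.
apply: eq_bigr => b _.
have -> : F a b a b = \sum_c \sum_d F a b c d * ((a == c) && (b == d))%:R.
  rewrite -[LHS](@sum_eq _ a (fun c => F a b c b) (fun c => a == c)) => [|c];
    last exact: eq_sym.
  apply: eq_bigr => c _.
  rewrite -[LHS](@sum_eq _ b (fun d => F a b c d *+ (a == c)) (fun d => b == d)) => [|d];
    last exact: eq_sym.
  by apply: eq_bigr => d _; rewrite -mulrnA mulnb mulr_natr.
have -> : F a b b a = \sum_c \sum_d F a b c d * ((a == d) && (b == c))%:R.
  rewrite -[LHS](@sum_eq _ b (fun c => F a b c a) (fun c => b == c)) => [|c];
    last exact: eq_sym.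
  apply: eq_bigr => c _.
  rewrite -[LHS](@sum_eq _ a (fun d => F a b c d *+ (b == c)) (fun d => a == d)) => [|d];
    last exact: eq_sym.
  by apply: eq_bigr => d _; rewrite -mulrnA mulnb mulr_natr andbC.
have -> : realb%:R * (\sum_c F a b c c) *+ (b == a) =
    \sum_c \sum_d F a b c d * (realb%:R * ((a == b) && (c == d))%:R).
  rewrite mulr_sumr -sumrMnl; apply: eq_bigr => c _.
  rewrite -[LHS](@sum_eq _ c (fun d => realb%:R * F a b c d *+ (b == a)) (fun d => c == d)) => [|d];
    last exact: eq_sym.
  apply: eq_bigr => d _; rewrite [b == a]eq_sym.
  by case: (a == b); case: (c == d); rewrite /= ?mulr1n ?mulr0n ?mulr1 ?mulr0 ?mul0rn // mulrC.
rewrite -!big_split; apply: eq_bigr => c _ /=.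
by rewrite -!big_split; apply: eq_bigr => d _ /=; rewrite !mulrDr.
Qed.

(** Each of the [fieldq.+1] pairings contributes [n (n + fieldq)], since [pairing] restricted to it
    is [1 + fieldq%:R * (a == b)%:R]. *)
Lemma sum_pairing_sq :
  \sum_a \sum_b \sum_c \sum_d pairing a b c d * pairing a b c d =
  (fieldq.+1 * n * (n + fieldq))%:R.
Proof.
have s1 (a : 'I_n) : \sum_(b < n) (a == b)%:R = 1 :> R.
  by rewrite -[RHS](@sum_eq _ a (fun=> 1) (fun b => a == b)) // => b; exact: eq_sym.
have s2 (F : 'I_n -> 'I_n -> R) : (forall a b, F a b = 1 + fieldq%:R * (a == b)%:R) ->
    \sum_a \sum_b F a b = (n * (n + fieldq))%:R.
  move=> FE; transitivity (\sum_(a < n) (n + fieldq)%:R : R); last first.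
    by rewrite sumr_const card_ord -[LHS]mulr_natl natrM.
  apply: eq_bigr => a _; under eq_bigr do rewrite FE.
  by rewrite big_split /= sumr_const card_ord -mulr_sumr s1 mulr1 natrD.
have s3 : realb%:R * \sum_a \sum_c pairing a a c c = realb%:R * (n * (n + fieldq))%:R :> R.
  have [->|r1] := posnP realb; first by rewrite !mul0r.
  congr (_ * _); apply: s2 => a b; rewrite /pairing !eqxx.
  move: r1; rewrite /fieldq /realb; case: k => // _ /=.
  by case: eqVneq => _ /=; ring.
rewrite sum_pairing s3 !s2 => [|a b|a b].
  by rewrite -natrM -!natrD /fieldq /realb; congr (_%:R); case: k; ring.
all: rewrite /pairing; case: (eqVneq a b) => [->|ab].
all: rewrite ?eqxx ?(negbTE ab) ?[b == a]eq_sym ?(negbTE ab) /fieldq /realb.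
all: by case: k => /=; ring.
Qed.

Variables (I : finType) (mu : I -> R) (v : I -> 'rV[K]_n).

Let T (a b c d : 'I_n) : K := \sum_l ofR (mu l) *
  (v l 0 a * v l 0 b * conjK (v l 0 c) * conjK (v l 0 d)).

Let sum4 (A B C D : 'I_n -> K) :
  \sum_a \sum_b \sum_c \sum_d A a * B b * C c * D d =
  (\sum_a A a) * (\sum_b B b) * (\sum_c C c) * (\sum_d D d).
Proof.
rewrite !mulr_suml; apply: eq_bigr => a _.
rewrite [A a * _]mulr_sumr !mulr_suml; apply: eq_bigr => b _.
rewrite [A a * B b * _]mulr_sumr mulr_suml; apply: eq_bigr => c _.
by rewrite mulr_sumr.
Qed.

Let sumT_sq : \sum_a \sum_b \sum_c \sum_d absK (T a b c d) ^+ 2 =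
  \sum_l \sum_j mu l * mu j * absK (inner (v l) (v j)) ^+ 4.
Proof.
apply: (@of_real_inj _ k); rewrite !rmorph_sum /=.
transitivity (\sum_l \sum_j \sum_a \sum_b \sum_c \sum_d ofR (mu l * mu j) *
  (v l 0 a * conjK (v j 0 a) * (v l 0 b * conjK (v j 0 b)) *
   (conjK (v l 0 c) * v j 0 c) * (conjK (v l 0 d) * v j 0 d))).
  pose F l j a b c d := ofR (mu l * mu j) *
  (v l 0 a * conjK (v j 0 a) * (v l 0 b * conjK (v j 0 b)) *
   (conjK (v l 0 c) * v j 0 c) * (conjK (v l 0 d) * v j 0 d)).
  transitivity (\sum_a \sum_b \sum_c \sum_d \sum_l \sum_j F l j a b c d).
    apply: eq_bigr => a _; rewrite rmorph_sum; apply: eq_bigr => b _ /=.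
    rewrite rmorph_sum; apply: eq_bigr => c _ /=.
    rewrite rmorph_sum; apply: eq_bigr => d _ /=.
    rewrite -mulz_conj /T rmorph_sum mulr_suml; apply: eq_bigr => l _.
    rewrite mulr_sumr; apply: eq_bigr => j _.
    rewrite /F !rmorphM /= !conjKK conjK_of_real; ring.
  under eq_bigr do under eq_bigr do under eq_bigr do rewrite exchange_big.
  under eq_bigr do under eq_bigr do rewrite exchange_big.
  under eq_bigr do rewrite exchange_big.
  rewrite exchange_big; apply: eq_bigr => l _ /=.
  under eq_bigr do under eq_bigr do under eq_bigr do rewrite exchange_big.
  under eq_bigr do under eq_bigr do rewrite exchange_big.
  under eq_bigr do rewrite exchange_big.
  by rewrite exchange_big.
apply: eq_bigr => l _; rewrite rmorph_sum; apply: eq_bigr => j _ /=.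
have -> : ofR (mu l * mu j * absK (inner (v l) (v j)) ^+ 4) =
    ofR (mu l * mu j) * (inner (v l) (v j) * inner (v l) (v j) *
     inner (v j) (v l) * inner (v j) (v l)).
  rewrite rmorphM /= -[4%N]/(2 * 2)%N exprM [(_ ^+ 2) ^+ 2]expr2
    [ofR (absK _ ^+ 2 * _)]rmorphM /=.
  by rewrite -mulz_conj inner_conj; congr (_ * _); ring.
rewrite -sum4 !mulr_sumr; apply: eq_bigr => a _.
rewrite mulr_sumr; apply: eq_bigr => b _.
rewrite mulr_sumr; apply: eq_bigr => c _.
rewrite mulr_sumr; apply: eq_bigr => d _.
by congr (_ * _); rewrite [conjK _ * v j 0 c]mulrC [conjK _ * v j 0 d]mulrC.
Qed.

Let S := \sum_l mu l * sqn (v l) ^+ 2.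

Let sumT_pairing : \sum_a \sum_b \sum_c \sum_d
    real_part (T a b c d) * pairing a b c d = fieldq.+1%:R * S.
Proof.
rewrite sum_pairing.
have s2 (F : 'I_n -> 'I_n -> R) : (forall a b, F a b =
    \sum_l mu l * (absK (v l 0 a) ^+ 2 * absK (v l 0 b) ^+ 2)) ->
    \sum_a \sum_b F a b = S.
  move=> FE; under eq_bigr do under eq_bigr do rewrite FE.
  under eq_bigr do rewrite exchange_big; rewrite exchange_big.
  apply: eq_bigr => l _ /=; rewrite sqnE expr2 mulr_suml mulr_sumr.
  by apply: eq_bigr => a _; rewrite !mulr_sumr.
have reT l (a b c d e f : 'I_n) :
   v l 0 a * v l 0 b * conjK (v l 0 c) * conjK (v l 0 d) =
   (v l 0 e * conjK (v l 0 e)) * (v l 0 f * conjK (v l 0 f)) ->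
   real_part (ofR (mu l) * (v l 0 a * v l 0 b * conjK (v l 0 c) * conjK (v l 0 d))) =
   mu l * (absK (v l 0 e) ^+ 2 * absK (v l 0 f) ^+ 2).
  by move=> ->; rewrite real_partZ !mulz_conj -rmorphM of_realK.
rewrite (s2 (fun a b => real_part (T a b a b))); last first.
  move=> a b; rewrite raddf_sum; apply: eq_bigr => l _; apply: reT; ring.
rewrite (s2 (fun a b => real_part (T a b b a))); last first.
  move=> a b; rewrite raddf_sum; apply: eq_bigr => l _; apply: reT; ring.
have -> : realb%:R * (\sum_a \sum_c real_part (T a a c c)) = realb%:R * S.
  have [->|r1] := posnP realb; first by rewrite !mul0r.
  congr (_ * _); apply: s2 => a b; rewrite raddf_sum; apply: eq_bigr => l _.
  apply: reT; move: r1 v; rewrite /realb /conjK; case: k => // _ v0 /=; ring.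
by rewrite /realb /fieldq; case: k; ring.
Qed.

(* Positivity of [\sum |T - s * pairing|^2] for the optimal [s]. *)
Lemma fourth_moment_ge :
  fieldq.+1%:R * (\sum_l mu l * sqn (v l) ^+ 2) ^+ 2 <=
  (n * (n + fieldq))%:R *
   \sum_l \sum_j mu l * mu j * absK (inner (v l) (v j)) ^+ 4.
Proof.
rewrite -/S -sumT_sq; set Q := \sum_a _.
have [n0|n_gt0] := posnP n.
  have -> : S = 0; last by rewrite expr0n mulr0 n0 mul0r.
  rewrite /S big1 // => l _; rewrite sqnE big1 ?expr0n ?mulr0 // => a.
  by case/eqP: (lt0n_neq0 (leq_ltn_trans (leq0n a) (ltn_ord a))).
have N0 : 0 < (n * (n + fieldq))%:R :> R by rewrite ltr0n muln_gt0 n_gt0 addn_gt0 n_gt0.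
(* The ratio of the product of [T] with [pairing], equal to [fieldq.+1 * S], to the square sum of
   [pairing]. *)
pose s := S / (n * (n + fieldq))%:R.
have : 0 <= \sum_a \sum_b \sum_c \sum_d absK (T a b c d - ofR (s * pairing a b c d)) ^+ 2.
  by do 4!apply: sumr_ge0 => ? _; exact: sqr_ge0.
have -> : \sum_a \sum_b \sum_c \sum_d absK (T a b c d - ofR (s * pairing a b c d)) ^+ 2
  = Q - 2 * s * (fieldq.+1%:R * S) + s ^+ 2 * (fieldq.+1 * n * (n + fieldq))%:R.
  rewrite -sumT_pairing -sum_pairing_sq !mulr_sumr -sumrB -big_split /=.
  apply: eq_bigr => a _; rewrite !mulr_sumr -sumrB -big_split /=.
  apply: eq_bigr => b _; rewrite !mulr_sumr -sumrB -big_split /=.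
  apply: eq_bigr => c _; rewrite !mulr_sumr -sumrB -big_split /=.
  apply: eq_bigr => d _.
  apply: (@of_real_inj _ k); rewrite -mulz_conj rmorphB /= conjK_of_real.
  set x := s * _; set z := T _ _ _ _.
  have -> : (z - ofR x) * (conjK z - ofR x) =
      z * conjK z - (z + conjK z) * ofR x + ofR (x ^+ 2).
    by rewrite rmorphXn /=; ring.
  have -> : z + conjK z = ofR (2 * real_part z).
    rewrite /z; case: k (T a b c d) => /= [y|[y1 y2]]; first by ring.
    by rewrite /GRing.add /=; congr Complex; ring.
  rewrite mulz_conj -rmorphM -rmorphB -rmorphD /=; congr (ofR _).
  rewrite /x; ring.
rewrite -mulnA natrM /s; move: (_%:R) N0 => N N0 h.
rewrite -subr_ge0.
have -> : N * Q - fieldq.+1%:R * S ^+ 2 =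
    N * (Q - 2 * (S / N) * (fieldq.+1%:R * S) + (S / N) ^+ 2 * (fieldq.+1%:R * N)).
  by field; rewrite gt_eqF.
by rewrite mulr_ge0 // ltW.
Qed.
End Tensor.
End FourthMoment.

(** * The constants of the quartic majorant *)

Section EnergyConstants.
Variables (R : realType) (k : scalar_kind) (n : nat).
Hypothesis hn : (2 <= n)%N.
Local Notation q := ((fieldq k)%:R : R).

(** The Welch bound [sqrt ((d - n) / (n (d - 1)))] for [d = dmax k n] unit vectors simplifies to
    this value. *)
Definition etf_angle : R := (Num.sqrt (n%:R + q))^-1.
Local Notation c := etf_angle.

Definition energy_slope : R := (2 * c * (1 + c) ^+ 2)^-1.
Local Notation e := energy_slope.

(** The coefficient left for [(\sum_l m_l |v_l|)^2] when the fourth-moment bound is subtracted from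
    the constant term of the majorant. *)
Definition energy_gap : R :=
  e * (c ^+ 2 * (1 + 2 * c) - (q + 1) / (n%:R * (n%:R + q))).

Let s : R := Num.sqrt (n%:R + q).
Let s2 : s ^+ 2 = n%:R + q.
Proof. by rewrite sqr_sqrtr // addr_ge0 ?ler0n. Qed.

Let q1 : 1 <= q. Proof. by rewrite /fieldq; case: k; rewrite ler1n. Qed.
Let n2 : 2 <= n%:R :> R. Proof. by rewrite ler_nat. Qed.
Let s_gt0 : 0 < s.
Proof. by rewrite sqrtr_gt0; have := q1; have := n2; lra. Qed.

Lemma etf_angle_gt0 : 0 < c. Proof. by rewrite invr_gt0. Qed.

Lemma etf_angle_sq : c ^+ 2 * (n%:R + q) = 1.
Proof. by rewrite -s2 -exprMn mulVf ?expr1n // gt_eqF. Qed.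

Lemma etf_angle_lt1 : c < 1.
Proof.
have := etf_angle_sq; have := etf_angle_gt0; have := q1; have := n2; nra.
Qed.

Lemma energy_slope_gt0 : 0 < e.
Proof.
by rewrite invr_gt0 mulr_gt0 ?exprn_gt0 ?mulr_gt0 ?addr_gt0 ?etf_angle_gt0.
Qed.

(* On [0, 1] the left side majorizes [u], with equality at [c] and [1] only. *)
Lemma quartic_majorant (u : R) :
  e * (c ^+ 2 * (1 + 2 * c)) + e * (1 + 2 * c + 3 * c ^+ 2) * u ^+ 2
    - e * u ^+ 4
  = u + e * ((1 - u) * (u - c) ^+ 2) * (u + 1 + 2 * c).
Proof.
rewrite /e; field; rewrite !gt_eqF ?etf_angle_gt0 //.
by rewrite addr_gt0 ?etf_angle_gt0.
Qed.

(** This sign is what allows [(\sum_l m_l |v_l|)^2 <= n] to be inserted in an upper bound.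
    Denominators cleared, the claim is [n (1 + 2 c) > q + 1]; [n >= q + 1] settles it except in the
    real plane, where [c = 1/2]. *)
Lemma energy_gap_gt0 : 0 < energy_gap.
Proof.
have nq : 0 < n%:R + q by have := q1; have := n2; lra.
have c2 : c ^+ 2 = (n%:R + q)^-1.
  by apply: (mulIf (lt0r_neq0 nq)); rewrite etf_angle_sq mulVf // gt_eqF.
rewrite /energy_gap mulr_gt0 ?energy_slope_gt0 // c2.
have -> : (n%:R + q)^-1 * (1 + 2 * c) - (q + 1) / (n%:R * (n%:R + q)) =
    (n%:R * (1 + 2 * c) - (q + 1)) / (n%:R * (n%:R + q)).
  by field; rewrite !gt_eqF //; have := n2; lra.
rewrite divr_gt0 //; last by rewrite mulr_gt0 //; have := n2; lra.
have := etf_angle_gt0; have := etf_angle_sq; have := n2.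
rewrite /fieldq; case: k => /=; last by nra.
have [n3 _|] := leqP 3 n.
  by have : 3 <= n%:R :> R; [rewrite ler_nat|nra].
rewrite ltnS => n_le2; have -> : n = 2%N by apply/eqP; rewrite eqn_leq n_le2.
nra.
Qed.


(** The right side is the energy of a maximal ETF scaled to length [sqrt n] with weights [1 / d]:
    the diagonal gives [n / d = q / (n + q - 1)], the other pairs give [(n - n / d) c]. *)
Lemma delta_angle :
  delta R k n = q / (n%:R + q - 1) + (n%:R - q / (n%:R + q - 1)) * c.
Proof.
have nE : n%:R = s ^+ 2 - q by rewrite s2 addrK.
have n0 := n2; have t0 := s_gt0; rewrite nE in n0.
rewrite /delta /etf_angle; move: nE n0 t0; rewrite /s /fieldq; case: k => /=.
  set t := Num.sqrt _ => -> h t0; field.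
  by rewrite !gt_eqF //; nra.
set t := Num.sqrt _ => -> h t0; field.
by rewrite !gt_eqF //; nra.
Qed.

(** The right side is what the majorant yields when the term in [u^2] has moment 1 and
    [(\sum_l m_l |v_l|)^2 = n], so the bound meets the energy in [delta_angle]. *)
Lemma delta_energy :
  delta R k n = e * (1 + 2 * c + 3 * c ^+ 2) + energy_gap * n%:R.
Proof.
have nE : n%:R = s ^+ 2 - q by rewrite s2 addrK.
have n0 := n2; have t0 := s_gt0; rewrite nE in n0.
rewrite delta_angle -/s.
rewrite /energy_gap /e /etf_angle -/s nE.
have := q1 => q1'; field.
rewrite !gt_eqF //; nra.
Qed.
End EnergyConstants.

(** * The energy inequality with its slack terms *)

Section FrameEnergy.
Variables (R : realType) (k : scalar_kind).
Local Notation K := (scalars R k).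
Local Notation ofR := (@of_real R k).
Variables (r : nat) (I : finType) (m : I -> R) (v : I -> 'rV[K]_r).
Hypothesis m_ge0 : forall l, 0 <= m l.
Hypothesis m_le1 : \sum_l m l <= 1.
Hypothesis frame : forall x, \sum_l (ofR (m l) * inner x (v l)) *: v l = x.

Local Notation G i j := (absK (inner (v i) (v j))).

Lemma frame_inner x y :
  \sum_l ofR (m l) * (inner x (v l) * inner (v l) y) = inner x y.
Proof.
rewrite -{2}[x]frame inner_suml; apply: eq_bigr => l _.
by rewrite innerZl mulrA.
Qed.

Lemma frame_sqn x : \sum_l m l * absK (inner x (v l)) ^+ 2 = sqn x.
Proof.
apply: (@of_real_inj _ k); rewrite -inner_sqn -frame_inner rmorph_sum.
by apply: eq_bigr => l _; rewrite rmorphM /= -mulz_conj inner_conj.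
Qed.

Lemma frame_trace : \sum_l m l * sqn (v l) = r%:R.
Proof.
transitivity (\sum_(a < r) \sum_l m l * absK (inner (delta_mx 0 a) (v l)) ^+ 2).
  rewrite exchange_big; apply: eq_bigr => l _ /=.
  rewrite sqnE mulr_sumr; apply: eq_bigr => a _.
  by rewrite inner_deltal absK_conj.
transitivity (\sum_(a < r) (1 : R)); last by rewrite sumr_const card_ord.
apply: eq_bigr => a _; rewrite frame_sqn /sqn inner_delta mxE !eqxx /=.
by rewrite -(rmorph1 ofR) of_realK.
Qed.

Lemma sum_nrm_sq : (\sum_l m l * nrm (v l)) ^+ 2 <= (\sum_l m l) * r%:R.
Proof.
rewrite -frame_trace; set A := \sum_l m l; set B := \sum_l m l * nrm _.
set C := \sum_l _.
have A0 : 0 <= A by exact: sumr_ge0.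
have h t : 0 <= C - 2 * t * B + t ^+ 2 * A.
  have -> : C - 2 * t * B + t ^+ 2 * A = \sum_l m l * (nrm (v l) - t) ^+ 2.
    rewrite /A /B /C !mulr_sumr -sumrB -big_split; apply: eq_bigr => l _ /=.
    by rewrite -nrm_sq; ring.
  by apply: sumr_ge0 => l _; rewrite mulr_ge0 // sqr_ge0.
have [A_gt0|] := boolP (0 < A).
  rewrite -subr_ge0; have := h (B / A).
  have -> : C - 2 * (B / A) * B + (B / A) ^+ 2 * A = (C * A - B ^+ 2) / A.
    by field; rewrite gt_eqF.
  by rewrite pmulr_lge0 ?invr_gt0 // mulrC.
rewrite -leNgt => A_le0; have A00 : A = 0 by apply/eqP; rewrite eq_le A_le0.
have m0 l : m l = 0 by exact: (psumr_eq0P (fun i _ => m_ge0 i) A00).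
by rewrite /B big1 ?expr0n ?A00 ?mul0r // => l _; rewrite m0 mul0r.
Qed.

(* The left side is the squared Hilbert-Schmidt norm of
   [H = \sum_l m_l |v_l|^-1 v_l^* v_l]; expand
   [0 <= \sum_l m_l |v_l H - |v_l|^-1 v_l|^2]. *)
Lemma cubic_energy_le :
  \sum_i \sum_j m i * m j * (G i j ^+ 2 / (nrm (v i) * nrm (v j))) <= \sum_l m l.
Proof.
set Q := \sum_i _.
pose h l : 'rV[K]_r := \sum_j (ofR (m j / nrm (v j)) * inner (v l) (v j)) *: v j.
have hv l : real_part (inner (h l) (v l)) = \sum_j m j / nrm (v j) * G l j ^+ 2.
  rewrite inner_suml raddf_sum; apply: eq_bigr => j _ /=.
  by rewrite innerZl -mulrA -[inner (v j) _]inner_conj mulz_conj -rmorphM of_realK.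
have hh : \sum_l m l * sqn (h l) = Q.
  transitivity (real_part (\sum_l ofR (m l) * inner (h l) (h l))).
    by rewrite raddf_sum; apply: eq_bigr => l _; rewrite /= real_partZ.
  rewrite -[RHS](@of_realK _ k); congr real_part.
  transitivity (\sum_i \sum_j \sum_l ofR (m l) * (ofR (m i / nrm (v i) * (m j / nrm (v j))) *
     (inner (v l) (v i) * inner (v j) (v l) * inner (v i) (v j)))).
    transitivity (\sum_l \sum_i \sum_j ofR (m l) * (ofR (m i / nrm (v i) * (m j / nrm (v j))) *
     (inner (v l) (v i) * inner (v j) (v l) * inner (v i) (v j)))).
      apply: eq_bigr => l _; rewrite {1}/h inner_suml mulr_sumr; apply: eq_bigr => i _.
      rewrite inner_sumr mulr_sumr; apply: eq_bigr => j _.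
      rewrite innerZl innerZr !rmorphM /= !conjK_of_real inner_conj; ring.
    by rewrite exchange_big; apply: eq_bigr => i _; rewrite exchange_big.
  rewrite rmorph_sum; apply: eq_bigr => i _; rewrite rmorph_sum; apply: eq_bigr => j _ /=.
  transitivity (ofR (m i / nrm (v i) * (m j / nrm (v j))) * inner (v i) (v j) *
     \sum_l ofR (m l) * (inner (v j) (v l) * inner (v l) (v i))).
    by rewrite mulr_sumr; apply: eq_bigr => l _; ring.
  rewrite frame_inner -mulrA -[inner (v j) _]inner_conj mulz_conj -rmorphM; congr (ofR _).
  by rewrite invfM; ring.
have : 0 <= \sum_l m l * sqn (h l - ofR (nrm (v l))^-1 *: v l).
  by apply: sumr_ge0 => l _; rewrite mulr_ge0 ?sqn_ge0.
have -> : \sum_l m l * sqn (h l - ofR (nrm (v l))^-1 *: v l) =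
   Q - 2 * Q + \sum_l m l * ((nrm (v l))^-1 * nrm (v l)) ^+ 2.
  rewrite -{1}hh mulr_sumr -sumrB -big_split /=; apply: eq_bigr => l _.
  rewrite sqnB sqnZ innerZr conjK_of_real real_partZ hv absK_of_real.
  rewrite real_normK ?num_real // !mulr_sumr !(mulrDr, mulrN) exprMn nrm_sq.
  rewrite addrAC; congr (_ - _ + _).
  rewrite !mulr_sumr; apply: eq_bigr => j _; rewrite invfM; ring.
move=> Q0; have : \sum_l m l * ((nrm (v l))^-1 * nrm (v l)) ^+ 2 <= \sum_l m l.
  apply: ler_sum => l _; rewrite -[leRHS]mulr1 ler_wpM2l //.
  by have [->|n0] := eqVneq (nrm (v l)) 0; rewrite ?mulr0 ?expr0n // mulVf // expr1n.
lra.
Qed.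

(** Division by zero makes this 0 when a vector vanishes, and [cosineE] covers that case too. *)
Definition cosine i j : R := G i j / (nrm (v i) * nrm (v j)).

Lemma cosineE i j : nrm (v i) * nrm (v j) * cosine i j = G i j.
Proof.
have [/eqP|n0] := eqVneq (nrm (v i) * nrm (v j)) 0; last by rewrite mulrC mulfVK.
rewrite mulf_eq0 !nrm_eq0 => /orP [] /eqP v0.
  by rewrite v0 inner0l absK0 /nrm /sqn inner0l raddf0 sqrtr0 !mul0r.
by rewrite v0 inner0r absK0 /nrm /sqn inner0l raddf0 sqrtr0 mulr0 mul0r.
Qed.

Lemma cosine_ge0 i j : 0 <= cosine i j.
Proof. by rewrite divr_ge0 ?absK_ge0 // mulr_ge0 ?nrm_ge0. Qed.

Lemma cosine_le1 i j : cosine i j <= 1.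
Proof.
have [n0|] := boolP (0 < nrm (v i) * nrm (v j)).
  by rewrite ler_pdivrMr // mul1r cauchy_schwarz.
rewrite -leNgt => n0; have/eqP-E : nrm (v i) * nrm (v j) == 0.
  by rewrite eq_le n0 mulr_ge0 ?nrm_ge0.
by rewrite /cosine E invr0 mulr0.
Qed.

Variable n : nat.
Hypotheses (hn : (2 <= n)%N) (hr : (r <= n)%N).
Local Notation q := ((fieldq k)%:R : R).
Local Notation c := (etf_angle R k n).
Local Notation e := (energy_slope R k n).

(** The remainder in [quartic_majorant] up to [e] and its last factor, which is at least 1. For
    nonzero vectors it vanishes exactly at the cosines 1 and [c]. *)
Definition etf_defect i j : R :=
  nrm (v i) * nrm (v j) * ((1 - cosine i j) * (cosine i j - c) ^+ 2).

Lemma etf_defect_ge0 i j : 0 <= etf_defect i j.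
Proof.
apply: mulr_ge0; first by rewrite mulr_ge0 ?nrm_ge0.
by apply: mulr_ge0; rewrite ?sqr_ge0 // subr_ge0 cosine_le1.
Qed.

(** The fourth-moment inequality with weights [m_l / |v_l|^3], chosen to give degree one in each
    length: [m_l |v_l|^4] becomes [m_l |v_l|]. It holds in dimension [r], and [r <= n] lets [n]
    replace [r]. *)
Lemma quartic_energy_ge :
  (q + 1) / (n%:R * (n%:R + q)) * (\sum_l m l * nrm (v l)) ^+ 2 <=
  \sum_i \sum_j m i * m j * (nrm (v i) * nrm (v j) * cosine i j ^+ 4).
Proof.
have n2 : 2 <= n%:R :> R by rewrite ler_nat.
have q0 : 0 <= q by rewrite ler0n.
have N0 : 0 < n%:R * (n%:R + q) :> R by rewrite mulr_gt0 //; lra.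
rewrite mulrAC ler_pdivrMr // [leRHS]mulrC.
have := fourth_moment_ge (fun l => m l / nrm (v l) ^+ 3) v.
have -> : \sum_l m l / nrm (v l) ^+ 3 * sqn (v l) ^+ 2 = \sum_l m l * nrm (v l).
  apply: eq_bigr => l _; rewrite -nrm_sq.
  have [->|n0] := eqVneq (nrm (v l)) 0; last by field.
  by rewrite !expr0n /= !mulr0.
rewrite -natr1 => h; apply: le_trans h _.
set S := \sum_i \sum_j m i * m j * _.
set S' := \sum_i _.
have -> : S' = S.
  apply: eq_bigr => i _; apply: eq_bigr => j _; rewrite -!cosineE.
  have [->|n0] := eqVneq (nrm (v i)) 0; first by rewrite !(mul0r, mulr0, expr0n, invr0).
  have [->|n1] := eqVneq (nrm (v j)) 0; first by rewrite !(mul0r, mulr0, expr0n, invr0).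
  by field; rewrite n0 n1.
rewrite -natrD -natrM. rewrite ler_wpM2r //; last by rewrite ler_nat leq_mul // leq_add2r.
apply: sumr_ge0 => i _; apply: sumr_ge0 => j _.
apply: mulr_ge0; first exact: mulr_ge0.
by rewrite mulr_ge0 ?exprn_ge0 ?cosine_ge0 // mulr_ge0 ?nrm_ge0.
Qed.

(** Sum [quartic_majorant] with the weights [m_i m_j |v_i| |v_j|], then apply [cubic_energy_le] and
    [quartic_energy_ge]. Both slack terms stay, for the equality case and for stability. *)
Lemma frame_energy :
  \sum_i \sum_j m i * m j * G i j + e * (\sum_i \sum_j m i * m j * etf_defect i j)
  + energy_gap R k n * (n%:R - (\sum_l m l * nrm (v l)) ^+ 2) <= delta R k n.
Proof.
set B := \sum_l m l * nrm (v l).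
set D := \sum_i \sum_j m i * m j * etf_defect i j.
pose Q := \sum_i \sum_j m i * m j * (G i j ^+ 2 / (nrm (v i) * nrm (v j))).
pose F := \sum_i \sum_j m i * m j * (nrm (v i) * nrm (v j) * cosine i j ^+ 4).
have e0 : 0 < e by exact: energy_slope_gt0.
have c0 : 0 < c by exact: etf_angle_gt0.
have Q1 : Q <= 1 by apply: le_trans m_le1; exact: cubic_energy_le.
have F1 := quartic_energy_ge; rewrite -/F -/B in F1.
have main : \sum_i \sum_j m i * m j * G i j + e * D <=
    e * (c ^+ 2 * (1 + 2 * c)) * B ^+ 2 + e * (1 + 2 * c + 3 * c ^+ 2) * Q - e * F.
  rewrite [B ^+ 2]expr2 /B mulr_suml /D /Q /F !mulr_sumr -!big_split /= -sumrB.
  apply: ler_sum => i _; rewrite !mulr_sumr -!big_split /= -sumrB.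
  apply: ler_sum => j _.
  set M := m i * m j; have M0 : 0 <= M by rewrite mulr_ge0.
  have -> : G i j ^+ 2 / (nrm (v i) * nrm (v j)) = nrm (v i) * nrm (v j) * cosine i j ^+ 2.
    rewrite -cosineE; have [->|n0] := eqVneq (nrm (v i) * nrm (v j)) 0.
      by rewrite !mul0r expr0n mul0r.
    by move: n0; rewrite mulf_eq0 negb_or => /andP[ni nj]; field; rewrite ni nj.
  have P0 : 0 <= nrm (v i) * nrm (v j) by rewrite mulr_ge0 ?nrm_ge0.
  rewrite -cosineE /etf_defect.
  have := cosine_ge0 i j; have := cosine_le1 i j.
  have := @quartic_majorant R k n hn (cosine i j).
  move: (cosine i j) => u maj u1 u0.
  have u2 : 0 <= (1 - u) * (u - c) ^+ 2 by rewrite mulr_ge0 ?sqr_ge0 // subr_ge0.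
  rewrite -subr_ge0.
  have -> : e * (c ^+ 2 * (1 + 2 * c)) * (m i * nrm (v i) * (m j * nrm (v j))) +
    e * (1 + 2 * c + 3 * c ^+ 2) * (M * (nrm (v i) * nrm (v j) * u ^+ 2)) -
    e * (M * (nrm (v i) * nrm (v j) * u ^+ 4)) -
    (M * (nrm (v i) * nrm (v j) * u) +
     e * (M * (nrm (v i) * nrm (v j) * ((1 - u) * (u - c) ^+ 2)))) =
    M * (nrm (v i) * nrm (v j)) * ((e * (c ^+ 2 * (1 + 2 * c)) +
      e * (1 + 2 * c + 3 * c ^+ 2) * u ^+ 2
    - e * u ^+ 4) - u - e * ((1 - u) * (u - c) ^+ 2)).
    by rewrite /M; ring.
  rewrite maj; apply: mulr_ge0; first exact: mulr_ge0.
  have -> : u + e * ((1 - u) * (u - c) ^+ 2) * (u + 1 + 2 * c) - u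
      - e * ((1 - u) * (u - c) ^+ 2)
    = e * ((1 - u) * (u - c) ^+ 2) * (u + 2 * c) by ring.
  apply: mulr_ge0; first by apply: mulr_ge0 => //; exact: ltW.
  by rewrite addr_ge0 // mulr_ge0 // ltW.
rewrite delta_energy // /energy_gap.
have eQ : e * (1 + 2 * c + 3 * c ^+ 2) * Q <= e * (1 + 2 * c + 3 * c ^+ 2).
  rewrite -[leRHS]mulr1 ler_wpM2l // ltW // mulr_gt0 //.
  by rewrite addr_gt0 ?mulr_gt0 ?exprn_gt0 // addr_gt0 ?mulr_gt0.
have eF : e * ((q + 1) / (n%:R * (n%:R + q)) * B ^+ 2) <= e * F by rewrite ler_pM2l.
move: main eQ eF; set X := _ / _; lra.
Qed.

End FrameEnergy.

(** * From certificates to isotropic frames *)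

Section CertificateFrame.
Variables (R : realType) (k : scalar_kind) (n : nat).
Local Notation K := (scalars R k).
Local Notation ofR := (@of_real R k).

Lemma mulmx_adj (x y : 'rV[K]_n) : x *m adj y = (inner x y)%:M.
Proof.
by apply/rowP => i; rewrite ord1 !mxE eqxx mulr1n; apply: eq_bigr => j _; rewrite !mxE.
Qed.

(** The reconstruction formula exhibits a left inverse of [adj A]. *)
Lemma frame_unitmx (I : finType) (m : I -> R) (y : I -> 'rV[K]_n) (A : 'M[K]_n) :
  (forall x, \sum_l (ofR (m l) * inner x (y l *m adj A)) *: (y l *m adj A) = x) ->
  A \in unitmx.
Proof.
move=> frame; pose v l := y l *m adj A.
pose B : 'M[K]_n := \sum_l ofR (m l) *: (adj (v l) *m y l).
have : B *m adj A = 1%:M.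
  apply/row_matrixP => i; rewrite !rowE mulmx1.
  rewrite mulmxA mulmx_sumr mulmx_suml -[RHS]frame; apply: eq_bigr => l _.
  by rewrite -scalemxAr -scalemxAl !mulmxA mulmx_adj mul_scalar_mx -scalemxAl scalerA.
by case/mulmx1_unit => _; rewrite /adj map_unitmx unitmx_tr.
Qed.

Variable N : 'rV[K]_n -> K.
Hypothesis hN : is_norm N.
Local Notation rnorm := (rnorm N).
Variables (I : finType) (m : I -> R) (y : I -> 'rV[K]_n) (X : 'M[K]_n).
Hypothesis cert : summing_certificate N m y X.

Let M : 'M[K]_n := \sum_l ofR (m l) *: (adj (y l) *m y l).

Let mulM p p' (A : 'M[K]_(p, n)) (B : 'M[K]_(p', n)) :
  A *m M *m adj B = \sum_l ofR (m l) *: (A *m adj (y l) *m (y l *m adj B)).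
Proof.
rewrite mulmx_sumr mulmx_suml; apply: eq_bigr => l _.
by rewrite -scalemxAr -scalemxAl !mulmxA.
Qed.

Let adj_mulM p p' (A : 'M[K]_(p, n)) (B : 'M[K]_(p', n)) :
  adj (A *m M *m adj B) = B *m M *m adj A.
Proof.
rewrite !adjM adjK mulmxA; congr (_ *m _ *m _).
apply/matrixP => i j; rewrite !mxE !summxE rmorph_sum; apply: eq_bigr => l _ /=.
rewrite !mxE rmorphM /= conjK_of_real !big_ord1 !mxE rmorphM /= conjKK.
by rewrite [conjK _ * _]mulrC.
Qed.

(* [A] is a maximal family that is orthonormal for the form [M]; whatever is
   [M]-orthogonal to it is killed by [X]. *)
Lemma certificate_frame : exists r (A : 'M[K]_(r, n)),
  let v l := y l *m adj A in
  [/\ (r <= n)%N,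
      forall x, \sum_l (ofR (m l) * inner x (v l)) *: v l = x
    & \tr X = \sum_l ofR (m l) * inner (v l *m A *m X) (y l)].
Proof.
have [m_ge0 By m_le1 certX] := cert.
pose P r := `[< exists A : 'M[K]_(r, n), A *m M *m adj A = 1%:M >].
have P0 : exists r, P r.
  by exists 0%N; apply/asboolP; exists 0; apply/matrixP => -[].
have Pn r : P r -> (r <= n)%N.
  by move=> /asboolP[A]; rewrite -mulmxA => /mulmx1_min.
case: (ex_maxnP P0 Pn) => r /asboolP[A AMA] rmax; exists r, A => v.
have XE : X = M *m adj A *m A *m X.
  apply/row_matrixP => a; rewrite !rowE; move: (delta_mx 0 a) => w.
  pose w' := w - w *m M *m adj A *m A.
  have w'A : w' *m M *m adj A = 0.
    rewrite !mulmxBl -[X in _ - X](_ : w *m M *m adj A *m (A *m M *m adj A) = _).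
      by rewrite AMA mulmx1 subrr.
    by rewrite !mulmxA.
  suff : w' *m X = 0.
    by rewrite mulmxBl !mulmxA => /eqP; rewrite subr_eq0 => /eqP.
  pose s := \sum_l m l * absK (inner w' (y l)) ^+ 2.
  have sE : w' *m M *m adj w' = (ofR s)%:M.
    rewrite mulM /s rmorph_sum raddf_sum; apply: eq_bigr => l _ /=.
    rewrite !mulmx_adj -scalar_mxM scale_scalar_mx -[inner (y l) _]inner_conj mulz_conj.
    by congr (_%:M); apply: esym; exact: rmorphM.
  have s_ge0 : 0 <= s by apply: sumr_ge0 => l _; rewrite mulr_ge0 ?sqr_ge0.
  (* [s] is the value of the form [M] at [w']; were it positive, [w'] divided by its square root
     would enlarge [A]. *)
  have s0 : s = 0.
    apply/eqP; rewrite eq_le s_ge0 andbT leNgt; apply/negP => s_gt0.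
    suff /rmax : P (r + 1)%N by rewrite addn1 ltnn.
    pose t := ofR (Num.sqrt s)^-1.
    apply/asboolP; exists (col_mx A (t *: w')).
    have adjc : adj (col_mx A (t *: w')) = row_mx (adj A) (adj (t *: w')).
      by rewrite /adj tr_col_mx map_row_mx.
    rewrite adjc mul_col_mx mul_col_row AMA.
    have w0 : t *: w' *m M *m adj A = 0 by rewrite -!scalemxAl w'A scaler0.
    have -> : A *m M *m adj (t *: w') = 0.
      by rewrite -adj_mulM w0 /adj trmx0 map_mx0.
    rewrite w0 [RHS]scalar_mx_block; congr block_mx.
    have -> : adj (t *: w') = t *: adj w'.
      by apply/matrixP => i j; rewrite !mxE rmorphM /= conjK_of_real.
    rewrite -scalemxAr -!scalemxAl sE scalerA scale_scalar_mx -!rmorphM.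
    rewrite -[s in X in _ * X]sqr_sqrtr // -expr2 -exprMn mulVf ?gt_eqF ?sqrtr_gt0 //.
    by rewrite expr1n rmorph1.
  apply: (rnorm_eq0 hN); apply/eqP; rewrite eq_le rnorm_ge0 // andbT.
  apply: le_trans (certX _) _; rewrite big1 // => l _.
  have : m l * absK (inner w' (y l)) ^+ 2 == 0.
    apply/eqP; apply: (psumr_eq0P _ s0) => // i _.
    by rewrite mulr_ge0 ?sqr_ge0.
  by rewrite mulf_eq0 sqrf_eq0 => /orP[] /eqP ->; rewrite ?mul0r ?mulr0.
split; first by apply: Pn; apply/asboolP; exists A.
  move=> x; transitivity (x *m (A *m M *m adj A)); last by rewrite AMA mulmx1.
  rewrite mulM mulmx_sumr; apply: eq_bigr => l _.
  rewrite -scalemxAr !mulmxA mulmx_adj inner_mulmx -/(v l).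
  by rewrite -mulmxA mul_scalar_mx scalerA.
rewrite {1}XE -[M *m _ *m _ *m _]mulmxA mxtrace_mulC mulmxA mulM raddf_sum.
apply: eq_bigr => l _ /=; rewrite mxtraceZ mxtrace_mulC !mulmxA mulmx_adj.
by rewrite mxtrace_scalar mulr1n.
Qed.

(** Pair with [y l] in the dual ball, then use the certificate at [v l *m A], whose inner product
    with [y j] is that of [v l] with [v j]. *)
Lemma certificate_energy_bound r (A : 'M[K]_(r, n)) (v := fun l => y l *m adj A) l :
  real_part (inner (v l *m A *m X) (y l)) <=
  \sum_j m j * absK (inner (v l) (v j)).
Proof.
have [_ By _ certX] := cert.
apply: le_trans (real_part_le _) _.
have /(dual_ballP hN)/(_ (v l *m A *m X)) h := By l; apply: le_trans h _.
apply: le_trans (certX _) _; apply: ler_sum => j _.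
by rewrite inner_mulmx.
Qed.

(** Three nonnegative deficits are collected: in the trace pairing, in the angles, and in the
    lengths and total mass. The upper bound, the equality case and the nearly optimal case all start
    from here. *)
Lemma certificate_delta : (2 <= n)%N -> exists r (A : 'M[K]_(r, n)),
  let v l := y l *m adj A in
  [/\ (r <= n)%N,
      forall x, \sum_l (ofR (m l) * inner x (v l)) *: v l = x,
      \tr X = \sum_l ofR (m l) * inner (v l *m A *m X) (y l)
    & \sum_l m l * (\sum_j m j * absK (inner (v l) (v j))
          - real_part (inner (v l *m A *m X) (y l)))
      + energy_slope R k n * (\sum_i \sum_j m i * m j * etf_defect v n i j)
      + energy_gap R k n * (n%:R - (\sum_l m l * nrm (v l)) ^+ 2)
      <= delta R k n - real_part (\tr X)].
Proof.
move=> hn; have [m_ge0 By m_le1 certX] := cert.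
have [r [A [hr frame trX]]] := certificate_frame.
exists r, A; split=> //=.
have := frame_energy m_ge0 m_le1 frame hn hr.
set v := fun l => y l *m adj A.
have -> : real_part (\tr X) = \sum_l m l * real_part (inner (v l *m A *m X) (y l)).
  by rewrite trX raddf_sum; apply: eq_bigr => l _ /=; rewrite real_partZ.
have -> : \sum_l m l * (\sum_j m j * absK (inner (v l) (v j))
      - real_part (inner (v l *m A *m X) (y l))) =
    \sum_i \sum_j m i * m j * absK (inner (v i) (v j)) -
    \sum_l m l * real_part (inner (v l *m A *m X) (y l)).
  rewrite -sumrB; apply: eq_bigr => l _; rewrite mulrBr mulr_sumr; congr (_ - _).
  by apply: eq_bigr => j _; rewrite mulrA.
by lra.
Qed.

Lemma certificate_le_delta : (2 <= n)%N -> real_part (\tr X) <= delta R k n.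
Proof.
move=> hn; have [m_ge0 By m_le1 certX] := cert.
have [r [A [hr frame _]]] := certificate_delta hn.
set v := fun l => y l *m adj A => h.
rewrite -subr_ge0; apply: le_trans h; rewrite !addr_ge0 //.
- apply: sumr_ge0 => l _; rewrite mulr_ge0 // subr_ge0.
  exact: certificate_energy_bound.
- apply: mulr_ge0; first by rewrite ltW ?energy_slope_gt0.
  do 2!(apply: sumr_ge0 => ? _); apply: mulr_ge0; first exact: mulr_ge0.
  exact: etf_defect_ge0.
- apply: mulr_ge0; first by rewrite ltW ?energy_gap_gt0.
  rewrite subr_ge0; apply: le_trans (sum_nrm_sq m_ge0 frame) _.
  apply: le_trans (_ : 1 * r%:R <= _); first by rewrite ler_wpM2r.
  by rewrite mul1r ler_nat.
Qed.
End CertificateFrame.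

(** * Bounds on the projection constant *)

Lemma normed_of_norm (K : numFieldType) (V : lmodType K) (norm : V -> K) :
  is_norm norm ->
  exists (Z : normedModType K) (j : {linear V -> Z}), 
   [/\ forall v, `|j v| = norm v & forall z, exists v, z = j v].
Proof.
case=> nD nZ n0.
pose nM := @Lmodule_isNormed.Build K V norm nD nZ n0.
pose Z : normedModType K := HB.pack (GRing.Lmodule.sort V) nM.
have jL : linear (fun v : V => v : Z) by [].
pose jM := GRing.isLinear.Build K V Z _ (fun v : V => v : Z) jL.
exists Z, (HB.pack (fun v : V => v : Z) jM : {linear V -> Z}); split=> // z.
by exists z.
Qed.

Section Lambda.
Variables (R : realType) (k : scalar_kind) (n : nat).
Local Notation K := (scalars R k).
Local Notation ofR := (@of_real R k).
Variable N : 'rV[K]_n -> K.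
Hypothesis hN : is_norm N.
Local Notation rnorm := (rnorm N).

Lemma lambda_le (c : R) : 0 <= c ->
  (forall p (m : 'I_p -> R) y X, summing_certificate N m y X -> real_part (\tr X) <= c) ->
  (lambda N <= c%:E)%E.
Proof.
move=> c0 cert_le; apply: ge_ereal_sup => _ [Z [S [S_isom ->]]].
have [P [PS Pc]] := projection_of_certificates hN S_isom c0 cert_le.
have [Q QE] : exists Q : {linear Z -> Z}, Q =1 S \o P.
  by apply: linear_lift => a x y /=; rewrite !linearP.
apply: ereal_inf_le; exists (op_norm Q).
  exists Q; split=> //; split=> [|_ [x _ <-]]; last by rewrite QE /= PS.
  apply/seteqP; split=> [_ [z _ <-]|_ [x _ <-]]; first by exists (P z); rewrite ?QE.
  by exists (S x); rewrite ?QE //= PS.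
apply: ge_ereal_sup => _ [z z1 <-]; rewrite lee_fin QE /= S_isom.
apply: le_trans (Pc z) _; rewrite -[leRHS]mulr1 ler_wpM2l //.
by move: z1; rewrite /= znormE -(rmorph1 ofR) ler_of_real.
Qed.

(* The superspace is [K^d] with the largest norm making [J] a contraction and the
   basis vectors [e_i] of norm at most 1; the hypothesis says that [J] is then an
   isometry, and a projection [P] satisfies [\sum_i <P e_i, y_i> = n mu]. *)
Lemma lambda_ge d (mu : R) (y : 'I_d -> 'rV[K]_n) : (0 < d)%N -> 0 < mu ->
  (forall i, dual_ball N (y i)) ->
  (forall z, dual_ball N z -> exists2 a : 'I_d -> K, forall i, absK (a i) <= 1
      & z = ofR mu^-1 *: \sum_i a i *: y i) ->
  ((n%:R * mu / d%:R)%:E <= lambda N)%E.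
Proof.
move=> d0 mu0 By yB.
have muV0 : 0 < mu^-1 by rewrite invr_gt0.
(* The factor [mu^-1] is that of the zonotope, which yields [rnorm x <= l1 (J x)]. *)
pose J x : 'rV[K]_d := \row_i (ofR mu^-1 * inner x (y i)).
pose l1 (c : 'rV[K]_d) : R := \sum_i absK (c 0 i).
have l1D c c' : l1 (c + c') <= l1 c + l1 c'.
  by rewrite -big_split; apply: ler_sum => i _; rewrite mxE absKD.
have l1Z a c : l1 (a *: c) = absK a * l1 c.
  by rewrite mulr_sumr; apply: eq_bigr => i _; rewrite mxE absKM.
have l1_ge0 c : 0 <= l1 c by apply: sumr_ge0 => i _; exact: absK_ge0.
have JL a x x' : J (a *: x + x') = a *: J x + J x'.
  by apply/rowP => i; rewrite !mxE innerDl innerZl mulrDr mulrCA.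
have NJ x : rnorm x <= l1 (J x).
  apply: (rnorm_le_dual hN) => z /yB[a a1 ->].
  rewrite innerZr conjK_of_real absKM absK_of_real gtr0_norm // inner_sumr.
  have -> : l1 (J x) = mu^-1 * \sum_i absK (inner x (y i)).
    by rewrite mulr_sumr; apply: eq_bigr => i _; rewrite mxE absKM absK_of_real gtr0_norm.
  rewrite ler_pM2l //; apply: le_trans (absK_sum _ _ _) _; apply: ler_sum => i _.
  by rewrite innerZr absKM absK_conj -[leRHS]mul1r ler_wpM2r ?absK_ge0.
pose C := mu^-1 * d%:R.
have JN x : l1 (J x) <= C * rnorm x.
  rewrite /C -mulrA mulr_natl -[d in leRHS]card_ord -sumr_const mulr_sumr.
  apply: ler_sum => i _; rewrite mxE absKM absK_of_real gtr0_norm // ler_pM2l //.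
  by have /(dual_ballP hN) := By i.
have C0 : 0 <= C by rewrite mulr_ge0 ?ler0n // ltW.
(* Infimal convolution of [rnorm], carried over by [J], with [l1]: the gauge of the hull of the
   [J]-image of the unit ball and the basis vectors. *)
pose E c := [set rnorm x + l1 (c - J x) | x in setT].
have E_lb c : has_lbound (E c).
  by exists 0 => _ [x _ <-]; rewrite addr_ge0 ?rnorm_ge0.
pose zn c := inf (E c).
have zn_le c x : zn c <= rnorm x + l1 (c - J x).
  by apply: (ge_inf (E_lb c)); exists x.
have le_zn c a : (forall x, a <= rnorm x + l1 (c - J x)) -> a <= zn c.
  move=> h; apply: lb_le_inf => [|_ [x _ <-]]; last exact: h.
  by exists (rnorm 0 + l1 (c - J 0)); exists 0.
have J0 : J 0 = 0.
  by have := JL (-1) 0 0; rewrite scaler0 addr0 scaleN1r addNr.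
have JZ a x : J (a *: x) = a *: J x by rewrite -[a *: x]addr0 JL J0 addr0.
have JD x x' : J (x + x') = J x + J x' by rewrite -[x]scale1r JL !scale1r.
have zn_ge0 c : 0 <= zn c by apply: (le_zn) => x; rewrite addr_ge0 ?rnorm_ge0.
have znD c c' : zn (c + c') <= zn c + zn c'.
  rewrite -lerBlDr; apply: (le_zn) => x.
  rewrite lerBlDr -lerBlDl; apply: (le_zn) => x'; rewrite lerBlDl.
  apply: le_trans (zn_le _ (x + x')) _; rewrite addrACA lerD ?rnormD //.
  by rewrite JD opprD addrACA.
have znZ a c : zn (a *: c) = absK a * zn c.
  have le b u : b != 0 -> zn (b *: u) <= absK b * zn u.
    move=> b0; have b1 : 0 < absK b by rewrite lt0r absK_eq0 b0 absK_ge0.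
    rewrite -ler_pdivrMl //; apply: (le_zn) => x; rewrite ler_pdivrMl //.
    apply: le_trans (zn_le _ (b *: x)) _.
    by rewrite JZ -scalerBr l1Z rnormZ // -mulrDr.
  have [->|a0] := eqVneq a 0.
    rewrite scale0r absK0 mul0r; apply/eqP; rewrite eq_le zn_ge0 andbT.
    apply: le_trans (zn_le _ 0) _; rewrite J0 rnorm0 // subr0 add0r.
    by rewrite /l1 big1 // => i _; rewrite mxE absK0.
  apply/eqP; rewrite eq_le le //=.
  have a1 : 0 < absK a by rewrite lt0r absK_eq0 a0 absK_ge0.
  have := le a^-1 (a *: c); rewrite invr_eq0 scalerA mulVf // scale1r => /(_ a0).
  by rewrite absK_inv -ler_pdivrMl ?invr_gt0 // invrK.
(* [J] is bounded from [rnorm] to [l1], so [zn] dominates a multiple of [l1]; this gives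
   definiteness. *)
have zn_l1 c : l1 c <= (1 + C) * zn c.
  have C1 : 0 < 1 + C by rewrite ltr_wpDr.
  rewrite mulrC -ler_pdivrMr //; apply: (le_zn) => x; rewrite ler_pdivrMr //.
  have := l1D (J x) (c - J x); rewrite addrC subrK => h; apply: le_trans h _.
  have := JN x; have := rnorm_ge0 hN x; have := l1_ge0 (c - J x); nra.
have znJ x : zn (J x) = rnorm x.
  apply/eqP; rewrite eq_le; apply/andP; split.
    apply: le_trans (zn_le _ x) _; rewrite subrr.
    by rewrite /l1 big1 ?addr0 // => i _; rewrite mxE absK0.
  apply: (le_zn) => x'.
  have -> : J x - J x' = J (x - x') by rewrite -(scaleN1r x') [x + _]addrC JL scaleN1r addrC.
  have := rnormD hN x' (x - x'); rewrite addrC subrK => h; apply: le_trans h _.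
  by rewrite lerD2l.
have zn_norm : is_norm (fun c => ofR (zn c)).
  split=> [c c'|a c|c].
  - by rewrite -rmorphD ler_of_real.
  - by rewrite znZ rmorphM normKE.
  rewrite -(rmorph0 ofR) => /of_real_inj c0; have := zn_l1 c; rewrite c0 mulr0 => l10.
  apply/rowP => i; rewrite mxE; apply/eqP; rewrite -absK_eq0.
  have /psumr_eq0P : l1 c = 0 by apply/eqP; rewrite eq_le l10 l1_ge0.
  by move=> -> // i' _; exact: absK_ge0.
have [Z [j [j_norm jsurj]]] := normed_of_norm zn_norm.
have [S SE] : exists S : {linear 'rV[K]_n -> Z}, S =1 (fun x => j (J x)).
  by apply: linear_lift => a x x'; rewrite JL linearP.
have S_isom x : `|S x| = N x by rewrite SE j_norm znJ rnormE.
have S_inj x : S x = 0 -> x = 0.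
  by move=> Sx; apply: (rnorm_eq0 hN); apply: (@of_real_inj _ k);
    rewrite -rnormE // -S_isom Sx normr0 rmorph0.
apply: le_trans (_ : proj_const (range S) <= _)%E; last first.
  by apply: ereal_sup_ubound; exists Z, S.
apply: le_ereal_inf_tmp => _ [P [[rangeP PS] ->]].
pose e i := j (delta_mx 0 i).
have e1 i : znorm (e i) <= 1.
  rewrite /znorm j_norm of_realK; apply: le_trans (zn_le _ 0) _.
  rewrite J0 rnorm0 // subr0 add0r /l1 (bigD1 i) //= big1 => [|a ai].
    by rewrite mxE !eqxx absK1 addr0.
  by rewrite mxE (negbTE ai) andbF absK0.
have /choice[x xE] i : exists x, P (e i) = S x.
  have : range P (P (e i)) by exists (e i).
  by rewrite rangeP => -[x _ <-]; exists x.
(* [P] fixes [S z], a combination of the [e i], and [S] is injective. *)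
have recon z : z = \sum_i (ofR mu^-1 * inner z (y i)) *: x i.
  apply/eqP; rewrite -subr_eq0; apply/eqP/S_inj.
  rewrite linearB -(PS (S z)); last by exists z.
  have -> : S z = \sum_i (ofR mu^-1 * inner z (y i)) *: e i.
    rewrite SE [J z]row_sum_delta linear_sum; apply: eq_bigr => i _.
    by rewrite linearZ /= mxE.
  rewrite [P _]linear_sum [S _]linear_sum -sumrB big1 // => i _.
  by rewrite [P _]linearZ [S _]linearZ /= xE subrr.
(* The trace of the identity, computed from [recon]. *)
have trE : \sum_i inner (x i) (y i) = ofR (n%:R * mu).
  transitivity (ofR mu * \sum_(a < n) (delta_mx 0 a : 'rV[K]_n) 0 a); last first.
    under eq_bigr do rewrite mxE !eqxx.
    by rewrite sumr_const card_ord rmorphM /= of_real_nat mulrC.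
  under [in RHS]eq_bigr => a _ do rewrite {1}[delta_mx 0 a]recon summxE.
  rewrite [in RHS]exchange_big [RHS]mulr_sumr; apply: eq_bigr => i _ /=.
  rewrite {1}/inner [RHS]mulr_sumr; apply: eq_bigr => a _.
  rewrite mxE inner_deltal.
  rewrite -mulrA mulrA -rmorphM mulfV ?gt_eqF // rmorph1 mul1r mulrC //.
have [i hi] : exists i, n%:R * mu / d%:R <= znorm (P (e i)).
  apply: contrapT => no.
  have lt i : znorm (P (e i)) < n%:R * mu / d%:R.
    by rewrite ltNge; apply/negP => ge; apply: no; exists i.
  suff : n%:R * mu < n%:R * mu by rewrite ltxx.
  have mun : 0 <= n%:R * mu by rewrite mulr_ge0 ?ler0n // ltW.
  apply: le_lt_trans (_ : \sum_i znorm (P (e i)) < _).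
    rewrite -[leLHS](ger0_norm mun) -(absK_of_real k) -trE.
    apply: le_trans (absK_sum _ _ _) _; apply: ler_sum => i _.
    have /(dual_ballP hN)/(_ (x i)) h := By i; apply: le_trans h _.
    by rewrite xE /znorm S_isom.
  have -> : n%:R * mu = \sum_(i < d) n%:R * mu / d%:R.
    by rewrite sumr_const card_ord -[RHS]mulr_natr divfK // pnatr_eq0 -lt0n.
  apply: ltr_sum => [|i _]; last exact: lt.
  by apply/hasP; exists (Ordinal d0); rewrite ?mem_index_enum.
apply: le_ereal_sup_tmp; exists (znorm (P (e i)))%:E; last by rewrite lee_fin.
by exists (e i) => //=; rewrite znormE -(rmorph1 ofR) ler_of_real.
Qed.

End Lambda.

(** * Extremal certificates *)

Section ExtremalConstants.
Variables (R : realType) (k : scalar_kind) (n : nat).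
Hypothesis hn : (2 <= n)%N.
Local Notation q := ((fieldq k)%:R : R).
Local Notation c := (etf_angle R k n).
Local Notation d := ((dmax k n)%:R : R).

Lemma dmax_fieldq : d * q = n%:R * (n%:R + q - 1).
Proof.
rewrite /fieldq /dmax; case: k => /=; last by rewrite mulr1 addrK natrX expr2.
rewrite -natrM divnK; last by rewrite dvdn2 oddM addn1 oddS andbN.
by rewrite natrM natrD; ring.
Qed.

Lemma dmax_gt0 : (0 < dmax k n)%N.
Proof.
rewrite /dmax; case: k; last by rewrite expn_gt0 (leq_trans _ hn).
by rewrite divn_gt0 // (leq_trans _ (leq_mul hn (leq_addl n 1))).
Qed.

Let q1 : 1 <= q. Proof. by rewrite /fieldq; case: k; rewrite ler1n. Qed.
Let n2 : 2 <= n%:R :> R. Proof. by rewrite ler_nat. Qed.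
Let d0 : 0 < d. Proof. by rewrite ltr0n dmax_gt0. Qed.

(** The hypothesis is the frame identity at a vector of squared length [n], when mass [s] lies on
    its line and the remaining [1 - s] at angle [c]. *)
Lemma class_mass (s : R) : n%:R ^+ 2 * s + (n%:R * c) ^+ 2 * (1 - s) = n%:R ->
  s = d^-1.
Proof.
have c2 := etf_angle_sq R k hn; have dq := dmax_fieldq.
have n0 : n%:R != 0 :> R by have := n2; lra.
move=> h; have : (n%:R + q) * (n%:R * s + n%:R * c ^+ 2 * (1 - s)) = n%:R + q.
  apply: (mulfI n0).
  transitivity ((n%:R + q) * (n%:R ^+ 2 * s + (n%:R * c) ^+ 2 * (1 - s))); first by ring.
  by rewrite h mulrC.
have -> : (n%:R + q) * (n%:R * s + n%:R * c ^+ 2 * (1 - s)) =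
   n%:R * ((n%:R + q) * s + c ^+ 2 * (n%:R + q) * (1 - s)) by ring.
rewrite c2 => {}h.
have sq : s * (n%:R * (n%:R + q - 1)) = q.
  have -> : s * (n%:R * (n%:R + q - 1)) = n%:R * ((n%:R + q) * s + 1 * (1 - s)) - n%:R by ring.
  by rewrite h; ring.
apply: (mulIf (x := d)); first by rewrite gt_eqF.
rewrite mulVf ?gt_eqF //; apply: (mulIf (x := q)); first by rewrite gt_eqF //; have := q1; lra.
by rewrite mul1r -mulrA dq.
Qed.

(** The eigenvalue of the optimal operator arises in the form on the right. *)
Lemma delta_dmax : delta R k n / n%:R = (n%:R * c)^-1 + d^-1 * (1 - c^-1).
Proof.
have c0 := etf_angle_gt0 R k hn; have c2 := etf_angle_sq R k hn.
have n0 := n2; have qq := q1; have q0 : q != 0 by lra.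
have dE : d = n%:R * (n%:R + q - 1) / q by rewrite -dmax_fieldq mulfK.
have c2V : (c ^+ 2)^-1 = n%:R + q.
  by apply: (mulfI (x := c ^+ 2)); rewrite ?c2 ?divff // expf_neq0 // gt_eqF.
have nE : n%:R = (c ^+ 2)^-1 - q by rewrite c2V addrK.
have c1 := etf_angle_lt1 R k hn.
have h1 : 0 < 1 - q * c ^+ 2.
  have -> : 1 - q * c ^+ 2 = c ^+ 2 * n%:R by rewrite -[X in X - _]c2; ring.
  by rewrite mulr_gt0 ?exprn_gt0 //; lra.
rewrite (delta_angle R k hn) dE nE; move: h1 q0; move: q => p h1 p0.
field; rewrite p0 !gt_eqF //=; [nra|].
nra.
Qed.

Lemma delta_gt0 : 0 < delta R k n.
Proof.
have c0 := etf_angle_gt0 R k hn; have n0 := n2.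
rewrite (delta_energy R k hn) addr_gt0 // mulr_gt0 ?energy_slope_gt0 ?energy_gap_gt0 //.
  by rewrite addr_gt0 ?mulr_gt0 ?exprn_gt0 // addr_gt0 ?mulr_gt0.
by lra.
Qed.
End ExtremalConstants.

(** * The equality case *)

Section ExtremalCertificate.
Variables (R : realType) (k : scalar_kind) (n : nat).
Hypothesis hn : (2 <= n)%N.
Local Notation K := (scalars R k).
Local Notation ofR := (@of_real R k).
Variable N : 'rV[K]_n -> K.
Hypothesis hN : is_norm N.
Local Notation rnorm := (rnorm N).
Variables (I : finType) (m : I -> R) (y : I -> 'rV[K]_n) (X : 'M[K]_n).
Hypothesis m_gt0 : forall l, 0 < m l.
Local Notation c := (etf_angle R k n).
Local Notation d := ((dmax k n)%:R : R).

(** The form on the left is bounded by the weighted [l1] norm of the tuple of the [inner w (y j)].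
    Hahn-Banach extends it to all tuples, and a functional of norm at most 1 for that norm has
    coefficients bounded by the weights. *)
Lemma summing_functional z : summing_certificate N m y X -> dual_ball N z ->
  exists2 a : I -> K, forall j, absK (a j) <= m j
    & forall w, inner (w *m X) z = \sum_j inner w (y j) * a j.
Proof.
move=> [m_ge0 _ _ certX] /(dual_ballP hN) Bz.
pose V := {ffun I -> K^o}.
pose p (f : V) : R := \sum_j m j * absK (f j : K).
have pD (f g : V) : p (f + g) <= p f + p g.
  rewrite -big_split; apply: ler_sum => j _; rewrite ffunE /= -mulrDr ler_wpM2l //.
  exact: absKD.
have pZ a (f : V) : p (a *: f) = absK a * p f.
  by rewrite mulr_sumr; apply: eq_bigr => j _; rewrite ffunE mulrCA -absKM.
have [S SE] : exists S : {linear 'rV[K]_n -> V}, S =1 (fun w => [ffun j => inner w (y j)]).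
  by apply: linear_lift => a x x'; apply/ffunP => j; rewrite !ffunE innerDl innerZl.
have fL a (x x' : 'rV[K]_n) :
    inner ((a *: x + x') *m X) z = a * inner (x *m X) z + inner (x' *m X) z.
  by rewrite mulmxDl -scalemxAl innerDl innerZl.
have fp w : absK (inner (w *m X) z) <= p (S w).
  apply: le_trans (Bz _) _; apply: le_trans (certX _) _; rewrite SE /p.
  by apply: ler_sum => j _; rewrite ffunE.
have [g [gL gp gS]] := hahn_banach pD pZ fL fp.
have g0 : g 0 = 0 by have := gL (-1) 0 0; rewrite scaler0 addr0 mulN1r addNr.
pose e (j : I) : V := [ffun i => (i == j)%:R].
exists (fun j => g (e j)) => [j|w].
  apply: le_trans (gp _) _; rewrite /p (bigD1 j) //= big1 ?addr0 => [|i ij].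
    by rewrite ffunE eqxx absK1 mulr1.
  by rewrite ffunE (negbTE ij) absK0 mulr0.
rewrite -gS; have -> : S w = \sum_j inner w (y j) *: e j.
  apply/ffunP => i; rewrite SE sum_ffunE ffunE (bigD1 i) //= big1 ?addr0 => [|j ji].
    by rewrite !ffunE eqxx [_ *: _]mulr1.
  by rewrite !ffunE eq_sym (negbTE ji) scaler0.
by elim/big_rec2 : _ => [|i u v _ <-]; rewrite ?g0 ?gL.
Qed.

Hypothesis cert : summing_certificate N m y X.
Hypothesis trX : delta R k n <= real_part (\tr X).

(** The deficits of [certificate_delta] are nonnegative with sum at most 0, and positive weights
    make every summand vanish. Then [n = B^2 <= (\sum_l m_l) r] gives [r = n] and total mass 1, and
    the lengths have variance zero about [sqrt n]. *)
Lemma extremal_frame : exists A : 'M[K]_n,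
  let v l := y l *m adj A in
  [/\ forall x, \sum_l (ofR (m l) * inner x (v l)) *: v l = x,
      \sum_l m l = 1,
      forall l, sqn (v l) = n%:R,
      forall i j, absK (inner (v i) (v j)) = n%:R \/ absK (inner (v i) (v j)) = n%:R * c
    & forall l, real_part (inner (v l *m A *m X) (y l)) =
                \sum_j m j * absK (inner (v l) (v j))].
Proof.
have [m_ge0 By m_le1 certX] := cert.
have [r [A [hr frame _]]] := certificate_delta hN cert hn.
set v := fun l => y l *m adj A in frame * => /= h.
set T1 := \sum_l m l * _ in h; set T2 := \sum_i \sum_j m i * m j * _ in h.
set B := \sum_l m l * nrm (v l) in h.
have e0 := energy_slope_gt0 R k hn; have g0 := energy_gap_gt0 R k hn.
have t1_ge0 l : 0 <= m l * (\sum_j m j * absK (inner (v l) (v j))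
    - real_part (inner (v l *m A *m X) (y l))).
  by rewrite mulr_ge0 // subr_ge0; exact: (certificate_energy_bound hN cert A l).
have t2_ge0 i j : 0 <= m i * m j * etf_defect v n i j.
  by apply: mulr_ge0; [exact: mulr_ge0|exact: etf_defect_ge0].
have T1_ge0 : 0 <= T1 by apply: sumr_ge0 => l _; exact: t1_ge0.
have T2_ge0 : 0 <= T2 by do 2!(apply: sumr_ge0 => ? _); exact: t2_ge0.
have B2 := sum_nrm_sq m_ge0 frame; rewrite -/B in B2.
have rn : r%:R <= n%:R :> R by rewrite ler_nat.
have r0 : 0 <= r%:R :> R by exact: ler0n.
have B3 : B ^+ 2 <= n%:R by apply: le_trans B2 _; nra.
have n0 : 0 < n%:R :> R by rewrite ltr0n (leq_trans _ hn).
have eT2 : 0 <= energy_slope R k n * T2 by rewrite mulr_ge0 // ltW.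
have gB : 0 <= energy_gap R k n * (n%:R - B ^+ 2) by rewrite mulr_ge0 ?subr_ge0 // ltW.
have T10 : T1 = 0 by move: h trX T1_ge0 eT2 gB; lra.
have T20 : T2 = 0.
  have/eqP : energy_slope R k n * T2 = 0 by move: h trX T1_ge0 eT2 gB; lra.
  by rewrite mulf_eq0 gt_eqF //= => /eqP.
have Bn : B ^+ 2 = n%:R.
  have/eqP : energy_gap R k n * (n%:R - B ^+ 2) = 0 by move: h trX T1_ge0 eT2 gB; lra.
  by rewrite mulf_eq0 gt_eqF //= subr_eq0 => /eqP.
have m1 : \sum_l m l = 1.
  apply/eqP; rewrite eq_le m_le1 /= -(ler_pM2r n0) mul1r -{1}Bn.
  by apply: le_trans B2 _; rewrite ler_wpM2l // sumr_ge0.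
have rnE : r = n.
  by apply/eqP; rewrite eqn_leq hr -(ler_nat R) -Bn (le_trans B2) // m1 mul1r.
subst r; exists A; rewrite -/v.
have s0 : 0 < Num.sqrt n%:R :> R by rewrite sqrtr_gt0.
have s2 : Num.sqrt n%:R ^+ 2 = n%:R :> R by rewrite sqr_sqrtr // ltW.
have Bs : B = Num.sqrt n%:R.
  apply/eqP; rewrite -(@eqrXn2 _ 2) ?Bn ?s2 // ?sqrtr_ge0 //.
  by apply: sumr_ge0 => l _; rewrite mulr_ge0 ?nrm_ge0.
have vs l : nrm (v l) = Num.sqrt n%:R.
  have h0 : \sum_l m l * (nrm (v l) - Num.sqrt n%:R) ^+ 2 = 0.
    transitivity (\sum_l m l * sqn (v l) - 2 * Num.sqrt n%:R * B + n%:R * \sum_l m l).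
      rewrite /B !mulr_sumr -sumrB -big_split; apply: eq_bigr => i _ /=.
      by rewrite -nrm_sq -[in n%:R * _]s2; ring.
    by rewrite (frame_trace frame) Bs m1 -[2 * _ * _]mulrA -expr2 s2; ring.
  have := psumr_eq0P (fun i _ => mulr_ge0 (m_ge0 i) (sqr_ge0 _)) h0 (i := l) isT.
  move/eqP; rewrite mulf_eq0 gt_eqF ?m_gt0 //= sqrf_eq0 subr_eq0 => /eqP //.
have vs2 l : sqn (v l) = n%:R by rewrite -nrm_sq vs s2.
split=> // [i j|l].
- have : \sum_j m i * m j * etf_defect v n i j = 0.
    by apply: (psumr_eq0P _ T20) => // i' _; apply: sumr_ge0 => j' _.
  move=> Ti; have /eqP : m i * m j * etf_defect v n i j = 0.
    exact: (psumr_eq0P (fun j _ => t2_ge0 i j) Ti).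
  rewrite /etf_defect !mulf_eq0 (gt_eqF (m_gt0 i)) (gt_eqF (m_gt0 j)) !vs.
  rewrite (gt_eqF s0) /= orbb !subr_eq0 -(cosineE v) !vs -expr2 s2.
  by case/orP => /eqP; [move=> <-; left; rewrite mulr1|move=> ->; right].
- have := psumr_eq0P (fun i _ => t1_ge0 i) T10 (i := l) isT.
  move/eqP; rewrite mulf_eq0 gt_eqF ?m_gt0 //= subr_eq0 => /eqP -> //.
Qed.


(* Having the same line is an equivalence relation on the points [v_l]; its [d]
   classes all have mass [1 / d], and representatives form the ETF. *)
Lemma extremal_certificate : exists (w : 'I_(dmax k n) -> 'rV[K]_n)
    (T : {linear 'rV[K]_n -> 'rV[K]_n}) (y' : 'I_(dmax k n) -> 'rV[K]_n),
  [/\ maximal_ETF w,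
      forall s, dual_ball N (y' s) /\ T (y' s) = w s
    & forall z, dual_ball N z -> exists2 a : 'I_(dmax k n) -> K,
        forall s, absK (a s) <= 1
      & T z = ofR (n%:R / (d * delta R k n)) *: \sum_s a s *: w s].
Proof.
have [m_ge0 By m_le1 certX] := cert.
have [A] := extremal_frame; set v := fun l => y l *m adj A.
case=> frame m1 vn G_cases tight.
have n0 : 0 < n%:R :> R by rewrite ltr0n (leq_trans _ hn).
have c0 := etf_angle_gt0 R k hn; have c1 := etf_angle_lt1 R k hn.
have d0 : 0 < d by rewrite ltr0n dmax_gt0.
have ncn : n%:R * c != n%:R by rewrite lt_eqF // -[ltRHS]mulr1 ltr_pM2l.
have G_gt0 i j : 0 < absK (inner (v i) (v j)).
  by case: (G_cases i j) => ->; rewrite ?mulr_gt0.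
pose e i j := absK (inner (v i) (v j)) == n%:R.
(* When [e i j] holds there is equality in Cauchy-Schwarz, and this is the phase carrying [v i] to
   [v j]. *)
pose ph i j : K := inner (v j) (v i) / n%:R.
have eP i j : e i j -> absK (ph i j) = 1 /\ v j = ph i j *: v i.
  move=> /eqP eij.
  have ph1 : absK (ph i j) = 1.
    rewrite /ph absKM absK_inv -inner_conj absK_conj eij -(of_real_nat R k n) absK_of_real.
    by rewrite gtr0_norm // divff ?gt_eqF.
  split=> //; apply/eqP; rewrite -subr_eq0 -sqn_eq0 sqnB sqnZ ph1 !vn innerZr.
  have -> : conjK (ph i j) * inner (v j) (v i) = ofR n%:R.
    rewrite /ph rmorphM /= fmorphV /= -(of_real_nat R k n) conjK_of_real mulrAC.
    rewrite [conjK (inner _ _) * _]mulrC mulz_conj -absK_conj inner_conj eij.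
    by rewrite -fmorphV -rmorphM; congr (ofR _); field; rewrite gt_eqF.
  by rewrite of_realK; apply/eqP; ring.
have G_scale i j l : e i j -> absK (inner (v j) (v l)) = absK (inner (v i) (v l)).
  by move=> /eP[ph1 ->]; rewrite innerZl absKM ph1 mul1r.
have ee i j l : e i j -> e i l = e j l by move=> eij; rewrite /e (G_scale _ _ _ eij).
have eii i : e i i by rewrite /e inner_sqn absK_of_real vn gtr0_norm.
have es i j : e i j = e j i by rewrite /e -inner_conj absK_conj.
have mass i : \sum_(j | e i j) m j = d^-1.
  apply: (class_mass hn); rewrite -[RHS](vn i) -(frame_sqn frame).
  have -> : 1 - \sum_(j | e i j) m j = \sum_(j | ~~ e i j) m j.
    by rewrite -m1 [\sum_l m l](bigID (e i)) /= addrAC subrr add0r.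
  rewrite [RHS](bigID (e i)) /=.
  rewrite !mulr_sumr; congr (_ + _); apply: eq_bigr => j.
    by move/eqP => ->; rewrite mulrC.
  move=> /negbTE eij; case: (G_cases i j) => [E|->]; rewrite 1?mulrC //.
  by rewrite /e E eqxx in eij.
pose f i := odflt i [pick j | e i j].
have ef i : e i (f i) by rewrite /f; case: pickP => //= ->.
have fe i j : e i j = (f i == f j).
  apply/idP/eqP => [eij|fij]; last first.
    by rewrite (ee _ _ _ (ef i)) es fij es -(ee _ _ _ (ef j)).
  rewrite /f (@eq_pick _ (e i) (e j)) => [|l]; last exact: ee.
  by case: pickP => //= /(_ j); rewrite eii.
have ff i : f (f i) = f i by apply/esym/eqP; rewrite -fe ef.
pose D := [set f i | i : I].
have cardD : #|D| = dmax k n.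
  have : \sum_(i in I) m i = #|D|%:R * d^-1.
    rewrite (partition_big f (mem D)) /= => [|i _]; last by apply: imset_f.
    rewrite (eq_bigr (fun=> d^-1)) => [|_ /imsetP[i _ ->]].
      by rewrite sumr_const mulr_natl.
    rewrite -(mass i); apply: eq_bigl => j; rewrite fe eq_sym; congr (_ == _).
  by rewrite m1 => /esym/divr1_eq/eqP; rewrite eqr_nat => /eqP.
pose g (s : 'I_(dmax k n)) : I := enum_val (cast_ord (esym cardD) s).
have fg s : f (g s) = g s.
  have /imsetP[i _ gi] : g s \in D by exact: enum_valP.
  by rewrite gi ff.
have g_inj : injective g by move=> s t /enum_val_inj/cast_ord_inj.
have /choice[h gh] i : exists s, g s = f i.
  have fD : f i \in D by exact: imset_f.
  exists (cast_ord cardD (enum_rank_in fD (f i))).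
  by rewrite /g cast_ordK enum_rankK_in //.
have eg s i : e (g s) i = (h i == s).
  by rewrite fe fg -gh (inj_eq g_inj) eq_sym.
have group (U : zmodType) (F : I -> U) : \sum_i F i = \sum_s \sum_(i | e (g s) i) F i.
  rewrite (partition_big h predT) //; apply: eq_bigr => s _.
  by apply: eq_bigl => i; rewrite eg.
pose rn : R := Num.sqrt n%:R.
have rn0 : 0 < rn by rewrite sqrtr_gt0.
have rn2 : rn^-1 * rn^-1 = n%:R^-1 by rewrite -invfM -expr2 sqr_sqrtr // ltW.
pose w s := ofR rn^-1 *: v (g s).
have ww s t : inner (w s) (w t) = ofR n%:R^-1 * inner (v (g s)) (v (g t)).
  by rewrite innerZl innerZr conjK_of_real mulrA -rmorphM rn2.
have [T TE] : exists T : {linear 'rV[K]_n -> 'rV[K]_n},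
    T =1 (fun z => ofR rn^-1 *: (z *m adj A)).
  apply: linear_lift => a x x'; rewrite mulmxDl -scalemxAl scalerDr.
  by rewrite !scalerA mulrC.
have Ty s : T (y (g s)) = w s by rewrite TE.
have frame_class x : x = ofR (n%:R / d) *: \sum_s inner x (w s) *: w s.
  rewrite -[LHS]frame group scaler_sumr; apply: eq_bigr => s _.
  rewrite [RHS]scalerA innerZr conjK_of_real !scalerA.
  transitivity (\sum_(i | e (g s) i) ofR (m i) *: (inner x (v (g s)) *: v (g s))).
    apply: eq_bigr => i /eP[ph1 ->]; rewrite innerZr !scalerA; congr (_ *: _).
    have phc : conjK (ph (g s) i) * ph (g s) i = 1.
      by rewrite mulrC mulz_conj ph1 expr1n rmorph1.
    by rewrite -[RHS]mulr1 -phc; ring.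
  rewrite -scaler_suml -rmorph_sum mass scalerA; congr (_ *: _).
  transitivity (ofR (n%:R / d * (rn^-1 * rn^-1)) * inner x (v (g s))); last first.
    by rewrite !rmorphM /=; ring.
  by rewrite rn2; congr (ofR _ * _); field; rewrite !gt_eqF.
have etf : maximal_ETF w.
  split; last by exists (ofR (n%:R / d)); exact: frame_class.
  split=> [s t wst|s|].
  - apply: g_inj; apply/eqP; rewrite -(fg s) -(fg t) -fe /e.
    have : inner (w s) (w t) = inner (w s) (w s) by rewrite wst.
    rewrite !ww => /(mulfI _) ->; first by rewrite inner_sqn absK_of_real vn gtr0_norm.
    by rewrite -(rmorph0 ofR) (inj_eq (@of_real_inj _ _)) invr_eq0 gt_eqF.
  - by rewrite ww inner_sqn vn -rmorphM mulVf ?rmorph1 // gt_eqF.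
  exists (ofR c) => s t st; rewrite ww normKE absKM absK_of_real.
  rewrite gtr0_norm ?invr_gt0 //.
  case: (G_cases (g s) (g t)) => [/eqP E|->]; last by rewrite mulKf // gt_eqF.
  have : e (g s) (g t) by [].
  by rewrite fe !fg (inj_eq g_inj) => /eqP E'; rewrite E' ltnn in st.
pose theta : R := delta R k n / n%:R.
have delta0 := delta_gt0 R k hn.
have theta0 : 0 < theta by rewrite divr_gt0.
have Xv x l : inner (x *m A *m X) (y l) = ofR theta * inner x (v l).
  have [a a_le aE] := summing_functional cert (By l).
  have wA j z : inner (z *m A) (y j) = inner z (v j) by rewrite inner_mulmx.
  (* Equality in the trace bound holds term by term, so each product is real, nonnegative and of the
     largest modulus allowed. *)
  have term j : inner (v l) (v j) * a j = ofR (m j * absK (inner (v l) (v j))).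
    have le i : real_part (inner (v l) (v i) * a i) <= m i * absK (inner (v l) (v i)).
      apply: le_trans (real_part_le _) _; rewrite absKM mulrC.
      by rewrite ler_wpM2r ?absK_ge0.
    have eq0 : \sum_i (m i * absK (inner (v l) (v i)) -
        real_part (inner (v l) (v i) * a i)) = 0.
      rewrite sumrB -tight aE raddf_sum -sumrB big1 // => i _.
      by rewrite wA subrr.
    have nn i : 0 <= m i * absK (inner (v l) (v i)) - real_part (inner (v l) (v i) * a i).
      by rewrite subr_ge0.
    have E0 : real_part (inner (v l) (v j) * a j) = m j * absK (inner (v l) (v j)).
      apply/eqP; rewrite eq_sym -subr_eq0; apply/eqP.
      exact: (psumr_eq0P (fun i _ => nn i) eq0).
    have Eabs : absK (inner (v l) (v j) * a j) = m j * absK (inner (v l) (v j)).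
      apply/eqP; rewrite eq_le -{2}E0 real_part_le andbT.
      by rewrite absKM mulrC ler_wpM2r ?absK_ge0.
    by rewrite -Eabs; apply: real_part_eq_abs; rewrite E0 Eabs.
  have a_val j : a j = ofR (m j / absK (inner (v l) (v j))) * inner (v j) (v l).
    have G0 := G_gt0 l j.
    apply: (mulfI (x := ofR (absK (inner (v l) (v j)) ^+ 2))).
      by rewrite -(rmorph0 ofR) (inj_eq (@of_real_inj _ _)) expf_neq0 // gt_eqF.
    rewrite -{1}mulz_conj inner_conj mulrAC term mulrC mulrA -!rmorphM mulrC.
    by congr (ofR _ * _); field; rewrite gt_eqF.
  rewrite aE.
  (* The factor [1 / |<v_l, v_j>|] in [a_val] is [1 / (n c)] off the class of [l] and [1 / n] on it;
     [kap] is the correction on the class. *)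
  pose kap : R := n%:R^-1 - (n%:R * c)^-1.
  transitivity (\sum_j (ofR (n%:R * c)^-1 * (ofR (m j) * (inner x (v j) * inner (v j) (v l))) +
      (if e l j then ofR (kap * n%:R * m j) * inner x (v l) else 0))).
    apply: eq_bigr => j _; rewrite wA a_val.
    case: ifPn => [elj|/negbTE elj].
      have [ph1 vj] := eP _ _ elj; rewrite (eqP elj).
      have xv : inner x (v j) * inner (v j) (v l) = ofR n%:R * inner x (v l).
        rewrite vj innerZr innerZl inner_sqn vn.
        have phc : conjK (ph l j) * ph l j = 1.
          by rewrite mulrC mulz_conj ph1 expr1n rmorph1.
        by rewrite -[RHS]mulr1 -phc; ring.
      rewrite mulrCA [in LHS]xv [in RHS]xv.
      rewrite !mulrA -!rmorphM -mulrDl -rmorphD; congr (ofR _ * _).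
      by rewrite /kap; field; rewrite !gt_eqF.
    case: (G_cases l j) => E; first by rewrite /e E eqxx in elj.
    rewrite E addr0 mulrCA [RHS]mulrA -[in RHS]rmorphM; congr (ofR _ * _).
    by rewrite mulrC.
  rewrite big_split /= -mulr_sumr (frame_inner frame) -big_mkcond /=.
  rewrite -mulr_suml -rmorph_sum -mulr_sumr mass -mulrDl -rmorphD; congr (ofR _ * _).
  by rewrite /theta (delta_dmax R k hn) /kap; field; rewrite !gt_eqF.
have Aunit := frame_unitmx frame.
have inner_eq0 (u : 'rV[K]_n) : (forall x, inner x u = 0) -> u = 0.
  by move=> u0; apply/eqP; rewrite -sqn_eq0 /sqn u0 raddf0.
(* The [y l] span, because [A] is invertible and the [v l] form a frame; so the pairings in [Xv]
   determine [X]. *)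
have Xtheta (x : 'rV[K]_n) : x *m X = ofR theta *: x.
  apply/eqP; rewrite -subr_eq0; set u := _ - _.
  have uA : u = u *m invmx A *m A by rewrite mulmxKV.
  have h0 : u *m invmx A = 0.
    rewrite -(frame (u *m invmx A)) big1 // => l _.
    have -> : inner (u *m invmx A) (v l) = inner u (y l) by rewrite -inner_mulmx mulmxKV.
    suff -> : inner u (y l) = 0 by rewrite mulr0 scale0r.
    rewrite innerBl innerZl -[x in x *m X](mulmxKV Aunit) Xv.
    by rewrite -inner_mulmx mulmxKV // subrr.
  by rewrite uA h0 mul0mx.
exists w, T, (fun s => y (g s)); split=> // z Bz.
have [a a_le aE] := summing_functional cert Bz.
(* As [X] is a scalar, the dual form of its certificate expands [z] itself in the points [y j]. *)
have thz : ofR theta *: z = \sum_j conjK (a j) *: y j.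
  apply/eqP; rewrite -subr_eq0; apply/eqP/inner_eq0 => x.
  rewrite innerBr innerZr conjK_of_real -innerZl -Xtheta aE inner_sumr.
  by rewrite -sumrB big1 // => j _; rewrite innerZr conjKK mulrC subrr.
(* Phases move the coefficients of a class to its representative; the class has mass [1 / d], whence
   the factor [d]. *)
pose b s := ofR d * \sum_(j | e (g s) j) conjK (a j) * ph (g s) j.
exists b => [s|].
  rewrite absKM absK_of_real gtr0_norm // mulrC -ler_pdivlMr // div1r -(mass (g s)).
  apply: le_trans (absK_sum _ _ _) _; apply: ler_sum => j /eP[ph1 _].
  by rewrite absKM absK_conj ph1 mulr1.
have Tz : ofR theta *: T z = \sum_s (ofR d^-1 * b s) *: w s.
  rewrite -linearZ /= thz linear_sum group; apply: eq_bigr => s _.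
  rewrite /b mulrA -rmorphM mulVf ?gt_eqF // rmorph1 mul1r scaler_suml.
  apply: eq_bigr => j /eP[_ vj]; rewrite linearZ /= TE -/(v j) vj.
  by rewrite /w !scalerA; congr (_ *: _); ring.
have -> : T z = ofR theta^-1 *: (ofR theta *: T z).
  by rewrite scalerA -rmorphM mulVf ?gt_eqF // rmorph1 scale1r.
rewrite Tz; under eq_bigr do rewrite -scalerA.
rewrite -scaler_sumr scalerA -rmorphM; congr (ofR _ *: _).
by rewrite /theta; field; rewrite !gt_eqF.
Qed.

End ExtremalCertificate.

(** * Existence of optimal certificates *)

Section Rounding.
Variables (R : realType) (k : scalar_kind).
Local Notation K := (scalars R k).
Local Notation ofR := (@of_real R k).

Definition imag_part : K -> R :=
  match k with Reals => fun=> 0 | Complexes => @complex.Im R end.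

Lemma imag_partB (x y : K) : imag_part (x - y) = imag_part x - imag_part y.
Proof. by rewrite /imag_part; case: k x y => [x y|[? ?] [? ?]] //=; rewrite subr0. Qed.

Lemma absK_sq (z : K) : absK z ^+ 2 = real_part z ^+ 2 + imag_part z ^+ 2.
Proof.
rewrite /absK /imag_part; case: k z => /= z.
  by rewrite real_normK ?num_real // expr0n addr0.
by case: z => x y /=; rewrite sqr_sqrtr // addr_ge0 ?sqr_ge0.
Qed.

Lemma imag_part_le (z : K) : `|imag_part z| <= absK z.
Proof.
rewrite -(@ler_pXn2r _ 2) ?nnegrE ?normr_ge0 ?absK_ge0 // real_normK ?num_real //.
by rewrite absK_sq lerDr sqr_ge0.
Qed.

Lemma real_part_norm_le (z : K) : `|real_part z| <= absK z.
Proof.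
rewrite -(@ler_pXn2r _ 2) ?nnegrE ?normr_ge0 ?absK_ge0 // real_normK ?num_real //.
by rewrite absK_sq lerDl sqr_ge0.
Qed.

Lemma rounding_real (b s : R) : 0 < s -> exists M (cell : R -> 'I_M.+1),
  forall x y, `|x| <= b -> `|y| <= b -> cell x = cell y -> `|x - y| <= s.
Proof.
move=> s0; pose t x := Num.truncn ((x + b) / s).
exists (Num.truncn (2 * b / s)), (fun x => inord (t x)) => x y.
have main z : `|z| <= b -> (t z < (Num.truncn (2 * b / s)).+1)%N /\
    s * (t z)%:R <= z + b < s * (t z).+1%:R.
  rewrite ler_norml => /andP[bz zb].
  have z0 : 0 <= (z + b) / s by apply: divr_ge0; [lra|exact: ltW].
  split.
    rewrite ltnS; apply: le_truncn; rewrite ler_pM2r ?invr_gt0 //; lra.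
  have /andP[le lt] := truncn_itv z0.
  by move: le lt; rewrite -/(t z) ler_pdivlMr // ltr_pdivrMr // ![_ * s]mulrC => -> ->.
move=> /main[tx /andP[x1 x2]] /main[ty /andP[y1 y2]] /(congr1 val).
rewrite /= !inordK // => txy; rewrite txy in x1 x2.
move: x2 y2; rewrite -natr1 mulrDr mulr1 => x2 y2.
rewrite ler_norml; apply/andP; split; lra.
Qed.

Lemma rounding n (B kap : R) : 0 <= B -> 0 < kap ->
  exists (C : finType) (cell : 'rV[K]_n -> C), forall v w,
    sqn v <= B -> sqn w <= B -> cell v = cell w -> sqn (v - w) <= kap.
Proof.
(* With [s <= 1], the bound [2 s^2] on a squared coordinate is at most [2 s]; the [+ 1] keeps the
   denominator positive for [n = 0]. *)
move=> B0 kap0; pose s := Num.min 1 (kap / (2 * n%:R + 1)).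
have n0 : 0 <= n%:R :> R by exact: ler0n.
have s0 : 0 < s by rewrite lt_min ltr01 divr_gt0 //; lra.
have s1 : s <= 1 by rewrite ge_min lexx.
have s2 : s * (2 * n%:R + 1) <= kap by rewrite -ler_pdivlMr ?ge_min ?lexx ?orbT //; lra.
have [M [cell hcell]] := rounding_real (B + 1) s0.
exists {ffun 'I_n -> 'I_M.+1 * 'I_M.+1}.
exists (fun v => [ffun a => (cell (real_part (v 0 a)), cell (imag_part (v 0 a)))]).
move=> v w vB wB /ffunP vw.
have bound (u : 'rV[K]_n) a : sqn u <= B -> absK (u 0 a) <= B + 1.
  move=> uB; have : absK (u 0 a) ^+ 2 <= B.
    apply: le_trans uB; rewrite sqnE (bigD1 a) //= lerDl.
    by apply: sumr_ge0 => ? _; exact: sqr_ge0.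
  by have := absK_ge0 (u 0 a); nra.
apply: le_trans (_ : \sum_(a < n) (2 * s) <= _); last first.
  by rewrite sumr_const card_ord -[leLHS]mulr_natr; nra.
rewrite sqnE; apply: ler_sum => a _.
have := vw a; rewrite !ffunE => -[re im]; rewrite !mxE absK_sq raddfB imag_partB /=.
have := hcell _ _ (le_trans (real_part_norm_le _) (bound v a vB))
   (le_trans (real_part_norm_le _) (bound w a wB)) re.
have := hcell _ _ (le_trans (imag_part_le _) (bound v a vB))
   (le_trans (imag_part_le _) (bound w a wB)) im.
rewrite !ler_norml => /andP[? ?] /andP[? ?]; nra.
Qed.

End Rounding.

(** * Merging nearly optimal certificates *)

Section FewPoints.
Variables (R : realType) (k : scalar_kind) (n : nat).
Hypothesis hn : (2 <= n)%N.
Local Notation K := (scalars R k).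
Local Notation ofR := (@of_real R k).
Local Notation c := (etf_angle R k n).

(** Turn [z] by the phase that makes its inner product with [x] real and nonnegative, which brings
    it closest to [x]. *)
Lemma phase_dist (x z : 'rV[K]_n) : exists2 t : K, absK t = 1 &
  sqn (x - t *: z) = (nrm x - nrm z) ^+ 2 + 2 * (nrm x * nrm z - absK (inner x z)).
Proof.
have [t t1 tE] := absK_phase (inner x z); exists (conjK t); first by rewrite absK_conj.
by rewrite sqnB sqnZ absK_conj t1 innerZr conjKK tE of_realK -!nrm_sq; ring.
Qed.

Variable N : 'rV[K]_n -> K.
Hypothesis hN : is_norm N.
Local Notation rnorm := (rnorm N).

Section Merge.
Variables (C : finType) (cell : 'rV[K]_n -> C).
Hypothesis cellP : forall v w : 'rV[K]_n, sqn v <= 4 * n%:R -> sqn w <= 4 * n%:R ->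
  cell v = cell w -> sqn (v - w) <= (1 - c) / 2.
Variables (I : finType) (m : I -> R) (y : I -> 'rV[K]_n) (X : 'M[K]_n).
Hypothesis cert : summing_certificate N m y X.
Variable A : 'M[K]_n.
Local Notation v l := (y l *m adj A).
Hypothesis frame : forall x, \sum_l (ofR (m l) * inner x (v l)) *: v l = x.
Variable eta : R.
Hypotheses (eta0 : 0 < eta) (eta1 : eta <= 16^-1).

Let V l := v l.
Let s l := \sum_j m j * etf_defect V n l j.
Let t l := s l + (nrm (v l) - Num.sqrt n%:R) ^+ 2.
Hypothesis t_small : \sum_l m l * t l <= eta ^+ 2.

Let good l := t l <= eta.

Let m_ge0 l : 0 <= m l. Proof. by case: cert. Qed.
Let s_ge0 l : 0 <= s l.
Proof. by apply: sumr_ge0 => j _; rewrite mulr_ge0 ?etf_defect_ge0. Qed.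
Let t_ge0 l : 0 <= t l. Proof. by rewrite addr_ge0 ?sqr_ge0. Qed.

(** Markov's inequality for [t]. *)
Let bad_mass : \sum_(l | ~~ good l) m l <= eta.
Proof.
rewrite -(ler_pM2l eta0) -expr2; apply: le_trans t_small.
rewrite [leRHS](bigID good) /= -[leLHS]add0r mulr_sumr lerD //.
  by apply: sumr_ge0 => l _; rewrite mulr_ge0.
by apply: ler_sum => l; rewrite -ltNge => /ltW h; rewrite mulrC ler_wpM2l.
Qed.

Let n2 : 2 <= n%:R :> R. Proof. by rewrite ler_nat. Qed.
Let rn : R := Num.sqrt n%:R.
Let rn2 : rn ^+ 2 = n%:R. Proof. by rewrite sqr_sqrtr ?ler0n. Qed.
Let rn0 : 0 <= rn. Proof. exact: sqrtr_ge0. Qed.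

Let good_nrm l : good l -> (nrm (v l) - rn) ^+ 2 <= eta /\ s l <= eta.
Proof.
have := s_ge0 l; have := sqr_ge0 (nrm (v l) - rn).
rewrite /good /t -/rn; move: (s l) => a; lra.
Qed.

(** [eta <= 1/16] puts the length within [1/4] of [sqrt n], which is at least [5/4]. *)
Let good_range l : good l -> 1 <= nrm (v l) /\ sqn (v l) <= 4 * n%:R.
Proof.
move=> /good_nrm[h _]; rewrite -nrm_sq -rn2; have := nrm_ge0 (v l).
have := rn2; have := n2; have := rn0; have := eta1.
move: h; move: (nrm (v l)) rn => r a h e1 a0 a2 a3 r0.
have a4 : 5 / 4 <= a by nra.
have r1 : r - a <= 4^-1 by nra.
have r2 : - 4^-1 <= r - a by nra.
by split; nra.
Qed.

Let dist l j : R := (nrm (v l) - nrm (v j)) ^+ 2 +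
  2 * (nrm (v l) * nrm (v j) - absK (inner (v l) (v j))).

(** In one cell the cosine [u] is at least the midpoint of [c] and 1, so the factor [(u - c)^2] of
    the defect is at least [(1 - c)^2 / 4] and the defect controls [1 - u]. The term [4 * eta]
    accounts for the lengths. *)
Let dist_le l j : good l -> good j -> cell (v l) = cell (v j) ->
  dist l j <= 4 * eta + 8 / (1 - c) ^+ 2 * etf_defect V n j l.
Proof.
move=> gl gj lj; have [rl Bl] := good_range gl; have [rj Bj] := good_range gj.
have [el _] := good_nrm gl; have [ej _] := good_nrm gj.
have c1 := etf_angle_lt1 R k hn; have c0 := etf_angle_gt0 R k hn.
have near := cellP Bl Bj lj.
have e1 : (nrm (v l) - nrm (v j)) ^+ 2 <= 4 * eta.
  have := sqr_ge0 (nrm (v l) + nrm (v j) - 2 * rn).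
  by move: el ej; move: (nrm (v l)) (nrm (v j)) => a b; nra.
rewrite /dist lerD //.
set P := nrm (v l) * nrm (v j).
have P1 : 1 <= P by rewrite /P; nra.
have PE : P * cosine V j l = absK (inner (v l) (v j)).
  by rewrite /P [nrm (v l) * _]mulrC (cosineE V j l) -inner_conj absK_conj.
have u1 : cosine V j l <= 1 by exact: cosine_le1.
have u2 : (1 - c) / 2 <= cosine V j l - c.
  have : 1 - cosine V j l <= (1 - c) / 2.
    have : P * (1 - cosine V j l) <= (1 - c) / 4.
      rewrite mulrBr PE mulr1; move: near; rewrite sqnB -!nrm_sq /P.
      have := real_part_le (inner (v l) (v j)).
      by have := sqr_ge0 (nrm (v l) - nrm (v j)); nra.
    by move: u1 P1; move: (cosine V j l) => u; nra.
  lra.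
rewrite -PE /etf_defect -/(V j) -/(V l) [nrm (V j) * _]mulrC -/P.
move: (cosine V j l) u1 u2 => u u1 u2.
have d0 : 0 < (1 - c) ^+ 2 by rewrite exprn_gt0 // subr_gt0.
have -> : 2 * (P - P * u) = 2 * (P * (1 - u)) by ring.
have -> : 8 / (1 - c) ^+ 2 * (P * ((1 - u) * (u - c) ^+ 2)) =
    2 * (P * (1 - u)) * (4 * (u - c) ^+ 2 / (1 - c) ^+ 2).
  by field; rewrite subr_eq0 gt_eqF.
rewrite -[leLHS]mulr1 ler_wpM2l //.
  by rewrite mulr_ge0 // mulr_ge0 ?subr_ge0 //; lra.
by rewrite ler_pdivlMr // mul1r; nra.
Qed.

Let rep (a : C) : option I := [pick l | good l && (cell (v l) == a)].
Let m' (a : C) : R := \sum_(l | good l && (cell (v l) == a)) m l.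
(** A cell without good points gets the point 0, with mass 0. *)
Let y' (a : C) : 'rV[K]_n := if rep a is Some l then y l else 0.

Let repP l : good l -> exists j, [/\ good j, cell (v l) = cell (v j),
  rep (cell (v l)) = Some j & y' (cell (v l)) = y j].
Proof.
move=> gl; rewrite /y' /rep; case: pickP => [j /andP[gj /eqP jl]|/(_ l)].
  by exists j; rewrite -jl.
by rewrite gl eqxx.
Qed.

(** In isotropic position the Euclidean square is [\sum_l m_l |<w, y_l>|^2], at most [rnorm w ^+ 2]
    because the [y_l] lie in the dual ball. *)
Let rnorm_pull w : exists2 z : 'rV[K]_n, nrm z <= rnorm w &
  forall l, inner w (y l) = inner z (v l).
Proof.
have [_ By m_le1 _] := cert.
have Au := frame_unitmx frame; exists (w *m invmx A) => [|l]; last first.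
  by rewrite -inner_mulmx mulmxKV.
rewrite -(@ler_pXn2r _ 2) ?nnegrE ?nrm_ge0 ?rnorm_ge0 // nrm_sq -(frame_sqn frame).
apply: le_trans (_ : \sum_l m l * rnorm w ^+ 2 <= _).
  apply: ler_sum => l _; rewrite ler_wpM2l // -inner_mulmx mulmxKV //.
  rewrite ler_pXn2r ?nnegrE ?absK_ge0 ?rnorm_ge0 //.
  by have /(dual_ballP hN) := By l.
by rewrite -mulr_suml -[leRHS]mul1r ler_wpM2r ?sqr_ge0.
Qed.

(** Bad points are dropped at the cost [eta], and good ones are moved, up to a phase, to the
    representative of their cell. The inequality [r <= theta / 2 + r^2 / (2 theta)] replaces
    distances by their squares, which the defects control. *)
Lemma merged_certificate (theta : R) : 0 < theta -> exists (m1 : C -> R) (y1 : C -> 'rV[K]_n),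
  [/\ forall a, 0 <= m1 a, forall a, dual_ball N (y1 a), \sum_a m1 a <= 1
    & forall w, rnorm (w *m X) <= \sum_a m1 a * absK (inner w (y1 a)) +
       (eta + theta / 2 + (4 + 8 / (1 - c) ^+ 2 * #|C|%:R) * eta / (2 * theta)) * rnorm w].
Proof.
move=> theta0; have [_ By m_le1 certX] := cert; exists m', y'; split.
- by move=> a; apply: sumr_ge0.
- by move=> a; rewrite /y'; case: (rep a) => [l|]; [exact: By|exact: dual_ball0].
- rewrite -(partition_big (fun l => cell (v l)) predT) //.
  apply: le_trans m_le1; rewrite [leRHS](bigID good) /= lerDl.
  exact: sumr_ge0.
move=> w; apply: le_trans (certX w) _.
have N0 := rnorm_ge0 hN w.
rewrite (bigID good) /=.
have bad : \sum_(l | ~~ good l) m l * absK (inner w (y l)) <= eta * rnorm w.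
  apply: le_trans (_ : \sum_(l | ~~ good l) m l * rnorm w <= _).
    by apply: ler_sum => l _; rewrite ler_wpM2l //; have /(dual_ballP hN) := By l.
  by rewrite -mulr_suml ler_wpM2r.
pose D (l : I) : R := if rep (cell (v l)) is Some j then dist l j else 0.
have pt l : good l -> absK (inner w (y l)) <=
    absK (inner w (y' (cell (v l)))) + rnorm w * (theta / 2 + D l / (2 * theta)).
  move=> gl; have [j [gj lj repj ->]] := repP gl; rewrite /D repj.
  have [z zw zE] := rnorm_pull w; rewrite !zE.
  have [ph ph1 dE] := phase_dist (v l) (v j); rewrite -/(dist l j) in dE.
  rewrite -[X in absK (inner z X)](subrK (ph *: v j)) innerDr addrC.
  apply: le_trans (absKD _ _) _; rewrite innerZr absKM absK_conj ph1 mul1r lerD2l.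
  apply: le_trans (cauchy_schwarz _ _) _.
  apply: ler_pM; rewrite ?nrm_ge0 // -dE -nrm_sq; move: (nrm _) => r.
  rewrite -subr_ge0.
  have -> : theta / 2 + r ^+ 2 / (2 * theta) - r = (r - theta) ^+ 2 / (2 * theta).
    by field; rewrite gt_eqF.
  by rewrite divr_ge0 ?sqr_ge0 // mulr_ge0 // ltW.
(* A representative is good, so its total defect against all points is at most [eta]; summing over
   cells costs only the factor [#|C|]. *)
have sumD : \sum_(l | good l) m l * D l <= (4 + 8 / (1 - c) ^+ 2 * #|C|%:R) * eta.
  have c1 := etf_angle_lt1 R k hn.
  have k0 : 0 <= 8 / (1 - c) ^+ 2 by rewrite divr_ge0 ?sqr_ge0.
  apply: le_trans (_ : \sum_(l | good l) (4 * eta * m l + 8 / (1 - c) ^+ 2 *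
      (if rep (cell (v l)) is Some j then m l * etf_defect V n j l else 0)) <= _).
    apply: ler_sum => l gl; have [j [gj lj repj _]] := repP gl; rewrite /D repj.
    rewrite [4 * eta * _]mulrC [X in _ + X]mulrCA -mulrDr ler_wpM2l //.
    exact: dist_le.
  rewrite big_split /= -!mulr_sumr [leRHS]mulrDl lerD //.
    rewrite -[leRHS]mulr1 ler_wpM2l //; first by rewrite mulr_ge0 // ltW.
    apply: le_trans m_le1; rewrite [leRHS](bigID good) /= lerDl.
    exact: sumr_ge0.
  rewrite -mulrA ler_wpM2l // (partition_big (fun l => cell (v l)) predT) //=.
  rewrite mulr_natl -sumr_const; apply: ler_sum => a _.
  case E : (rep a) => [j|]; last first.
    by rewrite big1 ?ltW // => l /andP[_ /eqP ->]; rewrite E.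
  have gj : good j by move: E; rewrite /rep; case: pickP => // i /andP[gi _] [<-].
  have [_ sj] := good_nrm gj; apply: le_trans sj.
  rewrite /s [leRHS](bigID (fun l => good l && (cell (v l) == a))) /= -[leLHS]addr0 lerD //.
    by apply: ler_sum => l /andP[_ /eqP ->]; rewrite E.
  by apply: sumr_ge0 => l _; rewrite mulr_ge0 ?etf_defect_ge0.
have goodS : \sum_(l | good l) m l * absK (inner w (y l)) <=
    \sum_a m' a * absK (inner w (y' a)) +
    rnorm w * (theta / 2 + (4 + 8 / (1 - c) ^+ 2 * #|C|%:R) * eta / (2 * theta)).
  apply: le_trans (_ : \sum_(l | good l) (m l * absK (inner w (y' (cell (v l)))) +
    rnorm w * (theta / 2 * m l + (2 * theta)^-1 * (m l * D l))) <= _).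
    apply: ler_sum => l gl; apply: le_trans (ler_wpM2l (m_ge0 l) (pt l gl)) _.
    by rewrite le_eqVlt; apply/orP; left; apply/eqP; ring.
  rewrite big_split /= (partition_big (fun l => cell (v l)) predT) //=.
  have -> : \sum_a \sum_(l | good l && (cell (v l) == a)) 
      m l * absK (inner w (y' (cell (v l)))) =
      \sum_a m' a * absK (inner w (y' a)).
    by apply: eq_bigr => a _; rewrite mulr_suml; apply: eq_bigr => l /andP[_ /eqP ->].
  rewrite lerD2l -mulr_sumr ler_wpM2l // big_split /= -!mulr_sumr lerD //.
    rewrite -[leRHS]mulr1 ler_wpM2l //; first by rewrite divr_ge0 // ltW.
    apply: le_trans m_le1; rewrite [leRHS](bigID good) /= lerDl.
    exact: sumr_ge0.
  by rewrite [leRHS]mulrC ler_wpM2l // invr_ge0 mulr_ge0 // ltW.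
move: bad goodS; move: (\sum_(l | good l) _) => S1; move: (\sum_(l | ~~ good l) _) => S2.
move: (\sum_a _) => S3; lra.
Qed.

End Merge.

(* The number of points does not depend on [theta], so that limits exist. *)
Lemma few_points : exists C : finType, forall theta : R, 0 < theta ->
  exists2 eps : R, 0 < eps & forall (I : finType) (m : I -> R) y X,
    summing_certificate N m y X -> delta R k n - eps < real_part (\tr X) ->
    exists (m1 : C -> R) (y1 : C -> 'rV[K]_n),
    [/\ forall a, 0 <= m1 a, forall a, dual_ball N (y1 a), \sum_a m1 a <= 1
      & forall w, rnorm (w *m X) <=
          \sum_a m1 a * absK (inner w (y1 a)) + theta * rnorm w].
Proof.
have c1 := etf_angle_lt1 R k hn.
have n0 : 0 <= n%:R :> R by exact: ler0n.
have [||C [cell cellP]] := @rounding R k n (4 * n%:R) ((1 - c) / 2).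
- by rewrite mulr_ge0.
- by rewrite divr_gt0 // subr_gt0.
exists C => theta theta0.
pose kap : R := 4 + 8 / (1 - c) ^+ 2 * #|C|%:R.
have kap0 : 0 < kap.
  by rewrite ltr_wpDr // mulr_ge0 ?ler0n // divr_ge0 // sqr_ge0.
(* [16^-1] is for [good_range]; the other two bounds make the error of [merged_certificate] at most
   [theta/4 + theta/2 + theta/4]. *)
pose eta : R := Num.min 16^-1 (Num.min (theta / 4) (theta ^+ 2 / (2 * kap))).
have eta0 : 0 < eta by rewrite !lt_min invr_gt0 !divr_gt0 ?exprn_gt0 ?mulr_gt0 ?ltr0n.
have eta1 : eta <= 16^-1 by rewrite ge_min lexx.
have eta2 : eta <= theta / 4 by rewrite !ge_min lexx !orbT.
have eta3 : eta <= theta ^+ 2 / (2 * kap) by rewrite !ge_min lexx !orbT.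
have e0 := energy_slope_gt0 R k hn; have g0 := energy_gap_gt0 R k hn.
set e := energy_slope R k n in e0; set g := energy_gap R k n in g0.
(* The weighted defects will sum to at most [eps / e], the squared deviations of length to at most
   [2 eps / g]. *)
pose D := e^-1 + 2 / g.
have D0 : 0 < D.
  by apply: addr_gt0; [rewrite invr_gt0|rewrite divr_gt0 ?ltr0n].
exists (Num.min (g / 2) (eta ^+ 2 / D)).
  by rewrite lt_min !divr_gt0 ?exprn_gt0 ?ltr0n.
set eps := Num.min _ _ => I m y X cert trX.
have eps1 : eps <= g / 2 by rewrite ge_min lexx.
have eps2 : eps * D <= eta ^+ 2 by rewrite -ler_pdivlMr // ge_min lexx orbT.
have [m_ge0 By m_le1 _] := cert.
have [r [A [hr frame _]]] := certificate_delta hN cert hn.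
set v := fun l => y l *m adj A in frame * => /= h.
set T1 := \sum_l m l * _ in h; set T2 := \sum_i \sum_j m i * m j * _ in h.
set B := \sum_l m l * nrm (v l) in h.
have T1_ge0 : 0 <= T1.
  apply: sumr_ge0 => l _; rewrite mulr_ge0 // subr_ge0.
  exact: (certificate_energy_bound hN cert A l).
have T2_ge0 : 0 <= T2.
  do 2!(apply: sumr_ge0 => ? _); apply: mulr_ge0; first exact: mulr_ge0.
  exact: etf_defect_ge0.
have B2 := sum_nrm_sq m_ge0 frame; rewrite -/B in B2.
have rn : r%:R <= n%:R :> R by rewrite ler_nat.
have B2r : B ^+ 2 <= r%:R by apply: le_trans B2 _; rewrite -[leRHS]mul1r ler_wpM2r ?ler0n.
have B2n : B ^+ 2 <= n%:R by exact: le_trans B2r rn.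
have eT2 : 0 <= e * T2 by rewrite mulr_ge0 // ltW.
have gB : 0 <= g * (n%:R - B ^+ 2) by rewrite mulr_ge0 ?subr_ge0 // ltW.
have T2e : T2 <= eps / e.
  by rewrite ler_pdivlMr // mulrC; move: h trX T1_ge0 eT2 gB; rewrite -/e -/g; lra.
have Bg : n%:R - B ^+ 2 <= eps / g.
  by rewrite ler_pdivlMr // mulrC; move: h trX T1_ge0 eT2 gB; rewrite -/e -/g; lra.
(* [n - r <= n - B^2 <= 1/2] for integers [r <= n]; this is the role of [eps <= g / 2]. *)
have rnE : r = n.
  apply/eqP; rewrite eqn_leq hr -ltnS -(ltr_nat R) -natr1.
  have : eps / g <= 2^-1 by rewrite ler_pdivrMr // mulrC.
  by move: Bg B2r; lra.
subst r.
have B0 : 0 <= B by apply: sumr_ge0 => l _; rewrite mulr_ge0 ?nrm_ge0.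
have s0 : 0 <= Num.sqrt n%:R :> R by exact: sqrtr_ge0.
have s2 : Num.sqrt n%:R ^+ 2 = n%:R :> R by rewrite sqr_sqrtr.
have t_small : \sum_l m l * (\sum_j m j * etf_defect v n l j +
    (nrm (v l) - Num.sqrt n%:R) ^+ 2) <= eta ^+ 2.
  apply: le_trans eps2.
  have -> : eps * D = eps / e + 2 * (eps / g) by rewrite /D; ring.
  have -> : \sum_l m l * (\sum_j m j * etf_defect v n l j + (nrm (v l) - Num.sqrt n%:R) ^+ 2)
      = T2 + (\sum_l m l * sqn (v l) - 2 * Num.sqrt n%:R * B + n%:R * \sum_l m l).
    rewrite /T2 /B !mulr_sumr -sumrB -!big_split; apply: eq_bigr => l _ /=.
    rewrite mulrDr mulr_sumr; congr (_ + _).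
      by apply: eq_bigr => j _; rewrite mulrA.
    by rewrite -nrm_sq -[in n%:R * _]s2; ring.
  rewrite (frame_trace frame) lerD //.
  have sB : B <= Num.sqrt n%:R by rewrite -(@ler_pXn2r _ 2) ?nnegrE // s2.
  have : n%:R * \sum_l m l <= n%:R * 1 by rewrite ler_wpM2l.
  have : 0 <= (Num.sqrt n%:R - B) * B by rewrite mulr_ge0 // subr_ge0.
  move: Bg s2; move: (eps / g) (Num.sqrt _) (\sum_l m l) => u a M; lra.
have [m1 [y1 [m1_ge0 By1 m1_le1 c1X]]] :=
  merged_certificate cellP cert frame eta0 eta1 t_small theta0.
exists m1, y1; split=> // w; apply: le_trans (c1X w) _.
rewrite lerD2l ler_wpM2r ?rnorm_ge0 //.
have : kap * eta / (2 * theta) <= theta / 4.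
  rewrite ler_pdivrMr ?mulr_gt0 //.
  move: eta3; rewrite ler_pdivlMr ?mulr_gt0 //; lra.
rewrite /kap; lra.
Qed.

End FewPoints.

(* Over the reals the imaginary parts are [0] and [b] is ignored. *)
Lemma scalar_of_parts (R : realType) (k : scalar_kind) (a b : R) :
  exists l : scalars R k, real_part l = a /\
    forall x : scalars R k, `|imag_part x - imag_part l| <= `|imag_part x - b|.
Proof.
rewrite /imag_part; case: k => /=; last by exists (a +i* b)%C.
by exists a; split=> // x; rewrite subr0 normr0.
Qed.

(** * Limits along an ultrafilter *)

Section UltraLimits.
Import numFieldNormedType.Exports.
Variables (R : realType) (k : scalar_kind).
Local Notation K := (scalars R k).
Local Notation ofR := (@of_real R k).
Variables (U : set_system nat) (UU : UltraFilter U).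

(** The image ultrafilter has a cluster point by compactness and converges to it. One ultrafilter
    serves all coordinates at once, without extracting subsequences. *)
Lemma ultra_limit (f : nat -> R) (b : R) : (forall j, `|f j| <= b) ->
  exists l : R, f @ U --> l.
Proof.
move=> fb.
have UF : ProperFilter U by exact: ultra_proper.
have fU : (f @ U) `[- b, b]%classic.
  have UT : U setT by exact: filterT.
  by apply: (@filterS _ U _ setT) UT => j _; have := fb j; rewrite ler_norml /= in_itv.
have [l [_ cl]] := @segment_compact R (- b) b _ (fmap_proper_filter f UF) fU.
exists l => A lA; have [//|UA] := in_ultra_setVsetC (f @^-1` A) UU.
have : (f @ U) (~` A) by [].
by move=> /cl /(_ lA) [x []].
Qed.

(** Convergence is measured by a real sequence, which treats both fields alike. *)
Definition tends (z : nat -> K) (l : K) : Prop := (fun j => absK (z j - l)) @ U --> (0 : R).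

Lemma tends_limit (z : nat -> K) (b : R) : (forall j, absK (z j) <= b) ->
  exists l, tends z l.
Proof.
move=> zb.
have UF : ProperFilter U by exact: ultra_proper.
have [a az] : exists a : R, (fun j => real_part (z j)) @ U --> a.
  by apply: (@ultra_limit _ b) => j; exact: le_trans (real_part_norm_le _) (zb j).
have [a' a'z] : exists a : R, (fun j => imag_part (z j)) @ U --> a.
  by apply: (@ultra_limit _ b) => j; exact: le_trans (imag_part_le _) (zb j).
have [l [la la']] := scalar_of_parts k a a'.
exists l; pose H j := `|real_part (z j) - a| + `|imag_part (z j) - a'|.
have zH j : 0 <= absK (z j - l) <= H j.
  rewrite absK_ge0 /=.
  apply: le_trans (_ : `|real_part (z j - l)| + `|imag_part (z j - l)| <= _).
    rewrite -(@ler_pXn2r _ 2) ?nnegrE ?absK_ge0 ?addr_ge0 // absK_sq.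
    rewrite sqrrD !real_normK ?num_real // [leRHS]addrAC lerDl.
    by rewrite mulrn_wge0 // mulr_ge0.
  by rewrite raddfB /= la imag_partB lerD2l.
have H0 : H @ U --> (0 : R).
  rewrite -[X in _ --> X](addr0 (0 : R)); apply: cvgD.
    by rewrite -(normr0 R) -(subrr a); apply: cvg_norm; apply: cvgB => //; exact: cvg_cst.
  by rewrite -(normr0 R) -(subrr a'); apply: cvg_norm; apply: cvgB => //; exact: cvg_cst.
exact: (squeeze_cvgr (nearW _ zH) (cvg_cst _) H0).
Qed.

Let UF : ProperFilter U. Proof. exact: ultra_proper. Qed.

Lemma cvg_big_sum (I : Type) (r : seq I) (f : I -> nat -> R) (l : I -> R) :
  (forall i, f i @ U --> l i) ->
  (fun j => \sum_(i <- r) f i j) @ U --> \sum_(i <- r) l i.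
Proof.
move=> fl; elim: r => [|i r IHr].
  under eq_fun do rewrite big_nil.
  by rewrite big_nil; exact: cvg_cst.
under eq_fun do rewrite big_cons.
by rewrite big_cons; apply: cvgD.
Qed.

Lemma tends_absK (z : nat -> K) l : tends z l -> (fun j => absK (z j)) @ U --> absK l.
Proof.
move=> zl; apply: (@squeeze_cvgr _ _ _ _ (fun j => absK l - absK (z j - l))
   (fun j => absK l + absK (z j - l))).
- apply: nearW => j; apply/andP; split.
    by have := absKD (z j) (l - z j); rewrite subrKC -[absK (l - _)]absKN opprB; lra.
  by have := absKD l (z j - l); rewrite subrKC.
- by rewrite -[X in _ --> X]subr0; apply: cvgB => //; exact: cvg_cst.
- by rewrite -[X in _ --> X]addr0; apply: cvgD => //; exact: cvg_cst.
Qed.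

Lemma tends_inner n (w : 'rV[K]_n) (y : nat -> 'rV[K]_n) (y0 : 'rV[K]_n) :
  (forall a, tends (fun j => y j 0 a) (y0 0 a)) ->
  tends (fun j => inner w (y j)) (inner w y0).
Proof.
move=> yl; pose H j := \sum_a absK (w 0 a) * absK (y j 0 a - y0 0 a).
have wH j : 0 <= absK (inner w (y j) - inner w y0) <= H j.
  rewrite absK_ge0 -innerBr; apply: le_trans (absK_sum _ _ _) _.
  by apply: ler_sum => a _; rewrite absKM absK_conj !mxE.
have H0 : H @ U --> (0 : R).
  rewrite (_ : 0 = \sum_(a < n) absK (w 0 a) * 0 :> R); last first.
    by rewrite big1 // => a _; rewrite mulr0.
  by apply: cvg_big_sum => a; apply: cvgMr; exact: yl.
exact: (squeeze_cvgr (nearW _ wH) (cvg_cst _) H0).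
Qed.

End UltraLimits.

Section CompactCertificates.
Import numFieldNormedType.Exports.
Variables (R : realType) (k : scalar_kind) (n : nat).
Local Notation K := (scalars R k).
Variable N : 'rV[K]_n -> K.
Hypothesis hN : is_norm N.
Local Notation rnorm := (rnorm N).

(** With [C] fixed the data stay bounded: weights in [[0, 1]], points in the dual ball, and matrices
    controlled by [rnorm (w *m X) <= rnorm w]. The conditions pass to the limit, and the errors,
    taken along [harmonic], disappear. *)
Lemma compact_certificates (C : finType) (t0 : R) :
  (forall theta : R, 0 < theta -> exists (m : C -> R) (y : C -> 'rV[K]_n) (X : 'M[K]_n),
    [/\ (forall a, 0 <= m a) /\ \sum_a m a <= 1, forall a, dual_ball N (y a),
      forall w, rnorm (w *m X) <= rnorm w,
      forall w, rnorm (w *m X) <= \sum_a m a * absK (inner w (y a)) + theta * rnorm w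
      & t0 - theta <= real_part (\tr X)]) ->
  exists (m : C -> R) (y : C -> 'rV[K]_n) (X : 'M[K]_n),
    summing_certificate N m y X /\ t0 <= real_part (\tr X).
Proof.
move=> approx.
have /choice[D hD] (j : nat) : exists D : (C -> R) * (C -> 'rV[K]_n) * 'M[K]_n,
    [/\ (forall a, 0 <= D.1.1 a) /\ \sum_a D.1.1 a <= 1, forall a, dual_ball N (D.1.2 a),
      forall w, rnorm (w *m D.2) <= rnorm w,
      forall w, rnorm (w *m D.2) <= \sum_a D.1.1 a * absK (inner w (D.1.2 a))
         + harmonic j * rnorm w
      & t0 - harmonic j <= real_part (\tr D.2)].
  by have [m [y [X h]]] := approx (harmonic j) (harmonic_gt0 j); exists (m, y, X).
pose m j := (D j).1.1; pose y j := (D j).1.2; pose X j := (D j).2.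
have [U [UU ooU]] := ultraFilterLemma (F := \oo) _.
have UF : ProperFilter U by exact: ultra_proper.
have harm : harmonic @ U --> (0 : R).
  by apply: cvg_trans (@cvg_harmonic R); exact: cvg_app.
have [Cn Cn0 hC] := coord_le_rnorm hN.
have /choice[m0 m0P] a : exists l : R, (fun j => m j a) @ U --> l.
  apply: (@ultra_limit _ _ UU _ 1) => j; have [[mj mj1] _ _ _ _] := hD j.
  rewrite ger0_norm; last exact: mj.
  by apply: le_trans mj1; rewrite (bigD1 a) //= lerDl; apply: sumr_ge0.
have /choice[y0' y0P'] (ab : C * 'I_n) : exists l, tends U (fun j => y j ab.1 0 ab.2) l.
  apply: (@tends_limit _ _ _ UU _ (rnorm (delta_mx 0 ab.2))) => j.
  have [_ Bj _ _ _] := hD j; have /(dual_ballP hN)/(_ (delta_mx 0 ab.2)) := Bj ab.1.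
  by rewrite inner_deltal absK_conj.
pose y0 a : 'rV[K]_n := \row_b y0' (a, b).
have y0P a b : tends U (fun j => y j a 0 b) (y0 a 0 b) by rewrite mxE; exact: y0P' (a, b).
have /choice[X0' X0P'] (ab : 'I_n * 'I_n) : exists l, tends U (fun j => X j ab.1 ab.2) l.
  apply: (@tends_limit _ _ _ UU _ (Cn * rnorm (delta_mx 0 ab.1))) => j.
  have [_ _ hX _ _] := hD j.
  have -> : X j ab.1 ab.2 = ((delta_mx 0 ab.1 : 'rV[K]_n) *m X j) 0 ab.2 by rewrite -rowE mxE.
  by apply: le_trans (hC _ _) _; rewrite ler_wpM2l.
pose X0 : 'M[K]_n := \matrix_(a, b) X0' (a, b).
have X0P a b : tends U (fun j => X j a b) (X0 a b) by rewrite mxE; exact: X0P' (a, b).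
exists m0, y0, X0; split; first split.
- move=> a; apply: (cvgr_to_ge (m0P a)); apply: nearW => j.
  by have [[mj _] _ _ _ _] := hD j; exact: mj.
- move=> a; apply/(dual_ballP hN) => x.
  apply: (cvgr_to_le (tends_absK UU (tends_inner UU x (y0P a)))); apply: nearW => j.
  by have [_ Bj _ _ _] := hD j; have /(dual_ballP hN) := Bj a.
- have lim := cvg_big_sum UU (r := index_enum C) (f := fun a j => m j a) m0P.
  apply: (cvgr_to_le lim); apply: nearW => j.
  by have [[_ mj] _ _ _ _] := hD j.
- move=> w; pose E j :=
    \sum_a \sum_b absK (w 0 a) * absK (X j a b - X0 a b) * rnorm (delta_mx 0 b).
  have E0 : E @ U --> (0 : R).
    rewrite (_ : 0 = \sum_(a < n) \sum_(b < n)
      absK (w 0 a) * 0 * rnorm (delta_mx 0 b) :> R); last first.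
      by rewrite big1 // => a _; rewrite big1 // => b _; rewrite mulr0 mul0r.
    do 2!(apply: (cvg_big_sum UU) => ?); apply: cvgMl; apply: cvgMr; exact: X0P.
  have lim : (fun j => \sum_a m j a * absK (inner w (y j a)) + harmonic j * rnorm w + E j) @ U
     --> (\sum_a m0 a * absK (inner w (y0 a)) + 0 * rnorm w + 0).
    apply: cvgD => //; apply: cvgD; last exact: cvgMl.
    apply: (cvg_big_sum UU) => a; apply: cvgM; first exact: m0P.
    exact: (tends_absK UU (tends_inner UU w (y0P a))).
  rewrite mul0r !addr0 in lim; apply: (cvgr_to_ge lim); apply: nearW => j.
  have [_ _ _ hX _] := hD j; apply: le_trans (lerD (hX w) (lexx (E j))).
  have -> : w *m X0 = w *m X j + w *m (X0 - X j) by rewrite mulmxBr subrKC.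
  apply: le_trans (rnormD hN _ _) _; rewrite lerD2l.
  rewrite (row_sum_delta (w *m (X0 - X j))); apply: le_trans (rnorm_sum hN _ _ _) _.
  rewrite /E exchange_big; apply: ler_sum => b _; rewrite rnormZ // -mulr_suml.
  rewrite ler_wpM2r ?rnorm_ge0 // mxE; apply: le_trans (absK_sum _ _ _) _.
  by apply: ler_sum => a _; rewrite absKM !mxE -[absK (_ - _)]absKN opprB.
pose E j := \sum_a absK (X j a a - X0 a a).
have E0 : E @ U --> (0 : R).
  rewrite (_ : 0 = \sum_(a < n) 0 :> R); last by rewrite big1.
  by apply: (cvg_big_sum UU) => a; exact: X0P.
have lim : (fun j => t0 - harmonic j - E j) @ U --> (t0 - 0 - 0).
  by apply: cvgB => //; apply: cvgB => //; exact: cvg_cst.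
rewrite !subr0 in lim; apply: (cvgr_to_le lim); apply: nearW => j.
have [_ _ _ _ hX] := hD j; rewrite lerBlDr; apply: le_trans hX _.
have -> : \tr (X j) = \tr X0 + \sum_a (X j a a - X0 a a).
  by rewrite /mxtrace sumrB addrC subrK.
rewrite raddfD /= lerD2l; apply: le_trans (real_part_le _) _; exact: absK_sum.
Qed.

End CompactCertificates.

(** * Attainment and the two implications *)

Section Assembly.
Variables (R : realType) (k : scalar_kind) (n : nat).
Hypothesis hn : (2 <= n)%N.
Local Notation K := (scalars R k).
Local Notation ofR := (@of_real R k).
Variable N : 'rV[K]_n -> K.
Hypothesis hN : is_norm N.
Local Notation rnorm := (rnorm N).

Lemma near_optimal_certificate (eps : R) : 0 < eps -> lambda N = (delta R k n)%:E ->
  exists p (m : 'I_p -> R) y X, summing_certificate N m y X /\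
    delta R k n - eps < real_part (\tr X).
Proof.
move=> eps0 lamE; apply: contrapT => no; have d0 := delta_gt0 R k hn.
(* [lambda_le] asks for a nonnegative constant; [delta] is positive, so the maximum is still below
   it. *)
have : (lambda N <= (Num.max 0 (delta R k n - eps))%:E)%E.
  apply: (lambda_le hN); first by rewrite le_max lexx.
  move=> p m y X cert; rewrite le_max leNgt; apply/orP; right; rewrite leNgt.
  by apply/negP => lt; apply: no; exists p, m, y, X.
by rewrite lamE lee_fin le_max !leNgt d0 /= gtrBl eps0.
Qed.

Lemma optimal_certificate : lambda N = (delta R k n)%:E ->
  exists (I : finType) (m : I -> R) y X, [/\ forall l, 0 < m l,
    summing_certificate N m y X & delta R k n <= real_part (\tr X)].
Proof.
move=> lamE; have [C few] := few_points hn hN.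
have [theta theta0|m [y [X [[m_ge0 By m_le1 certX] trX]]]] :=
    @compact_certificates R k n N hN C (delta R k n).
  have [eps eps0 feweps] := few theta theta0.
  have [|p [m [y [X [cert trX]]]]] := @near_optimal_certificate (Num.min eps theta) _ lamE.
    by rewrite lt_min eps0.
  have [m1 [y1 [m1_ge0 By1 m1_le1 m1X]]] : exists (m1 : C -> R) (y1 : C -> 'rV[K]_n),
    [/\ forall a, 0 <= m1 a, forall a, dual_ball N (y1 a), \sum_a m1 a <= 1
      & forall w, rnorm (w *m X) <=
          \sum_a m1 a * absK (inner w (y1 a)) + theta * rnorm w].
    apply: feweps cert _; apply: le_lt_trans trX.
    by rewrite lerD2l lerN2 ge_min lexx.
  exists m1, y1, X; split=> // [w|]; last first.
    by rewrite ltW // (le_lt_trans _ trX) // lerD2l lerN2 ge_min lexx orbT.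
  have [m_ge0 By m_le1 certX] := cert; apply: le_trans (certX w) _.
  apply: le_trans (_ : \sum_l m l * rnorm w <= _).
    by apply: ler_sum => l _; rewrite ler_wpM2l //; have /(dual_ballP hN) := By l.
  by rewrite -mulr_suml -[leRHS]mul1r ler_wpM2r ?rnorm_ge0.
(* Points of weight zero are discarded, since the equality case concludes at every point from the
   positivity of its weight. *)
pose A : {pred C} := [pred a | 0 < m a]; pose I := {a : C | a \in A}.
have sumI (F : C -> R) : \sum_a m a * F a = \sum_(l : I) m (val l) * F (val l).
  rewrite -(big_sub _ (fun a => m a * F a)) [RHS]big_mkcond; apply: eq_bigr => a _.
  rewrite inE; case: ltP => // ma; have -> : m a = 0 by apply/eqP; rewrite eq_le ma m_ge0.
  by rewrite mul0r.
exists I, (fun l => m (val l)), (fun l => y (val l)), X; split=> //.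
  by move=> l; exact: valP l.
split=> [l|l||w]; [exact: m_ge0|exact: By| |
  by rewrite -(sumI (fun a => absK (inner w (y a))))].
have -> : \sum_(l : I) m (val l) = \sum_(l : I) m (val l) * 1.
  by apply: eq_bigr => l _; rewrite mulr1.
by rewrite -(sumI (fun=> 1)); under eq_bigr do rewrite mulr1.
Qed.

Lemma dual_ball_absconv (J : finType) (a : J -> K) (y : J -> 'rV[K]_n) :
  \sum_j absK (a j) <= 1 -> (forall j, dual_ball N (y j)) ->
  dual_ball N (\sum_j a j *: y j).
Proof.
move=> a1 By; apply/(dual_ballP hN) => x; rewrite inner_sumr.
apply: le_trans (absK_sum _ _ _) _.
apply: le_trans (_ : \sum_j absK (a j) * rnorm x <= _).
  apply: ler_sum => j _; rewrite innerZr absKM absK_conj ler_wpM2l ?absK_ge0 //.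
  by have /(dual_ballP hN) := By j.
by rewrite -mulr_suml -[leRHS]mul1r ler_wpM2r ?rnorm_ge0.
Qed.

Lemma linear_surj_inj (T : {linear 'rV[K]_n -> 'rV[K]_n}) :
  (forall x, exists z, T z = x) -> injective T.
Proof.
move=> Tsurj; have /choice[r rE] i : exists z, T z = delta_mx 0 i :> 'rV[K]_n.
  exact: Tsurj.
have : (\matrix_i r i) *m lin1_mx T = 1%:M.
  apply/row_matrixP => i; rewrite row_mul rowK mul_rV_lin1 rE.
  by rewrite rowE mulmx1.
case/mulmx1_unit => _ Tunit x z; rewrite -!mul_rV_lin1.
move=> /(congr1 (mulmx^~ (invmx (lin1_mx T)))).
by rewrite !mulmxK.
Qed.

End Assembly.

Theorem theorem1p2 (R : realType) (k : scalar_kind) (n : nat)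
    (hn : (2 <= n)%N)
    (N : 'rV[scalars R k]_n -> scalars R k) (hN : is_norm N) :
  lambda N = (delta R k n)%:E <->
  exists (w : 'I_(dmax k n) -> 'rV[scalars R k]_n)
         (T : {linear 'rV[scalars R k]_n -> 'rV[scalars R k]_n}),
    [/\ maximal_ETF w,
        absconv (range w) `<=` T @` dual_ball N
      & T @` dual_ball N `<=`
          [set of_real k (n%:R / ((dmax k n)%:R * delta R k n)) *: z
             | z in zonotope w]].
Proof.
have absK1P (a : scalars R k) : (`|a| <= 1) = (absK a <= 1).
  by rewrite -(absK_le_real a 1) rmorph1.
have d0 : 0 < (dmax k n)%:R :> R by rewrite ltr0n dmax_gt0.
have delta0 := delta_gt0 R k hn.
have n0 : 0 < n%:R :> R by rewrite ltr0n (leq_trans _ hn).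
split=> [lamE|[w [T [etf wT TZ]]]].
  have [I [m [y [X [m_gt0 cert trX]]]]] := optimal_certificate hn hN lamE.
  have [w [T [y' [etf yw TB]]]] := extremal_certificate hn hN m_gt0 cert trX.
  exists w, T; split=> // [_ [p [a [x [_ xw a1 ->]]]]|_ [z Bz <-]].
    have /choice[s sE] j : exists s, w s = x j by have [s _ <-] := xw j; exists s.
    exists (\sum_j a j *: y' (s j)).
      apply: (dual_ball_absconv hN) => [|j]; last by have [] := yw (s j).
      rewrite -(ler_of_real k) rmorph_sum rmorph1; apply: le_trans a1.
      by apply: ler_sum => j _; rewrite /= -normKE.
    rewrite linear_sum; apply: eq_bigr => j _; rewrite linearZ /=.
    by have [_ ->] := yw (s j); rewrite sE.
  have [a a1 TzE] := TB z Bz; exists (\sum_s a s *: w s) => //.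
  by exists a; split=> // i; rewrite absK1P.
apply/eqP; rewrite eq_le; apply/andP; split.
  apply: (lambda_le hN); first exact: ltW.
  by move=> p m y X cert; exact: (certificate_le_delta hN cert hn).
have /choice[y yP] s : exists z, dual_ball N z /\ T z = w s.
  have [|z Bz zE] := wT (w s); last by exists z.
  exists 1%N, (fun=> 1), (fun=> w s); split=> //.
  - by rewrite sumr_const card_ord normr1.
  - by rewrite big_ord1 scale1r.
(* The frame vectors span and are values of [T], so [T] is onto, hence injective, and the zonotope
   inclusion can be pulled back. *)
have Tinj : injective T.
  apply: linear_surj_inj => x; have [_ [alpha alphaE]] := etf.
  exists (alpha *: \sum_s inner x (w s) *: y s); rewrite linearZ linear_sum [RHS]alphaE /=.
  by congr (_ *: _); apply: eq_bigr => s _; rewrite linearZ /=; have [_ ->] := yP s.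
pose mu := (dmax k n)%:R * delta R k n / n%:R.
have muV : mu^-1 = n%:R / ((dmax k n)%:R * delta R k n) by rewrite invf_div.
have -> : delta R k n = n%:R * mu / (dmax k n)%:R.
  by rewrite /mu; field; rewrite !gt_eqF.
apply: (lambda_ge hN (y := y)); first exact: dmax_gt0.
- by rewrite divr_gt0 ?mulr_gt0.
- by move=> s; have [] := yP s.
move=> z Bz; have [|_ [a [a1 ->]] zE] := TZ (T z); first by exists z.
exists a => [s|]; first by rewrite -absK1P.
apply: Tinj; rewrite -zE muV linearZ /= [T _]linear_sum; congr (_ *: _).
by apply: eq_bigr => s _; rewrite linearZ /=; have [_ ->] := yP s.
Qed.
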